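(* Let $N\ge 1$, let $F=(F_1,\dots,F_N):\mathbb{C}^N\to\mathbb{C}^N$ be a regular polynomial map of degree $d\ge 1$ with leading homogeneous part $F_h$, and let $K=\{z\in\mathbb{C}^N: |F_i(z)|\le 1\text{ for all } i=1,\dots,N\}$. Then $$d_\infty(K)=|\operatorname{Res}(F_h)|^{-1/(Nd^N)}.$$
   Context: Regular maps: a polynomial map $F:\mathbb{C}^N\to\mathbb{C}^N$ is regular if it extends to a holomorphic endomorphism of $\mathbb{P}^N$; its coordinate functions then all have the same degree $d$, called the degree of $F$. Equivalently (for $d\ge1$), each component has degree $d$ and the leading homogeneous part $F_h$ (the $N$-tuple of degree-$d$ homogeneous parts of the components) satisfies $F_h^{-1}\{0\}=\{0\}$. Resultant: for an $N$-tuple $H=(H_1,\dots,H_N)$ of homogeneous polynomials of degree $d$ in $N$ variables, $\operatorname{Res}(H)$ is the multiresultant (Gelfand–Kapranov–Zelevinsky): the unique absolutely irreducible polynomial with integer coefficients in the coefficients of $H$ such that (i) $\operatorname{Res}(H)\ne0$ if and only if $H$ is regular (i.e. $H^{-1}\{0\}=\{0\}$), and (ii) $\operatorname{Res}(z_1^d,\dots,z_N^d)=1$. It is homogeneous of degree $d^{N-1}$ in the coefficients of each $H_i$. Transfinite diameter (Fekete–Leja): for $n\ge 1$ let $e_1,\dots,e_{M(n)}$ be the monomials in $N$ variables of degree $\le n$, where $M(n)=\binom{N+n}{N}$, and let $D(n)=N\binom{N+n}{N+1}$. For bounded $E\subset\mathbb{C}^N$ put $$d_n(E)=\Big(\sup_{\zeta_1,\dots,\zeta_{M(n)}\in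 E}|\det(e_i(\zeta_j))_{i,j}|\Big)^{1/D(n)},\qquad d_\infty(E)=\lim_{n\to\infty}d_n(E);$$ the limit exists (Zaharjuta). *)

(* Defs.v *)
From HB Require Import structures.
From mathcomp Require Import all_boot all_order all_algebra.
(* mpoly must be imported before the analysis library: in the other order their
   notations clash. *)
From mathcomp Require Import mpoly complex.
From mathcomp Require Import all_classical all_reals all_analysis.

Set Implicit Arguments.
Unset Strict Implicit.
Unset Printing Implicit Defensive.

Import Order.TTheory GRing.Theory Num.Theory.
Import numFieldNormedType.Exports.

Local Open Scope classical_set_scope.
Local Open Scope ring_scope.

(* C^N is represented by 'I_N -> R[i], where R[i] is the field of complex
   numbers over the reals R, and a polynomial map C^N -> C^N by the N-tuple
   'I_N -> {mpoly R[i][N]} of its components. *)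

Section PolynomialMaps.
Variables (R : realType) (N : nat).

Definition lead_part (d : nat) (F : 'I_N -> {mpoly R[i][N]}) :
    'I_N -> {mpoly R[i][N]} :=
  fun i => pihomog mdeg d (F i).

Definition zero_locus (F : 'I_N -> {mpoly R[i][N]}) : set ('I_N -> R[i]) :=
  [set z | forall i, (F i).@[z] = 0].

(* For d >= 1 this is equivalent to F having a holomorphic extension to P^N. *)
Definition regular_map (d : nat) (F : 'I_N -> {mpoly R[i][N]}) : Prop :=
  (forall i, msize (F i) = d.+1) /\
  zero_locus (lead_part d F) = [set (fun=> 0)].

Definition unit_polyhedron (F : 'I_N -> {mpoly R[i][N]}) :
    set ('I_N -> R[i]) :=
  [set z | forall i, Normc.normc (F i).@[z] <= 1].

End PolynomialMaps.

Definition irreducible_elt (A : idomainType) (x : A) : Prop :=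
  [/\ x != 0, x \isn't a GRing.unit &
      forall y z : A, x = y * z -> y \is a GRing.unit \/ z \is a GRing.unit].

(* The pair (i, m) indexes the coefficient of the degree-d monomial m in the
   i-th member of an N-tuple of homogeneous polynomials of degree d. *)
Definition coef_index (N d : nat) : finType :=
  ('I_N * {m : 'X_{1..N < d.+1} | mdeg m == d})%type.

(* Polynomials with integer coefficients in the coefficients of such a tuple;
   the k-th indeterminate stands for the coefficient of index enum_val k. *)
Definition resultant_poly (N d : nat) : Type := {mpoly int[#|coef_index N d|]}.

Section Resultant.
Variables (R : realType) (N d : nat).

Definition complexify (P : resultant_poly N d) : {mpoly R[i][#|coef_index N d|]} :=
  map_mpoly intr P.

Definition tuple_coefs (H : 'I_N -> {mpoly R[i][N]}) :
    'I_#|coef_index N d| -> R[i] :=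
  fun k => let: (i, m) := enum_val k in (H i)@_(val m).

Definition eval_coefs (P : resultant_poly N d) (H : 'I_N -> {mpoly R[i][N]}) :
    R[i] :=
  (complexify P).@[tuple_coefs H].

(* For N, d >= 1 these properties characterize the multiresultant uniquely.
   Absolute irreducibility of an integer polynomial is irreducibility over the
   complex numbers. *)
Definition is_resultant (Res : resultant_poly N d) : Prop :=
  [/\ irreducible_elt (complexify Res),
      forall H : 'I_N -> {mpoly R[i][N]}, (forall i, H i \is d.-homog) ->
        eval_coefs Res H != 0 <-> zero_locus H = [set (fun=> 0)] &
      eval_coefs Res (fun i => 'X_i ^+ d) = 1].

End Resultant.

Section TransfiniteDiameter.
Variables (R : realType) (N : nat).

(* The points and the monomials of degree <= n are both indexed by the
   enumeration of 'X_{1..N < n.+1}, which has 'C(N + n, N) elements; the choice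
   of enumeration only affects the sign of the determinant. *)
Definition monomial_det (n : nat)
    (zeta : 'I_#|{: 'X_{1..N < n.+1}}| -> 'I_N -> R[i]) : R[i] :=
  \det (\matrix_(i, j)
    'X_[(enum_val i : 'X_{1..N < n.+1}) : 'X_{1..N}].@[zeta j]).

(* The real sup is the intended one for bounded E. At n = 0 the exponent is
   0^-1 = 0 and the value is irrelevant. *)
Definition nth_diameter (E : set ('I_N -> R[i])) (n : nat) : R :=
  sup [set Normc.normc (monomial_det zeta) | zeta in
        [set zeta : 'I_#|{: 'X_{1..N < n.+1}}| -> 'I_N -> R[i] |
          forall j, E (zeta j)]]
  `^ ((N * 'C(N + n, N.+1))%N%:R)^-1.

Definition transfinite_diameter (E : set ('I_N -> R[i])) : R :=
  limn (nth_diameter E).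

End TransfiniteDiameter.

(* Main.v *)
(* Write an exponent g as d b + r with all r_i < d, and put B_g = F^b X^r. The
   determinant A_n of the matrix of (B_g), |g| <= n, in the basis of monomials
   depends on the leading part F_h only, and dividing det(B_g(zeta_j)) by it gives
   the determinants of monomials in the definition of the transfinite diameter.

   Seen as a polynomial in the coefficients of F_h, A_n vanishes on the
   irreducible hypersurface Res = 0 to an order E_n ~ D(n) / (N d^N), hence is
   divisible by Res^E_n. On the line through F_h and (X_i^d), where A_n takes the
   value 1, the quotient has degree o(D(n)) and its roots lie in a finite set
   independent of n, so that |A_n| = |Res(F_h)|^E_n up to a factor exp(o(D(n))).

   On K the determinants det(B_g(zeta_j)) are at most exp(o(D(n))) because
   |F_i| <= 1. Conversely, let p be B_g plus a combination of the B_g' with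
   |b'| >= |b|. The trace of p G over the fibres of F, where G is dual to X^r for
   the trace form at w0, is a polynomial in the point w of the base whose
   coefficient of (w - w0)^b is 1; by Cauchy's estimate |p| is bounded below at
   some point of {|F_i - w0_i| = rho}. Choosing points one after the other in this
   way gives det(B_g(zeta_j)) >= rho^D(n) / exp(o(D(n))), and rho is as close to 1
   as desired.

   If some A_n vanishes at F_h, then F is replaced by F + t (X_i^d) with small t. *)

Require Import Defs.
From HB Require Import structures.
From mathcomp Require Import all_boot all_order all_algebra.
From mathcomp Require Import perm cyclic separable cyclotomic mpoly complex.
From mathcomp Require Import all_classical all_reals all_analysis.
From mathcomp Require Import ring lra zify.

Set Implicit Arguments.
Unset Strict Implicit.
Unset Printing Implicit Defensive.

Import Order.TTheory GRing.Theory Num.Theory.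
Import numFieldNormedType.Exports.

Local Open Scope ring_scope.

(** Everything rests on a match of degrees. In the coefficients of F_h, A_n has degree sum |b|, at
    most D(n) / d, and Res has degree at least N d^(N-1); so Res^E_n uses up the degree of A_n up to
    o(D(n)). The order E_n becomes visible when a common zero of a singular tuple is moved to a
    coordinate point: there F^b X^r vanishes to order |b|, while a monomial of low degree in the
    remaining variables does not, and the difference must be made up by powers of the parameter of
    the line. Irreducibility of Res enters through a Nullstellensatz for hypersurfaces, which in
    turn needs unique factorization. What is left of A_n has to be bounded from both sides, so its
    roots must stay away from 0 as well; this is the reason to ask that the first A_k do not vanish
    at F_h. The perturbation that ensures it is made in all cases, with t depending on the precision
    wanted, and the a priori bound on the points is therefore uniform in t. The trace stands for the
    sum over a fibre; its form is nondegenerate at some w0 near 0 because the characteristic is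
    0. *)

Definition rdvd (A : comNzRingType) (x y : A) : Prop := exists z, y = z * x.

(** * Unique factorization in polynomial rings *)

Section Divisibility.
Variable A : idomainType.
Implicit Types p x y : A.

Definition prime_elt p : Prop :=
  [/\ p != 0, p \isn't a GRing.unit &
      forall x y, rdvd p (x * y) -> rdvd p x \/ rdvd p y].

Lemma rdvd_mull p x y : rdvd p x -> rdvd p (y * x).
Proof. by move=> [z ->]; exists (y * z); rewrite mulrA. Qed.

Lemma rdvd_mulr p x y : rdvd p x -> rdvd p (x * y).
Proof. by rewrite mulrC; exact: rdvd_mull. Qed.

Lemma rdvd_sum p (I : Type) (r : seq I) (P : pred I) (f : I -> A) :
  (forall i, P i -> rdvd p (f i)) -> rdvd p (\sum_(i <- r | P i) f i).
Proof.
move=> h; elim/big_ind: _ => //; first by exists 0; rewrite mul0r.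
by move=> x y [u ->] [v ->]; exists (u + v); rewrite mulrDl.
Qed.

Lemma rdvd_sub p x y : rdvd p x -> rdvd p (x + y) -> rdvd p y.
Proof. by move=> [u ->] [v e]; exists (v - u); rewrite mulrBl -e addrC addKr. Qed.

Lemma prime_irreducible p : prime_elt p -> irreducible_elt p.
Proof.
move=> [p0 pU pP]; split=> // x y e.
have [[z ez]|[z ez]] : rdvd p x \/ rdvd p y by apply: pP; exists 1; rewrite mul1r e.
- right; have zy : z * y = 1 by apply: (mulfI p0); rewrite mulr1 [RHS]e ez; ring.
  by apply/unitrP; exists z; rewrite zy mulrC zy.
- left; have zx : z * x = 1 by apply: (mulfI p0); rewrite mulr1 [RHS]e ez; ring.
  by apply/unitrP; exists z; rewrite zx mulrC zx.
Qed.

Lemma prime_rdvd_prod p u (s : seq A) : prime_elt p -> u \is a GRing.unit ->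
  rdvd p (u * \prod_(q <- s) q) -> exists2 q, q \in s & rdvd p q.
Proof.
move=> [p0 pU pP] uU.
have np v : v \is a GRing.unit -> ~ rdvd p v.
  by move=> vU [z e]; move: vU; rewrite e unitrM (negbTE pU) andbF.
elim: s => [|q s IHs]; first by rewrite big_nil mulr1 => /np; case.
rewrite big_cons mulrCA => /pP [pq|/IHs [r rs pr]].
  by exists q; rewrite ?mem_head.
by exists r => //; rewrite inE rs orbT.
Qed.

(** The factors are prime rather than irreducible: existence of such a factorization already
    contains uniqueness, and it makes irreducible elements prime. *)
Definition factorial_dom : Prop := forall x, x != 0 ->
  exists u (s : seq A), [/\ u \is a GRing.unit, {in s, forall p, prime_elt p} &
    x = u * \prod_(p <- s) p].

Lemma factorial_irreducible_prime x :
  factorial_dom -> irreducible_elt x -> prime_elt x.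
Proof.
move=> fA [x0 xU xI]; have [u [[|p s] [uU sP e]]] := fA _ x0.
  by move: xU; rewrite e big_nil mulr1 uU.
have pP : prime_elt p by apply: sP; rewrite mem_head.
move: e; rewrite big_cons mulrCA => e.
case: (xI _ _ e) => vU; first by case: pP => _; rewrite vU.
case: pP => p0 pU pP; split=> // a b [z ez].
have [|[c ->]|[c ->]] := pP a b.
- by exists (z * (u * \prod_(q <- s) q)); rewrite ez {1}e; ring.
- by left; exists (c * (u * \prod_(q <- s) q)^-1); rewrite e -mulrA (mulrC p) mulKr.
- by right; exists (c * (u * \prod_(q <- s) q)^-1); rewrite e -mulrA (mulrC p) mulKr.
Qed.

End Divisibility.

Section FactorialPoly.
Variable A : idomainType.
Hypothesis fA : factorial_dom A.
Implicit Types (f g h : {poly A}) (a b c p : A).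

Lemma rdvd_polyC p f : rdvd p%:P f <-> forall i, rdvd p f`_i.
Proof.
split=> [[g ->] i|H]; first by exists g`_i; rewrite coefMC.
have [g gE] := choice H.
exists (\poly_(i < size f) g i); apply/polyP=> i; rewrite coefMC coef_poly.
by case: ltnP => [_|le]; [exact: gE|rewrite mul0r nth_default].
Qed.

(** Gauss's lemma: let i and j be the least indices of coefficients of f and g not divisible by p.
    Modulo p, the coefficient of f g at i + j is the product of these two. *)
Lemma prime_polyC p : prime_elt p -> prime_elt p%:P.
Proof.
move=> [p0 pU pP]; split; first by rewrite polyC_eq0.
  by rewrite poly_unitE size_polyC p0 coefC eqxx.
move=> f g /rdvd_polyC fg.
have [?|nf] := pselect (rdvd p%:P f); first by left.
have [?|ng] := pselect (rdvd p%:P g); first by right.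
have least h : ~ rdvd p%:P h ->
    exists i, ~ rdvd p h`_i /\ forall j, (j < i)%N -> rdvd p h`_j.
  move=> nh; have ex : exists i, ~~ `[< rdvd p h`_i >].
    by apply/not_existsP => H; apply: nh; apply/rdvd_polyC => i; apply/asboolP; have /negP := H i; rewrite negbK.
  exists (ex_minn ex); case: ex_minnP => i /asboolPn ni min_i; split=> // j.
  by rewrite ltnNge => /negP ji; apply: contrapT => nj; apply/ji/min_i/asboolPn.
have [i [ni hi]] := least _ nf; have [j [nj hj]] := least _ ng.
have ij : rdvd p (f`_i * g`_j).
  have := fg (i + j)%N; rewrite coefM.
  have ltij : (i < (i + j).+1)%N by rewrite ltnS leq_addr.
  rewrite (bigD1 (Ordinal ltij)) //= addKn addrC; apply: rdvd_sub.
  apply: rdvd_sum => k ki.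
  have [ik|ik|ik] := ltngtP k i; first by apply/rdvd_mulr/hi.
    by apply/rdvd_mull/hj; rewrite ltn_subLR ?ltn_add2r // -ltnS.
  by move: ki; rewrite -val_eqE /= ik eqxx.
by case: (pP _ _ ij).
Qed.

(** A factorization over the fraction field descends to the ring with the same degrees: each prime
    factor of c divides g or h and is cancelled there. *)
Lemma split_scale c f g h : c != 0 -> c%:P * f = g * h ->
  exists g' h', [/\ f = g' * h', size g' = size g & size h' = size h].
Proof.
move=> c0; have [u [s [uU sP cE]]] := fA c0; rewrite {}cE {c c0}.
elim: s sP f g h => [|p s IHs] sP f g h.
  rewrite big_nil mulr1 => e; exists (u^-1%:P * g), h; split=> //.
    by rewrite -mulrA -e mulrA -polyCM mulVr // mul1r.
  by rewrite mul_polyC size_scale // invr_eq0; apply: contraTneq uU => ->; rewrite unitr0.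
have sP' : {in s, forall q, prime_elt q} by move=> q qs; apply: sP; rewrite inE qs orbT.
have pP : prime_elt p by apply: sP; rewrite mem_head.
have p0 : p != 0 by case: pP.
have pC0 : p%:P != 0 :> {poly A} by rewrite polyC_eq0.
rewrite big_cons mulrCA polyCM -mulrA => e.
have [_ _ pD] := prime_polyC pP.
have [|[g1 e1]|[h1 e1]] := pD g h.
- by exists ((u * \prod_(q <- s) q)%:P * f); rewrite -e mulrC.
- have [|g' [h' [ef sg sh]]] := IHs sP' f g1 h.
    by apply: (mulfI pC0); rewrite e e1; ring.
  by exists g', h'; split=> //; rewrite sg e1 mulrC mul_polyC size_scale.
- have [|g' [h' [ef sg sh]]] := IHs sP' f g h1.
    by apply: (mulfI pC0); rewrite e e1; ring.
  by exists g', h'; split=> //; rewrite sh e1 mulrC mul_polyC size_scale.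
Qed.

Definition primitive f := forall p, prime_elt p -> ~ rdvd p%:P f.

Lemma primitive_rdvd c f g :
  c != 0 -> primitive g -> rdvd g (c%:P * f) -> rdvd g f.
Proof.
move=> c0 gP; have [u [s [uU sP cE]]] := fA c0; rewrite {}cE {c c0}.
elim: s sP f => [|p s IHs] sP f.
  rewrite big_nil mulr1 => -[q e]; exists (u^-1%:P * q).
  by rewrite -mulrA -e mulrA -polyCM mulVr // mul1r.
have pP : prime_elt p by apply: sP; rewrite mem_head.
have pC0 : p%:P != 0 :> {poly A} by rewrite polyC_eq0; case: pP.
rewrite big_cons mulrCA polyCM -mulrA => -[q e].
apply: IHs => [r rs|]; first by apply: sP; rewrite inE rs orbT.
have [_ _ pD] := prime_polyC pP.
have [|[q1 e1]|/gP] := pD q g.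
- by exists ((u * \prod_(q <- s) q)%:P * f); rewrite -e mulrC.
- by exists q1; apply: (mulfI pC0); rewrite e e1 mulrAC mulrC.
- by case/(_ pP).
Qed.

(** Pulling a constant prime out of f removes a prime factor from the leading coefficient; the
    induction is on the number of these factors. *)
Lemma primitive_part f : f != 0 ->
  exists c g, f = c%:P * g /\ primitive g.
Proof.
move=> f0; have : lead_coef f != 0 by rewrite lead_coef_eq0.
case/fA => u [s [uU sP e]].
elim: {s}(size s) {-2}s (erefl (size s)) f f0 u uU sP e => [|n IHn] s sn f f0 u uU sP e.
  exists 1, f; rewrite mul1r; split=> // p pP [g eg].
  have [|] := @prime_rdvd_prod _ p u s pP uU.
    by rewrite -e eg lead_coefM lead_coefC; exists (lead_coef g).
  by move=> x; rewrite (size0nil sn).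
have [pf|np] := pselect (exists2 p, prime_elt p & rdvd p%:P f); last first.
  by exists 1, f; rewrite mul1r; split=> // p pP pf; apply: np; exists p.
case: pf => p pP [g eg].
have e' : lead_coef f = lead_coef g * p by rewrite eg lead_coefM lead_coefC.
have [q qs [v ev]] : exists2 q, q \in s & rdvd p q.
  by apply: (prime_rdvd_prod pP uU); rewrite -e e'; exists (lead_coef g).
have [q0 qU qP] := prime_irreducible (sP q qs).
have vU : v \is a GRing.unit by case: (qP _ _ ev) => // pU; case: pP => _; rewrite pU.
have srem : size (rem q s) = n by rewrite size_rem // sn.
have g0 : g != 0 by apply: contraNneq f0 => g0; rewrite eg g0 mul0r.
have uvU : u * v \is a GRing.unit by rewrite unitrM uU vU.
have remP : {in rem q s, forall r, prime_elt r} by move=> r /mem_rem; exact: sP.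
have e2 : lead_coef g = u * v * \prod_(r <- rem q s) r.
  move: e; rewrite (perm_big _ (perm_to_rem qs)) big_cons /= => e.
  have [p0 _ _] := pP.
  by apply: (mulIf p0); rewrite -e' e ev; ring.
have [c [h [eh hP]]] := IHn _ srem _ g0 _ uvU remP e2.
by exists (p * c), h; split=> //; rewrite eg eh polyCM; ring.
Qed.

Definition nonsplit g := forall x y, g = x * y -> size x = 1%N \/ size y = 1%N.

(** Over a domain [gcdp] and [%|] ignore constant factors, so they are those of the fraction field;
    [split_scale] and [primitive_rdvd] bring the conclusion back to the ring. *)
Lemma nonsplit_coprime g f :
  g != 0 -> primitive g -> nonsplit g -> coprimep g f \/ rdvd g f.
Proof.
move=> g0 gP gI; have [cop|ncop] := boolP (coprimep g f); first by left.
right; have : g %| f; last first.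
  move=> /Pdiv.Idomain.dvdpP [[k r] /= k0 e].
  by apply: (primitive_rdvd k0 gP); exists r; rewrite mul_polyC.
have /Pdiv.Idomain.dvdpP [[k r] /= k0 e] := dvdp_gcdl g f.
have [|x [y [exy sx sy]]] := @split_scale k g r (gcdp g f) k0.
  by rewrite mul_polyC.
case: (gI _ _ exy); rewrite ?sx ?sy; last first.
  by move/eqP; rewrite -coprimep_def (negbTE ncop).
move=> sr; have : gcdp g f %= g.
  rewrite -dvdp_size_eqp ?dvdp_gcdl // -sy exy size_mul ?sx ?sr //.
    by rewrite -size_poly_gt0 sx sr.
  by apply: contraNneq g0 => y0; rewrite exy y0 mulr0.
by move/eqp_dvdl <-; exact: dvdp_gcdr.
Qed.

Lemma nonsplit_prime g :
  (1 < size g)%N -> primitive g -> nonsplit g -> prime_elt g.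
Proof.
move=> sg gP gI; have g0 : g != 0 by rewrite -size_poly_gt0 ltnW.
split=> //; first by rewrite poly_unitE gtn_eqF.
move=> a b [q eq].
have [cop|] := nonsplit_coprime a g0 gP gI; last by left.
right; have : g %| a * b.
  by apply/Pdiv.Idomain.dvdpP; exists (1, q) => /=; rewrite ?oner_eq0 // scale1r.
rewrite Gauss_dvdpr // => /Pdiv.Idomain.dvdpP [[k r] /= k0 e].
by apply: (primitive_rdvd k0 gP); exists r; rewrite mul_polyC.
Qed.

Lemma factorial_poly : factorial_dom {poly A}.
Proof.
move=> f; move: {2}(size f) (leqnn (size f)) => n.
elim: n f => [|n IHn] f; first by rewrite leqn0 size_poly_eq0 => /eqP ->; rewrite eqxx.
move=> sf f0; have [sf1|sf1] := leqP (size f) 1.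
  move: f0; rewrite (size1_polyC sf1) polyC_eq0 => /fA [u [s [uU sP ->]]].
  exists u%:P, (map polyC s); split.
  - by rewrite poly_unitE size_polyC coefC eqxx uU andbT; apply/eqP; case: eqP uU => // ->; rewrite unitr0.
  - by move=> q /mapP [p ps ->]; apply/prime_polyC/sP.
  - by rewrite polyCM big_map rmorph_prod.
have [[x [y [exy sx sy]]]|ns] := pselect (exists x y,
    [/\ f = x * y, (size x < size f)%N & (size y < size f)%N]).
  have x0 : x != 0 by apply: contraNneq f0 => x0; rewrite exy x0 mul0r.
  have y0 : y != 0 by apply: contraNneq f0 => y0; rewrite exy y0 mulr0.
  have [u [s [uU sP es]]] := IHn x (leq_trans sx sf) x0.
  have [v [t [vU tP et]]] := IHn y (leq_trans sy sf) y0.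
  exists (u * v), (s ++ t); split; first by rewrite unitrM uU vU.
    by move=> p; rewrite mem_cat => /orP [/sP|/tP].
  by rewrite exy es et big_cat /= mulrACA.
have [c [g [efg gP]]] := primitive_part f0.
have c0 : c != 0 by apply: contraNneq f0 => c0; rewrite efg c0 mul0r.
have sfg : size f = size g by rewrite efg mul_polyC size_scale.
have [u [s [uU sP ec]]] := fA c0.
exists u%:P, (rcons (map polyC s) g); split.
- by rewrite poly_unitE size_polyC coefC eqxx uU andbT; apply/eqP; case: eqP uU => // ->; rewrite unitr0.
- move=> q; rewrite mem_rcons inE => /orP [/eqP ->|/mapP [p ps ->]]; last exact/prime_polyC/sP.
  apply: nonsplit_prime => //; first by rewrite -sfg.
  move=> x y exy.
  have g0 : g != 0 by rewrite -size_poly_gt0 -sfg ltnW.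
  have x0 : x != 0 by apply: contraNneq g0 => x0; rewrite exy x0 mul0r.
  have y0 : y != 0 by apply: contraNneq g0 => y0; rewrite exy y0 mulr0.
  have sxy : size f = (size x + size y).-1 by rewrite sfg exy size_mul.
  apply: contrapT => /not_orP [/eqP x1 /eqP y1]; apply: ns; exists (c%:P * x), y.
  move: x0 y0; rewrite -!size_poly_gt0 => x0 y0.
  rewrite -mulrA -exy -efg mul_polyC size_scale // sxy; split=> //; move: x0 y0 x1 y1; clear; move: (size x) (size y) => a b; lia.
- by rewrite efg ec polyCM -cats1 big_cat big_seq1 big_map rmorph_prod -mulrA.
Qed.

End FactorialPoly.

Lemma prime_iso (A B : idomainType) (f : {rmorphism A -> B})
  (g : {rmorphism B -> A}) p :
  cancel f g -> cancel g f -> prime_elt p -> prime_elt (f p).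
Proof.
move=> fK gK [p0 pU pP]; split.
- by apply: contraNneq p0 => p0; rewrite -[p]fK p0 rmorph0.
- by apply: contra pU => /(rmorph_unit g); rewrite fK.
- move=> a b [z ez]; have [|[c ec]|[c ec]] := pP (g a) (g b).
  + by exists (g z); rewrite -rmorphM ez rmorphM fK.
  + by left; exists (f c); rewrite -[a]gK ec rmorphM.
  + by right; exists (f c); rewrite -[b]gK ec rmorphM.
Qed.

Lemma factorial_iso (A B : idomainType) (f : {rmorphism A -> B})
  (g : {rmorphism B -> A}) :
  cancel f g -> cancel g f -> factorial_dom A -> factorial_dom B.
Proof.
move=> fK gK fA y y0.
have [|u [s [uU sP e]]] := fA (g y).
  by apply: contraNneq y0 => gy0; rewrite -[y]gK gy0 rmorph0.
exists (f u), (map f s); split; first exact: rmorph_unit.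
  by move=> q /mapP [p /sP pP ->]; exact: (prime_iso fK gK).
by rewrite -[y]gK e rmorphM rmorph_prod big_map.
Qed.

Lemma rmorph_mpoly_eq n (R S : comNzRingType)
  (f g : {rmorphism {mpoly R[n]} -> S}) :
  (forall c, f c%:MP = g c%:MP) -> (forall i, f 'X_i = g 'X_i) -> f =1 g.
Proof.
move=> eqC eqX p; rewrite (mpolyE p) !rmorph_sum; apply: eq_bigr => m _.
rewrite -mul_mpolyC !rmorphM eqC mpolyXE_id !rmorph_prod; congr (_ * _).
by apply: eq_bigr => i _; rewrite !rmorphXn eqX.
Qed.

Lemma rmorph_poly_eq (R S : comNzRingType) (f g : {rmorphism {poly R} -> S}) :
  (forall c, f c%:P = g c%:P) -> f 'X = g 'X -> f =1 g.
Proof.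
move=> eqC eqX; elim/poly_ind => [|p c IH]; first by rewrite !rmorph0.
by rewrite !rmorphD !rmorphM IH eqC eqX.
Qed.

(** * Splitting off the last variable *)

Section LastVariable.
Variables (n : nat) (R : comNzRingType).
Implicit Types (p : {mpoly R[n.+1]}) (f : {poly {mpoly R[n]}}).
Local Notation widen := (widen_ord (leqnSn n)).

(** The inverse of [muni]. The isomorphism carries the inductions on the number of variables. *)
Definition unmuni : {poly {mpoly R[n]}} -> {mpoly R[n.+1]} :=
  horner_eval 'X_ord_max \o map_poly (@mwiden n R).
HB.instance Definition _ := GRing.RMorphism.on unmuni.

Lemma widenE (i : 'I_n) : widen i = lift ord_max i.
Proof. by apply: val_inj; rewrite /= /bump leqNgt ltn_ord. Qed.

Lemma muni_last : muni 'X_ord_max = 'X :> {poly {mpoly R[n]}}.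
Proof.
rewrite muniE msuppX big_seq1 mcoeffX eqxx scale1r mnm1E eqxx expr1.
rewrite (_ : [multinom _ | i < n] = 0%MM) ?mpolyX0 ?scale1r //.
apply/mnmP => i; rewrite mnmE mnm1E mnm0E; apply/eqP.
by rewrite eqb0 widenE neq_lift.
Qed.

Lemma muni_widen i : muni 'X_(widen i) = ('X_i)%:P :> {poly {mpoly R[n]}}.
Proof.
rewrite muniE msuppX big_seq1 mcoeffX eqxx scale1r mnm1E.
rewrite {2}widenE eq_sym (negbTE (neq_lift _ _)) expr0 alg_polyC; congr (_%:P).
congr 'X_[_]; apply/mnmP => j; rewrite mnmE !mnm1E.
by rewrite !widenE (inj_eq lift_inj).
Qed.

Lemma ord_max_ind (P : 'I_n.+1 -> Prop) :
  P ord_max -> (forall i, P (widen i)) -> forall i, P i.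
Proof.
by move=> Pm Pw i; case: (unliftP ord_max i) => [j|] -> //; rewrite -widenE.
Qed.

Lemma mwidenXU (i : 'I_n) : mwiden 'X_i = 'X_(widen i) :> {mpoly R[n.+1]}.
Proof. by rewrite mwidenX mnmwiden1. Qed.

Lemma muniK : cancel (@muni n R) unmuni.
Proof.
apply: (@rmorph_mpoly_eq _ _ _ (unmuni \o @muni n R) idfun) => [c|] /=.
  by rewrite muniC /unmuni /= map_polyC /horner_eval hornerC /= mwidenC.
apply: ord_max_ind => [|i]; first by rewrite muni_last /unmuni /= map_polyX /horner_eval hornerX.
by rewrite muni_widen /unmuni /= map_polyC /horner_eval hornerC /= mwidenXU.
Qed.

Lemma unmuniK : cancel unmuni (@muni n R).
Proof.
apply: (@rmorph_poly_eq _ _ (@muni n R \o unmuni) idfun) => [c|] /=; last first.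
  by rewrite /unmuni /= map_polyX /horner_eval hornerX muni_last.
rewrite /unmuni /= map_polyC /horner_eval hornerC /=.
apply: (@rmorph_mpoly_eq _ _ _ (@muni n R \o @mwiden n R) polyC) => [d|i] /=.
  by rewrite mwidenC muniC.
by rewrite mwidenXU muni_widen.
Qed.

Lemma meval_muni (v : 'I_n.+1 -> R) p :
  p.@[v] = (map_poly (meval (v \o widen)) (muni p)).[v ord_max].
Proof.
apply: (@rmorph_mpoly_eq _ _ _ (meval v)
  (horner_eval (v ord_max) \o map_poly (meval (v \o widen)) \o @muni n R))
  => [c|] /=; first by rewrite muniC map_polyC /horner_eval hornerC /= !mevalC.
apply: ord_max_ind => [|i].
  by rewrite muni_last map_polyX /horner_eval hornerX mevalXU.
by rewrite muni_widen map_polyC /horner_eval hornerC /= !mevalXU.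
Qed.

Lemma extend_last (w : 'I_n -> R) (x : R) :
  exists v : 'I_n.+1 -> R, v \o widen = w /\ v ord_max = x.
Proof.
exists (fun i => oapp w x (unlift ord_max i)); split; last by rewrite unlift_none.
by apply: funext => i; rewrite /= widenE liftK.
Qed.

End LastVariable.

Lemma factorial_mpoly n (K : fieldType) : factorial_dom {mpoly K[n]}.
Proof.
elim: n => [p p0|n IH].
  exists p, [::]; split=> //; last by rewrite big_nil mulr1.
  have p00 : p@_0%MM != 0 by rewrite -(mpolyC_eq0 0) -nvar0_mpolyC.
  rewrite (nvar0_mpolyC p); move: p00; move: (p@_0%MM) => c c0.
  by apply/unitrP; exists c^-1%:MP; rewrite -!mpolyCM mulVf ?mulfV.
exact: (factorial_iso (@unmuniK n K) (@muniK n K) (factorial_poly IH)).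
Qed.

(** S is infinite in the sense that no finite list exhausts it; a small disc for S gives a nonroot
    close to the origin. *)
Lemma mpoly_nonroot (K : closedFieldType) (S : K -> Prop) n (p : {mpoly K[n]}) :
  (forall s : seq K, exists2 x, S x & x \notin s) -> p != 0 ->
  exists2 v, (forall i, S (v i)) & p.@[v] != 0.
Proof.
move=> Sinf; elim: n p => [|n IH] p p0.
  exists (fun=> 0); first by case.
  by rewrite (nvar0_mpolyC p) mevalC -(mpolyC_eq0 0) -nvar0_mpolyC.
have f0 : muni p != 0 by apply: contraNneq p0 => e; rewrite -[p]muniK e rmorph0.
have [|w Sw lw] := IH (lead_coef (muni p)); first by rewrite lead_coef_eq0.
have g0 : map_poly (meval w) (muni p) != 0.
  by apply: contraNneq lw => e; rewrite -[_.@[w]]/(meval w _) /lead_coef -coef_map e coef0.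
have [r er] := closed_field_poly_normal (map_poly (meval w) (muni p)).
have [x Sx xr] := Sinf r.
have [v [vw vx]] := extend_last w x.
exists v; last first.
  rewrite meval_muni vw vx er hornerZ mulf_neq0 ?lead_coef_eq0 //.
  by rewrite -[_ == 0]/(root _ _) root_prod_XsubC.
by apply: ord_max_ind => [|i]; rewrite ?vx // -[v _]/((v \o _) i) vw.
Qed.

(** * Hypersurfaces and orders of vanishing *)

Lemma closed_field_infinite (K : closedFieldType) (s : seq K) :
  exists2 x, True & x \notin s.
Proof.
pose p : {poly K} := 'X * \prod_(z <- s) ('X - z%:P) + 1.
have /closed_rootP [x px] : size p != 1%N.
  rewrite /p size_polyDl size_mul ?polyX_eq0 ?monic_neq0 ?monic_prod_XsubC //;
  by rewrite size_polyX size_prod_XsubC ?size_poly1.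
exists x => //; apply/negP => xs.
have : root (\prod_(z <- s) ('X - z%:P)) x by rewrite root_prod_XsubC.
move: px; rewrite /p /root hornerD hornerM hornerC => px /eqP h.
by move: px; rewrite h mulr0 add0r oner_eq0.
Qed.

(** The element c acts as a resultant of f and g in the last variable: it lies in the ideal they
    generate, hence vanishes wherever both do. *)
Lemma coprimep_common_zero (A : idomainType) (B : comNzRingType) (f g : {poly A}) :
  coprimep f g -> exists2 c, c != 0 &
    forall ev : {rmorphism {poly A} -> B}, ev f = 0 -> ev g = 0 -> ev c%:P = 0.
Proof.
move=> /Bezout_coprimepP [[u v] /=]; rewrite -size_poly_eq1 => /size_poly1P [c c0 e].
by exists c => // ev f0 g0; rewrite -e rmorphD !rmorphM f0 g0 !mulr0 addr0.
Qed.

(** If P involves the last variable and does not divide Q, the two are coprime in that variable, and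
    an elimination polynomial c vanishes below all their common zeros. Over a point where neither c
    nor the leading coefficient of P vanishes, P still has a root, and Q vanishes there too. *)
Lemma rdvd_nullstellensatz (K : closedFieldType) n (P Q : {mpoly K[n]}) :
  prime_elt P -> (forall v, P.@[v] = 0 -> Q.@[v] = 0) -> rdvd P Q.
Proof.
elim: n P Q => [|n IH] P Q.
  move=> /prime_irreducible [P0 PU _]; exfalso; move/negP: PU; apply.
  move: P0; rewrite (nvar0_mpolyC P); move: (P@_0%MM) => c.
  rewrite mpolyC_eq0 => c0.
  by apply/unitrP; exists c^-1%:MP; rewrite -!mpolyCM mulVf ?mulfV.
move=> PP PQ; set f := muni P; set g := muni Q.
have fP : prime_elt f by exact: (prime_iso (@muniK n K) (@unmuniK n K) PP).
suff [h eh] : rdvd f g by exists (unmuni h); rewrite -[Q]muniK -/g eh rmorphM /= [unmuni f]muniK.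
have vanish w x : (map_poly (meval w) f).[x] = 0 -> (map_poly (meval w) g).[x] = 0.
  have [v [vw vx]] := extend_last w x.
  by have := PQ v; rewrite (meval_muni v P) (meval_muni v Q) vw vx.
have [f0 fU fD] := fP.
(* When P is free of the last variable, Q vanishes on whole vertical lines over the zeros of P, so
   each of its coefficients does, and the induction hypothesis applies to these. *)
have [sf|sf] := leqP (size f) 1.
  have fE := size1_polyC sf; move: (f`_0) fE => a fE.
  rewrite fE; apply/rdvd_polyC => i.
  apply: IH.
    split; first by move: f0; rewrite fE polyC_eq0.
      apply: contra fU => aU; rewrite fE poly_unitE size_polyC coefC eqxx aU.
      by case: (eqVneq a 0) aU => // ->; rewrite unitr0.
    move=> x y [z ez]; case: (fD x%:P y%:P); rewrite -?polyCM ?ez ?fE.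
    + by exists z%:P; rewrite polyCM.
    + by move/rdvd_polyC/(_ 0%N); rewrite coefC; left.
    + by move/rdvd_polyC/(_ 0%N); rewrite coefC; right.
  move=> w aw; rewrite -[_.@[w]]/(meval w _) -coef_map.
  suff -> : map_poly (meval w) g = 0 by rewrite coef0.
  apply/eqP/negP => /negP g0.
  have [r er] := closed_field_poly_normal (map_poly (meval w) g).
  have [x _ xr] := closed_field_infinite r.
  have : (map_poly (meval w) g).[x] == 0.
    by apply/eqP/vanish; rewrite fE map_polyC hornerC.
  rewrite er hornerZ mulf_eq0 lead_coef_eq0 (negbTE g0) /=.
  by rewrite -[_ == 0]/(root _ _) root_prod_XsubC (negbTE xr).
have [_ _ fI] := prime_irreducible fP.
have fS : nonsplit f.
  by move=> x y /fI [] /[!poly_unitE] /andP [/eqP]; [left|right].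
have fprim : primitive f.
  move=> p [_ pU _] [z ez]; case: (fI _ _ ez) => [/[!poly_unitE] /andP [/eqP sz _]|].
    by move: sf; rewrite ez mulrC mul_polyC ltnNge (leq_trans (size_scale_leq _ _)) ?sz.
  by rewrite poly_unitE coefC eqxx (negbTE pU) andbF.
have [|] := nonsplit_coprime (@factorial_mpoly n K) g f0 fprim fS => //.
move=> /(coprimep_common_zero K) [c c0 fgc].
have [||w _] := @mpoly_nonroot K (fun=> True) n (lead_coef f * c).
- by move=> s; exact: closed_field_infinite.
- by rewrite mulf_neq0 ?lead_coef_eq0.
rewrite mevalM mulf_eq0 => /norP [lw cw].
have [x fx] : exists x, root (map_poly (meval w) f) x.
  by apply/closed_rootP; rewrite size_map_poly_id0 // gtn_eqF.
have := fgc (horner_eval x \o map_poly (meval w)) (eqP fx) (vanish _ _ (eqP fx)).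
by rewrite /= map_polyC /horner_eval hornerC => /eqP; rewrite (negbTE cw).
Qed.

(** * Restriction to lines and orders of vanishing *)

Definition mline (K : comNzRingType) n (a b : 'I_n -> K) :
    {mpoly K[n]} -> {poly K} :=
  mmap (@polyC K) (fun i => (a i)%:P + b i *: 'X).

HB.instance Definition _ (K : comNzRingType) n (a b : 'I_n -> K) :=
  GRing.RMorphism.on (mline a b).

Section Line.
Variables (K : comNzRingType) (n : nat) (a b : 'I_n -> K).
Implicit Types (p : {mpoly K[n]}).

Lemma mlineC c : mline a b c%:MP = c%:P.
Proof. by rewrite /mline mmapC. Qed.

Lemma mlineXU i : mline a b 'X_i = (a i)%:P + b i *: 'X.
Proof. by rewrite /mline mmapX mmap1U. Qed.

Lemma horner_mline p t : (mline a b p).[t] = p.@[fun i => a i + t * b i].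
Proof.
apply: (@rmorph_mpoly_eq _ _ _ (horner_eval t \o mline a b) (meval _)) => [c|i] /=.
  by rewrite mlineC mevalC /horner_eval hornerC.
by rewrite mlineXU mevalXU /horner_eval hornerD hornerC hornerZ hornerX mulrC.
Qed.

Lemma horner_mline0 p : (mline a b p).[0] = p.@[a].
Proof. by rewrite horner_mline; apply: meval_eq => i; rewrite mul0r addr0. Qed.

End Line.

Lemma deriv_mline (K : comNzRingType) n (a : 'I_n -> K) i (p : {mpoly K[n]}) :
  (mline a (fun j => (j == i)%:R) p)^`() = mline a (fun j => (j == i)%:R) p^`M(i).
Proof.
set b := fun j => _; elim/mpolyind: p => [|c m p _ _ IH].
  by rewrite mderiv0 rmorph0 deriv0.
rewrite mderivD rmorphD derivD IH rmorphD; congr (_ + _).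
rewrite mderivZ -!mul_mpolyC !rmorphM /=.
rewrite mlineC derivM derivC mul0r add0r mderivX -mul_mpolyC; congr (_ * _).
have LX (k : 'X_{1..n}) :
    mline a b 'X_[k] = (\prod_(j | j != i) (a j) ^+ k j)%:P * ((a i)%:P + 'X) ^+ k i.
  rewrite mpolyXE_id rmorph_prod (bigD1 i) //= mulrC; congr (_ * _); last first.
    by rewrite rmorphXn /= mlineXU /b eqxx scale1r.
  rewrite rmorph_prod; apply: eq_bigr => j /negbTE ji.
  by rewrite rmorphXn /= mlineXU /b ji scale0r addr0 rmorphXn.
rewrite rmorphM /= mlineC !LX derivM derivC mul0r add0r deriv_exp.
rewrite derivD derivC derivX add0r mul1r mnmBE mnm1E eqxx subn1.
rewrite rmorph_nat mulr_natl -mulrnAr; congr (_%:P * (_ *+ _)).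
by apply: eq_bigr => j ji; rewrite mnmBE mnm1E eq_sym (negbTE ji) subn0.
Qed.

Lemma msize_mderiv (K : numDomainType) n i (P : {mpoly K[n]}) :
  P^`M(i) != 0 -> (msize P^`M(i) < msize P)%N.
Proof.
move=> d0; rewrite -(mlead_deg d0).
have := mlead_supp d0; rewrite mcoeff_msupp mcoeff_deriv => h.
have : (mlead P^`M(i) + U_(i))%MM \in msupp P.
  by rewrite mcoeff_msupp; apply: contraNneq h => ->; rewrite mul0rn.
by move/msize_mdeg_lt; rewrite mdegD mdeg1 addn1.
Qed.

Lemma mderiv_neq0 (K : numDomainType) n (P : {mpoly K[n]}) :
  (1 < msize P)%N -> exists i, P^`M(i) != 0.
Proof.
move=> sP; have P0 : P != 0 by rewrite -msize_poly_eq0 -lt0n ltnW.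
move: sP; rewrite -(mlead_deg P0) ltnS lt0n mdeg_eq0 => m0.
have [i mi] : exists i, mlead P i != 0%N.
  apply/existsP; rewrite -negb_forall; apply: contra m0 => /forallP h.
  by apply/eqP/mnmP => i; rewrite mnm0E; apply/eqP.
exists i; apply/eqP => /mpolyP /(_ (mlead P - U_(i))%MM).
rewrite mcoeff_deriv mcoeff0 submK ?lep1mP // => /eqP.
by rewrite mulrn_eq0 /= mleadc_eq0 (negbTE P0).
Qed.

Lemma rdvdXn_coef (K : comNzRingType) (f : {poly K}) e :
  rdvd 'X^e f <-> forall i, (i < e)%N -> f`_i = 0.
Proof.
split=> [[g ->] i ie|H]; first by rewrite coefMXn ie.
exists (\poly_(i < size f) f`_(i + e)); apply/polyP => i; rewrite coefMXn.
case: ltnP => [/H //|ei]; rewrite coef_poly subnK //.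
by case: ltnP => // h; rewrite nth_default // (leq_trans h) // leq_subr.
Qed.

(* Dividing out the hypersurface once costs at most one order of vanishing at
   a smooth point, and the points where the gradient of P vanishes are
   swallowed by the extra factor P^`M(i). *)
Lemma rdvd_power_vanishing_order (K : numClosedFieldType) n (P Q : {mpoly K[n]}) e :
  prime_elt P ->
  (forall a b, P.@[a] = 0 -> rdvd 'X^e (mline a b Q)) -> rdvd (P ^+ e) Q.
Proof.
move=> pP H; suff: forall k, (k <= e)%N -> rdvd (P ^+ k) Q by apply.
elim=> [_|k IH ke]; first by exists Q; rewrite expr0 mulr1.
have [Q' eQ] := IH (ltnW ke); have [P0 PU PD] := pP.
have sP : (1 < msize P)%N.
  rewrite ltnNge; apply: contra PU => sP.
  move: P0; rewrite (msize1_polyC sP); move: (P@_0%MM) => c.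
  rewrite mpolyC_eq0 => c0.
  by apply/unitrP; exists c^-1%:MP; rewrite -!mpolyCM mulVf ?mulfV.
have [i di] := mderiv_neq0 sP.
have : rdvd P (P^`M(i) * Q').
  apply: rdvd_nullstellensatz => // a Pa; rewrite mevalM.
  pose b (j : 'I_n) : K := (j == i)%:R.
  have [h eh] : rdvd ('X^1) (mline a b P).
    by apply/rdvdXn_coef => -[|//] _; rewrite -horner_coef0 horner_mline0.
  have h0 : h.[0] = P^`M(i).@[a].
    rewrite -(horner_mline0 a b) -deriv_mline eh expr1.
    by rewrite derivM derivX mulr1 hornerD hornerM hornerX mulr0 add0r.
  have [g eg] := H a b Pa.
  move: eg; rewrite eQ rmorphM rmorphXn /= eh exprMn -exprM mul1n.
  rewrite mulrA -(subnK ke) exprD exprS => eg.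
  (* Cancelling t^k leaves Q' h^k divisible by t, and h(0) is the i-th partial derivative of P at
     a. *)
  have {}eg : mline a b Q' * h ^+ k = g * 'X^(e - k.+1) * 'X.
    have Xk0 : 'X^k != 0 :> {poly K} by rewrite -size_poly_gt0 size_polyXn.
    by apply: (mulIf Xk0); rewrite eg; ring.
  have := congr1 (fun p => p.[0]) eg; rewrite /= !hornerM horner_exp hornerX mulr0 h0 horner_mline0.
  by move/eqP; rewrite mulf_eq0 expf_eq0 => /orP [/eqP ->|/andP [_ /eqP ->]]; rewrite ?mulr0 ?mul0r.
case/PD => [[z ez]|[z ez]]; last first.
  by exists z; rewrite eQ ez exprS; ring.
have z0 : z != 0 by apply: contraNneq di => z0; rewrite ez z0 mul0r.
have := msize_mderiv di; rewrite ez msizeM //.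
move: z0; rewrite -msize_poly_eq0 -lt0n => z0.
by move: z0 sP; clear; move: (msize z) (msize P) => x y; lia.
Qed.

(** * Bases adapted to a polynomial map *)

Section LeadingTerms.
Variables (A : comNzRingType) (N : nat).
Implicit Types (p q : {mpoly A[N]}) (m : 'X_{1..N}).

Lemma mcoeff_pihomog k p m :
  (pihomog mdeg k p)@_m = if mdeg m == k then p@_m else 0.
Proof.
rewrite pihomogE raddf_sum /= big_mkcond /=.
have [mp|mp] := boolP (m \in msupp p); last first.
  rewrite (memN_msupp_eq0 mp) if_same big_seq big1 // => x xp; case: ifP => // _.
  rewrite mcoeffZ mcoeffX; case: eqP xp => [->|]; rewrite ?mulr0 //.
  by rewrite (negbTE mp).
rewrite (bigD1_seq m) ?msupp_uniq //= mcoeffZ mcoeffX eqxx mulr1.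
rewrite big1 ?addr0 // => x xm; case: ifP => // _.
by rewrite mcoeffZ mcoeffX (negbTE xm) mulr0.
Qed.

Definition deg_le k p := forall m, (k < mdeg m)%N -> p@_m = 0.
(** Degrees above k take part in the comparison, so that q has degree at most k as well. *)
Definition same_top k p q := deg_le k p /\ forall m, (k <= mdeg m)%N -> p@_m = q@_m.

Lemma deg_leP k p : deg_le k p <-> (msize p <= k.+1)%N.
Proof.
split=> [H|H m km]; last by apply: memN_msupp_eq0; apply: msize_mdeg_ge; apply: leq_trans km.
have [->|p0] := eqVneq p 0; first by rewrite msize0.
rewrite -(mlead_deg p0) ltnS leqNgt; apply/negP => /H /eqP.
by rewrite mleadc_eq0 (negbTE p0).
Qed.

Lemma deg_leW k l p : (k <= l)%N -> deg_le k p -> deg_le l p.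
Proof. by move=> kl H m lm; apply: H; apply: leq_ltn_trans lm. Qed.

Lemma mcoeffM_eq p q p' q' m :
  (forall m1 m2, mdeg m = (mdeg m1 + mdeg m2)%N -> m = (m1 + m2)%MM ->
    p@_m1 * q@_m2 = p'@_m1 * q'@_m2) ->
  (p * q)@_m = (p' * q')@_m.
Proof.
move=> H; rewrite !mcoeffM; apply: eq_bigr => -[m1 m2] /= /eqP em.
by apply: H => //; have := congr1 mdeg em; rewrite mdegD.
Qed.

Lemma deg_leM k l p q : deg_le k p -> deg_le l q -> deg_le (k + l) (p * q).
Proof.
move=> pk ql m klm; rewrite -(mcoeff0 A m) -(mul0r 0).
apply: mcoeffM_eq => m1 m2 dm _; rewrite mcoeff0 mul0r.
have [h|h] := ltnP k (mdeg m1); first by rewrite pk ?mul0r.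
by rewrite (ql m2) ?mulr0 //; lia.
Qed.

Lemma deg_leX m : deg_le (mdeg m) 'X_[m].
Proof. by apply/deg_leP; rewrite msizeX. Qed.

Lemma same_topM k l p p' q q' :
  same_top k p p' -> same_top l q q' -> same_top (k + l) (p * q) (p' * q').
Proof.
move=> [pk pE] [ql qE]; split; first exact: deg_leM.
move=> m klm; apply: mcoeffM_eq => m1 m2 dm _.
have [h1|h1] := ltnP (mdeg m1) k.
  by rewrite -(qE m2) ?(ql m2) ?mulr0 //; lia.
have [h2|h2] := ltnP (mdeg m2) l.
  by rewrite -(pE m1) ?(pk m1) ?mul0r //; lia.
by rewrite pE ?qE.
Qed.

Lemma same_top_refl k p : deg_le k p -> same_top k p p.
Proof. by []. Qed.

Lemma deg_le1 : deg_le 0 (1 : {mpoly A[N]}).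
Proof. by have := @deg_leX 0%MM; rewrite mdeg0 mpolyX0. Qed.

Lemma same_top_exp k p q e : same_top k p q -> same_top (k * e) (p ^+ e) (q ^+ e).
Proof.
move=> pq; elim: e => [|e IH]; first by rewrite muln0 !expr0; exact/same_top_refl/deg_le1.
by rewrite !exprS mulnS; exact: same_topM.
Qed.

Lemma same_top_prod (I : Type) (r : seq I) (k : I -> nat) (p q : I -> {mpoly A[N]}) :
  (forall i, same_top (k i) (p i) (q i)) ->
  same_top (\sum_(i <- r) k i)%N (\prod_(i <- r) p i) (\prod_(i <- r) q i).
Proof.
move=> H; elim: r => [|x r IH]; first by rewrite !big_nil; exact/same_top_refl/deg_le1.
by rewrite !big_cons; exact: same_topM.
Qed.

End LeadingTerms.

Section AdaptedBasis.
Variables (A : comNzRingType) (N d : nat).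
Implicit Types (F : 'I_N -> {mpoly A[N]}) (g m : 'X_{1..N}).

Definition mnm_div g : 'X_{1..N} := [multinom (g i %/ d)%N | i < N].
Definition mnm_mod g : 'X_{1..N} := [multinom (g i %% d)%N | i < N].

Lemma mnm_divmod g : g = (mnm_div g *+ d + mnm_mod g)%MM.
Proof. by apply/mnmP => i; rewrite mnmDE mulmnE !mnmE -divn_eq. Qed.

Lemma mdeg_divmod g : mdeg g = (mdeg (mnm_mod g) + d * mdeg (mnm_div g))%N.
Proof. by rewrite {1}(mnm_divmod g) mdegD mdegMn addnC mulnC. Qed.

Definition adapted F g : {mpoly A[N]} :=
  'X_[mnm_mod g] * \prod_i F i ^+ mnm_div g i.

Definition nthm n (i : 'I_#|{: 'X_{1..N < n.+1}}|) : 'X_{1..N} :=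
  (enum_val i : 'X_{1..N < n.+1}).
Arguments nthm n i : clear implicits.

Lemma mdeg_nthm n i : (mdeg (nthm n i) <= n)%N.
Proof. by rewrite -ltnS; exact: bmdeg. Qed.

Lemma nthm_inj n : injective (nthm n).
Proof. by move=> i j /val_inj /enum_val_inj. Qed.

Lemma nthm_surj n m : (mdeg m <= n)%N -> exists i, nthm n i = m.
Proof.
move=> mn; exists (enum_rank (BMultinom (mn : (mdeg m < n.+1)%N))).
by rewrite /nthm enum_rankK.
Qed.

Lemma big_nthm (T : Type) (idx : T) (op : Monoid.com_law idx) n (f : 'X_{1..N} -> T) :
  \big[op/idx]_(m : 'X_{1..N < n.+1}) f m = \big[op/idx]_i f (nthm n i).
Proof. by rewrite (reindex _ (onW_bij _ (@enum_val_bij {: 'X_{1..N < n.+1}}))). Qed.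

Definition adapted_mx F n : 'M[A]_#|{: 'X_{1..N < n.+1}}| :=
  \matrix_(i, j) (adapted F (nthm n i))@_(nthm n j).

Definition adapted_det F n : A := \det (adapted_mx F n).

Lemma same_top_adapted F F' g :
  (forall i, same_top d (F i) (F' i)) ->
  same_top (mdeg g) (adapted F g) (adapted F' g).
Proof.
move=> H; rewrite mdeg_divmod; apply: same_topM.
  by apply: same_top_refl; exact: deg_leX.
rewrite mdegE big_distrr /=; apply: same_top_prod => i; exact: same_top_exp.
Qed.

Lemma deg_le_adapted F g :
  (forall i, deg_le d (F i)) -> deg_le (mdeg g) (adapted F g).
Proof. by move=> H; apply: (proj1 (@same_top_adapted F F g _)) => i; exact: same_top_refl. Qed.

Lemma adapted_homog F g :
  (forall i, F i \is d.-homog) -> adapted F g \is (mdeg g).-homog.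
Proof.
move=> H; rewrite mdeg_divmod; apply: dhomogM; first by rewrite dhomogX.
rewrite mdegE big_distrr /=; elim/big_rec2: _ => [|i x y _ IH]; first exact: dhomog1.
by apply: dhomogM => //; apply: dhomogMn.
Qed.

(* In the Leibniz expansion the degrees of the rows bound those of the columns,
   and both add up to the same number. *)
Lemma adapted_det_same_top F F' n :
  (forall i, same_top d (F i) (F' i)) -> adapted_det F n = adapted_det F' n.
Proof.
move=> H; apply: eq_bigr => s _; congr (_ * _).
have H' i : same_top d (F' i) (F' i).
  apply: same_top_refl => m dm; have [Fd FE] := H i.
  by rewrite -FE ?Fd // ltnW.
have [/forallP E|] := boolP [forall i, (mdeg (nthm n (s i)) <= mdeg (nthm n i))%N].
  have {}E i : mdeg (nthm n (s i)) = mdeg (nthm n i).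
    have := leqif_sum (fun i (_ : true) => @leqif_eq _ _ (E i)).
    have -> : (\sum_i mdeg (nthm n i) = \sum_i mdeg (nthm n (s i)))%N.
      by rewrite [LHS](reindex_inj (@perm_inj _ s)).
    by case=> _; rewrite eqxx => /esym /forallP /(_ i) /eqP.
  apply: eq_bigr => i _; rewrite !mxE; apply: (proj2 (same_top_adapted _ H)).
  by rewrite E.
rewrite negb_forall; case/existsP => i; rewrite -ltnNge => lt.
rewrite (bigD1 i) //= [RHS](bigD1 i) //= !mxE.
by rewrite (proj1 (same_top_adapted _ H)) // (proj1 (same_top_adapted _ H')) // !mul0r.
Qed.

Lemma same_top_lead F i : deg_le d (F i) -> same_top d (F i) (pihomog mdeg d (F i)).
Proof.
move=> H; split=> // m; rewrite mcoeff_pihomog leq_eqVlt => /orP [/eqP ->|dm].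
  by rewrite eqxx.
by rewrite gtn_eqF // H.
Qed.

Lemma meval_deg_le n p (z : 'I_N -> A) : deg_le n p ->
  p.@[z] = \sum_i p@_(nthm n i) * ('X_[nthm n i]).@[z].
Proof.
move=> /deg_leP H; rewrite {1}(mpolywE H) rmorph_sum /=.
rewrite -(big_nthm _ n (fun m => p@_m * meval z (mpolyX A m))).
by apply: eq_bigr => m _; rewrite mevalZ.
Qed.

Lemma det_adapted_meval F n (z : 'I_#|{: 'X_{1..N < n.+1}}| -> 'I_N -> A) :
  (forall i, deg_le d (F i)) ->
  \det (\matrix_(i, j) (adapted F (nthm n i)).@[z j]) =
  adapted_det F n * \det (\matrix_(i, j) ('X_[nthm n i]).@[z j]).
Proof.
move=> H; rewrite /adapted_det -det_mulmx; congr (\det _); apply/matrixP => i j.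
rewrite !mxE (@meval_deg_le n); last first.
  by move=> m nm; apply: (deg_le_adapted H); apply: leq_ltn_trans nm; exact: mdeg_nthm.
by apply: eq_bigr => k _; rewrite !mxE.
Qed.

Lemma adapted_Xn g : adapted (fun i => 'X_i ^+ d) g = 'X_[g].
Proof.
rewrite /adapted (mpolyXE_id A (mnm_mod g)) (mpolyXE_id A g) -big_split /=.
by apply: eq_bigr => i _; rewrite !mnmE -exprM -exprD addnC mulnC -divn_eq.
Qed.

Lemma adapted_det_Xn n : adapted_det (fun i => 'X_i ^+ d) n = 1.
Proof.
rewrite /adapted_det (_ : adapted_mx _ _ = 1%:M) ?det1 //.
apply/matrixP => i j; rewrite !mxE adapted_Xn mcoeffX.
by rewrite (inj_eq (@nthm_inj n)).
Qed.

End AdaptedBasis.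
Arguments nthm {N} n i.

Lemma map_adapted (A B : comNzRingType) (f : {rmorphism A -> B}) N d
  (F : 'I_N -> {mpoly A[N]}) g :
  map_mpoly f (adapted d F g) = adapted d (fun i => map_mpoly f (F i)) g.
Proof.
rewrite /adapted rmorphM /= map_mpolyX rmorph_prod; congr (_ * _).
by apply: eq_bigr => i _; rewrite rmorphXn.
Qed.

Lemma rmorph_adapted_det (A B : comNzRingType) (f : {rmorphism A -> B}) N d
  (F : 'I_N -> {mpoly A[N]}) n :
  f (adapted_det d F n) = adapted_det d (fun i => map_mpoly f (F i)) n.
Proof.
rewrite /adapted_det -det_map_mx; congr (\det _); apply/matrixP => i j.
by rewrite !mxE -map_adapted mcoeff_map_mpoly.
Qed.

Section Spanning.
Variables (K : fieldType) (N d : nat).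
Hypotheses (N_gt0 : (0 < N)%N) (d_gt0 : (0 < d)%N).
Variable F : 'I_N -> {mpoly K[N]}.
Hypothesis F_deg : forall i, deg_le d (F i).
Implicit Types (p q : {mpoly K[N]}) (m g : 'X_{1..N}).

Definition in_span n p :=
  exists c : 'I_#|{: 'X_{1..N < n.+1}}| -> K, p = \sum_i c i *: adapted d F (nthm n i).

Lemma in_span0 n : in_span n 0.
Proof. by exists (fun=> 0); rewrite big1 // => i _; rewrite scale0r. Qed.

Lemma in_spanD n p q : in_span n p -> in_span n q -> in_span n (p + q).
Proof.
move=> [a ->] [b ->]; exists (fun i => a i + b i); rewrite -big_split.
by apply: eq_bigr => i _; rewrite scalerDl.
Qed.

Lemma in_spanZ n a p : in_span n p -> in_span n (a *: p).
Proof.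
move=> [c ->]; exists (fun i => a * c i); rewrite scaler_sumr.
by apply: eq_bigr => i _; rewrite scalerA.
Qed.

Lemma in_span_sum n (I : Type) (r : seq I) (P : pred I) (f : I -> {mpoly K[N]}) :
  (forall i, P i -> in_span n (f i)) -> in_span n (\sum_(i <- r | P i) f i).
Proof. by move=> H; elim/big_ind: _ => //; [exact: in_span0|move=> p q; exact: in_spanD]. Qed.

Lemma in_span_adapted n g : (mdeg g <= n)%N -> in_span n (adapted d F g).
Proof.
move=> /nthm_surj [i <-]; exists (fun j => (j == i)%:R).
rewrite (bigD1 i) //= eqxx scale1r big1 ?addr0 // => j /negbTE ->.
by rewrite scale0r.
Qed.

Lemma in_span_widen k n p : (k <= n)%N -> in_span k p -> in_span n p.
Proof.
move=> kn [c ->]; apply: in_span_sum => i _; apply/in_spanZ/in_span_adapted.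
by rewrite (leq_trans _ kn) // mdeg_nthm.
Qed.

(** Adding d to an exponent raises its quotient by 1 and keeps its remainder. *)
Lemma mul_adapted i g : F i * adapted d F g = adapted d F (g + U_(i) *+ d)%MM.
Proof.
have em j : mnm_mod d (g + U_(i) *+ d)%MM j = mnm_mod d g j.
  by rewrite !mnmE mulmnE mnm1E; case: (i == j); rewrite ?mul0n ?addn0 // mul1n modnDr.
have ed j : mnm_div d (g + U_(i) *+ d)%MM j = (mnm_div d g j + (i == j))%N.
  rewrite !mnmE mulmnE mnm1E; case: (i == j); last by rewrite mul0n !addn0.
  by rewrite mul1n divnDr ?dvdnn // divnn d_gt0.
rewrite /adapted (_ : mnm_mod d (g + _)%MM = mnm_mod d g); last exact/mnmP.
rewrite mulrCA; congr (_ * _).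
rewrite (bigD1 i) //= [RHS](bigD1 i) //= ed eqxx addn1 exprS mulrA; congr (_ * _).
by apply: eq_bigr => j /negbTE ji; rewrite ed eq_sym ji addn0.
Qed.

Lemma in_span_mulF i n p : in_span n p -> in_span (n + d) (F i * p).
Proof.
move=> [c ->]; rewrite mulr_sumr; apply: in_span_sum => j _.
rewrite -scalerAr mul_adapted; apply/in_spanZ/in_span_adapted.
by rewrite mdegD mdegMn mdeg1 mul1n leq_add2r mdeg_nthm.
Qed.

Lemma in_span_monomials n p : deg_le n p ->
  (forall m, (mdeg m <= n)%N -> in_span n 'X_[m]) -> in_span n p.
Proof.
move=> pn H; rewrite (mpolyE p) big_seq; apply: in_span_sum => m mp.
apply/in_spanZ/H; rewrite leqNgt; apply/negP => /pn/eqP.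
by rewrite mcoeff_eq0 mp.
Qed.

Lemma adapted_det_in_span n m :
  adapted_det d F n != 0 -> (mdeg m <= n)%N -> in_span n 'X_[m].
Proof.
move=> D0 /nthm_surj [j <-].
have MU : adapted_mx d F n \in unitmx by rewrite unitmxE unitfE.
exists (fun i => invmx (adapted_mx d F n) j i); apply/mpolyP => m'.
rewrite raddf_sum /= mcoeffX; have [m'n|nm'] := leqP (mdeg m') n.
  have [k <-] := nthm_surj m'n; rewrite (inj_eq (@nthm_inj _ n)).
  have := congr1 (fun B => fun_of_matrix B j k) (mulVmx MU); rewrite /= !mxE => <-.
  by apply: eq_bigr => i _; rewrite mcoeffZ mxE.
rewrite big1 => [|i _]; last first.
  rewrite mcoeffZ (deg_le_adapted F_deg) ?mulr0 //.
  by rewrite (leq_ltn_trans _ nm') // mdeg_nthm.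
by case: eqP nm' => // <-; rewrite ltnNge mdeg_nthm.
Qed.

Lemma in_span_adapted_det n :
  (forall m, (mdeg m <= n)%N -> in_span n 'X_[m]) -> adapted_det d F n != 0.
Proof.
move=> H; have /choice [c cE] : forall j, exists c, 'X_[nthm n j] =
    \sum_i c i *: adapted d F (nthm n i) by move=> j; apply: H; exact: mdeg_nthm.
have : (\matrix_(j, i) c j i) *m adapted_mx d F n = 1%:M.
  apply/matrixP => j k; rewrite !mxE -(inj_eq (@nthm_inj _ n)) -mcoeffX cE raddf_sum.
  by apply: eq_bigr => i _; rewrite !mxE /= mcoeffZ.
by move/mulmx1_unit => [_]; rewrite unitmxE unitfE.
Qed.

(* Beyond degree N d some exponent is at least d, so a factor F_i splits off. *)
Lemma adapted_det_neq0 :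
  (forall k, (k <= N * d)%N -> adapted_det d F k != 0) ->
  forall n, adapted_det d F n != 0.
Proof.
move=> H; suff S n m : (mdeg m <= n)%N -> in_span n 'X_[m].
  by move=> n; apply: in_span_adapted_det => m; exact: S.
elim/ltn_ind: n m => n IH m mn.
have [nNd|Ndn] := leqP n (N * d); first exact: adapted_det_in_span (H _ nNd) mn.
case: n IH mn Ndn => // n IH mn Ndn.
have IHp k p : (k <= n)%N -> deg_le k p -> in_span k p.
  by move=> kn pk; apply: in_span_monomials => // m' m'k; apply: IH.
have [m0|m_gt0] := posnP (mdeg m).
  by apply: (@in_span_widen 0) => //; apply: IH; rewrite ?m0.
have [i mi] : exists i, m i != 0%N.
  have : m != 0%MM by rewrite -mdeg_eq0 -lt0n.
  by move=> mn0; apply/existsP; rewrite -negb_forall; apply: contra mn0 => /forallP h;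
     apply/eqP/mnmP => i; rewrite mnm0E; apply/eqP.
have em : m = (U_(i) + (m - U_(i)))%MM by rewrite addmC submK ?lep1mP.
have [|c] := IH n (ltnSn n) (m - U_(i))%MM.
  by move: mn; rewrite {1}em mdegD mdeg1 add1n ltnS.
rewrite {2}em mpolyXD => ->; rewrite mulr_sumr; apply: in_span_sum => j _.
rewrite -scalerAr; apply: in_spanZ.
have [lt|ge] := ltnP (mdeg (nthm n j)) n.
  apply: (@in_span_widen n) => //; apply: IHp => //.
  have := deg_leM (@deg_leX K N U_(i)) (deg_le_adapted (g := nthm n j) F_deg).
  by rewrite mdeg1; apply: deg_leW.
have [l dl] : exists l, (d <= nthm n j l)%N.
  apply/existsP; rewrite -[[exists _, _]]negbK negb_exists; apply/negP => /forallP h.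
  have : (mdeg (nthm n j) <= N * d.-1)%N.
    rewrite mdegE -[N in (N * _)%N]card_ord -sum_nat_const; apply: leq_sum => l _.
    by have := h l; rewrite -ltnNge => lt; rewrite -ltnS prednK.
  move=> le; have := leq_trans ge le; move: N_gt0 d_gt0 Ndn; clear; case: d => // k; nia.
have eg : nthm n j = ((nthm n j - U_(l) *+ d) + U_(l) *+ d)%MM.
  rewrite submK //; apply/mnm_lepP => t; rewrite mulmnE mnm1E.
  by case: eqP => [<-|]; rewrite ?mul1n ?mul0n.
set g := (nthm n j - U_(l) *+ d)%MM in eg.
have dg : (mdeg g + d <= n)%N.
  by have := mdeg_nthm j; rewrite eg mdegD mdegMn mdeg1 mul1n.
rewrite eg -mul_adapted mulrCA.
(* With F_l split off, X_i B_g has degree at most |g| + 1 <= n, so the induction hypothesis applies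
   to it before F_l is multiplied back. *)
apply: (@in_span_widen ((mdeg g).+1 + d)); first by rewrite addSn ltnS.
apply: in_span_mulF; apply: IHp; first by rewrite (leq_trans _ dg) // -addn1 leq_add2l.
have := deg_leM (@deg_leX K N U_(i)) (deg_le_adapted (g := g) F_deg).
by rewrite mdeg1 add1n.
Qed.

End Spanning.

(** * Divisibility of the transition determinants by the resultant *)

Lemma homog_deg_le (A : comNzRingType) N k (f : {mpoly A[N]}) :
  f \is k.-homog -> deg_le k f.
Proof. by move=> fk m km; apply: (dhomog_nemf_coeff fk); rewrite gtn_eqF. Qed.

Section Shear.
Variables (A : comNzRingType) (N d : nat) (i0 : 'I_N).
Implicit Types (p : 'I_N -> A) (f : {mpoly A[N]}) (m : 'X_{1..N}).

(** A unipotent change of variables. If p_i0 = 1, the value of the sheared polynomial at e_i0 is the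
    value of the original one at p: a common zero p becomes a coordinate point. *)
Definition shear p : {mpoly A[N]} -> {mpoly A[N]} :=
  mmap (@mpolyC N A) (fun i => 'X_i + (if i == i0 then 0 else p i)%:MP * 'X_i0).
HB.instance Definition _ p := GRing.RMorphism.on (shear p).

Lemma shearC p c : shear p c%:MP = c%:MP.
Proof. by rewrite /shear mmapC. Qed.

Lemma shearXU p i :
  shear p 'X_i = 'X_i + (if i == i0 then 0 else p i)%:MP * 'X_i0.
Proof. by rewrite /shear mmapX mmap1U. Qed.

Lemma shearZ p c f : shear p (c *: f) = c *: shear p f.
Proof. by rewrite -!mul_mpolyC rmorphM /= shearC. Qed.

Lemma shearK p : cancel (shear p) (shear (fun i => - p i)).
Proof.
apply: (@rmorph_mpoly_eq _ _ _ (shear _ \o shear p) idfun) => [c|i] /=.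
  by rewrite !shearC.
rewrite shearXU rmorphD rmorphM /= shearC !shearXU eqxx.
case: eqP => _; first by rewrite !mpolyC0; ring.
by rewrite mpolyCN mpolyC0; ring.
Qed.

Lemma shear_homog p k f : f \is k.-homog -> shear p f \is k.-homog.
Proof.
move=> /dhomogP H; rewrite (mpolyE f) rmorph_sum /= big_seq.
apply: rpred_sum => m mf; have <- : mdeg m = k := H m mf.
rewrite shearZ; apply: dhomogZ.
rewrite mpolyXE_id rmorph_prod mdegE.
elim/big_rec2: _ => [|i x y _ IH]; first exact: dhomog1.
apply: dhomogM => //; rewrite rmorphXn /= shearXU.
have : 'X_i + (if i == i0 then 0 else p i)%:MP * 'X_i0 \is [in A[N], 1.-homog].
  apply: dhomogD; first by rewrite dhomogX /= mdeg1.
  by rewrite mul_mpolyC; apply: dhomogZ; rewrite dhomogX /= mdeg1.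
by move/(dhomogMn (m i)); rewrite mul1n.
Qed.

Definition shear_mx p n : 'M[A]_#|{: 'X_{1..N < n.+1}}| :=
  \matrix_(i, j) (shear p 'X_[nthm n i])@_(nthm n j).

Lemma shear_coef p n f m : deg_le n f ->
  (shear p f)@_m = \sum_i f@_(nthm n i) * (shear p 'X_[nthm n i])@_m.
Proof.
move=> /deg_leP H; rewrite {1}(mpolywE H) rmorph_sum raddf_sum /=.
rewrite -(big_nthm _ n (fun k => f@_k * (shear p (mpolyX A k))@_m)).
by apply: eq_bigr => k _; rewrite shearZ mcoeffZ.
Qed.

Lemma det_shear_mx p n : \det (shear_mx p n) * \det (shear_mx (fun i => - p i) n) = 1.
Proof.
rewrite -det_mulmx (_ : _ *m _ = 1%:M) ?det1 //; apply/matrixP => i j.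
rewrite !mxE -(inj_eq (@nthm_inj _ n)) -mcoeffX -[in RHS](shearK p 'X_[nthm n i]).
rewrite (@shear_coef _ n); first by apply: eq_bigr => k _; rewrite !mxE.
apply: deg_leW (mdeg_nthm i) _; apply: homog_deg_le.
by apply: shear_homog; rewrite dhomogX.
Qed.

Lemma meval_shear p f : p i0 = 1 ->
  (shear p f).@[fun i => (i == i0)%:R] = f.@[p].
Proof.
move=> p1; apply: (@rmorph_mpoly_eq _ _ _ (meval _ \o shear p) (meval p)) => [c|i] /=.
  by rewrite shearC !mevalC.
rewrite shearXU mevalD mevalM mevalC !mevalXU eqxx mulr1.
by case: eqP => [->|_]; rewrite ?addr0 ?add0r ?p1.
Qed.

Lemma meval_unit_homog f : f \is d.-homog ->
  f.@[fun i => (i == i0)%:R] = f@_(U_(i0) *+ d)%MM.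
Proof.
move=> /dhomogP H; rewrite mevalE.
have step m : m \in msupp f -> (m != U_(i0) *+ d)%MM ->
    f@_m * \prod_i ((i == i0)%:R : A) ^+ m i = 0.
  move=> mf me; have [i /andP [ii mi]] : exists i, (i != i0) && (m i != 0%N).
    apply/existsP; rewrite -[[exists _, _]]negbK negb_exists; apply: contra me => /forallP h.
    have z i : i != i0 -> m i = 0%N.
      by move=> ii; have := h i; rewrite ii /= negbK => /eqP.
    have md : mdeg m = d := H _ mf.
    apply/eqP/mnmP => i; rewrite mulmnE mnm1E -md mdegE (bigD1 i0) //= big1 ?addn0 //.
    by case: eqP => [<-|/eqP]; rewrite ?mul1n // mul0n eq_sym => /z.
  rewrite (bigD1 i) //= (negbTE ii) expr0n (negbTE mi) mul0r mulr0 //.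
have prod1 : \prod_i ((i == i0)%:R : A) ^+ (U_(i0) *+ d)%MM i = 1.
  apply: big1 => i _; rewrite mulmnE mnm1E eq_sym.
  by case: eqP; rewrite ?expr1n // mul0n expr0.
have [mf|mf] := boolP ((U_(i0) *+ d)%MM \in msupp f).
  rewrite (bigD1_seq (U_(i0) *+ d)%MM) ?msupp_uniq //= prod1 mulr1.
  by rewrite big_seq_cond big1 ?addr0 // => m /andP [mf' mn]; exact: step.
rewrite (memN_msupp_eq0 mf) big_seq big1 // => m mf'; apply: step => //.
by apply: contraNneq mf => <-.
Qed.

End Shear.

Section VanishingOrder.
Variables (A : idomainType) (N d : nat) (i0 : 'I_N) (x : A).
Hypotheses (d_gt0 : (0 < d)%N).
Implicit Types (f h : {mpoly A[N]}) (m g : 'X_{1..N}).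

Lemma mdeg_off m : (m i0 + (mdeg m - m i0) = mdeg m)%N.
Proof. by rewrite subnKC // mdegE (bigD1 i0) //= leq_addr. Qed.

(** Membership of f in the k-th power of the ideal generated by x and the X_i with i <> i0, read off
    the coefficients: |m| - m_i0 is the degree of X^m in these variables. *)
Definition order_ge k f := forall m, rdvd (x ^+ (k - (mdeg m - m i0))) f@_m.

Lemma order_ge0 f : order_ge 0 f.
Proof. by move=> m; exists f@_m; rewrite sub0n expr0 mulr1. Qed.

Lemma rdvd_exp (a b : nat) (y : A) : (a <= b)%N -> rdvd (x ^+ b) y -> rdvd (x ^+ a) y.
Proof.
by move=> ab [z ->]; exists (z * x ^+ (b - a)); rewrite -mulrA -exprD subnK.
Qed.

Lemma order_geM k l f h : order_ge k f -> order_ge l h -> order_ge (k + l) (f * h).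
Proof.
move=> kf lg m; rewrite mcoeffM; apply: rdvd_sum => -[m1 m2] /= /eqP em.
have [u eu] := kf m1; have [v ev] := lg m2.
apply: (@rdvd_exp _ ((k - (mdeg m1 - (m1 : 'X_{1..N}) i0)) + (l - (mdeg m2 - (m2 : 'X_{1..N}) i0)))).
  have := congr1 mdeg em; rewrite mdegD.
  have := congr1 (fun m' : 'X_{1..N} => m' i0) em; rewrite mnmDE.
  have := mdeg_off m1; have := mdeg_off m2.
  lia.
by exists (u * v); rewrite eu ev exprD; ring.
Qed.

Lemma order_geX k f e : order_ge k f -> order_ge (k * e) (f ^+ e).
Proof.
move=> H; elim: e => [|e IH]; first by rewrite muln0; exact: order_ge0.
by rewrite exprS mulnS; exact: order_geM.
Qed.

(** The coefficient of X_i0^d in the sheared form is the value of f at p; every other monomial of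
    degree d contains another variable. *)
Lemma order_ge_shear f (p : 'I_N -> A) : f \is d.-homog -> p i0 = 1 ->
  rdvd x f.@[p] -> order_ge 1 (shear i0 p f).
Proof.
move=> fd p1 xf m; case: (posnP (mdeg m - m i0)) => [m0|m_gt0]; last first.
  by rewrite (eqP (m_gt0 : (1 - _ == 0)%N)) expr0; exists (shear i0 p f)@_m; rewrite mulr1.
rewrite m0 subn0 expr1; have sd := shear_homog i0 p fd.
have em : m = (U_(i0) *+ m i0)%MM.
  have := mdeg_off m; rewrite m0 addn0 mdegE (bigD1 i0) //= -[LHS]addn0 => /addnI/esym/eqP.
  rewrite sum_nat_eq0 => /forall_inP h; apply/mnmP => i; rewrite mulmnE mnm1E.
  by case: eqP => [<-|/eqP ii]; rewrite ?mul1n // mul0n; apply/eqP/h; rewrite eq_sym.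
have [md|md] := eqVneq (mdeg m) d; last first.
  by rewrite (dhomog_nemf_coeff sd md); exists 0; rewrite mul0r.
have e0 : m i0 = d by move: md; rewrite {1}em mdegMn mdeg1 mul1n.
by rewrite em e0 -(meval_unit_homog i0 sd) meval_shear.
Qed.

Lemma order_ge_adapted (H : 'I_N -> {mpoly A[N]}) (p : 'I_N -> A) g :
  (forall i, H i \is d.-homog) -> p i0 = 1 -> (forall i, rdvd x (H i).@[p]) ->
  order_ge (mdeg (mnm_div d g)) (shear i0 p (adapted d H g)).
Proof.
move=> Hd p1 Hx; rewrite rmorphM /= -[mdeg _]add0n; apply: order_geM.
  exact: order_ge0.
rewrite rmorph_prod mdegE; elim/big_rec2: _ => [|i k f _ IH]; first exact: order_ge0.
apply: order_geM => //; rewrite rmorphXn.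
by have := order_geX (mnm_div d g i) (order_ge_shear (Hd i) p1 (Hx i)); rewrite mul1n.
Qed.

Lemma mdeg_div_ge g : (mdeg g %/ d - N <= mdeg (mnm_div d g))%N.
Proof.
have le : (mdeg (mnm_mod d g) <= N * d)%N.
  rewrite mdegE -[N in (N * _)%N]card_ord -sum_nat_const; apply: leq_sum => i _.
  by rewrite mnmE ltnW // ltn_mod.
rewrite leq_subLR (mdeg_divmod d g); move: le; move: (mdeg (mnm_mod d g)) (mdeg (mnm_div d g)) => a b le.
rewrite (addnC a) (mulnC d) divnMDl // addnC leq_add2r.
by rewrite (leq_trans (leq_div2r d le)) // mulnK.
Qed.

(** Row g has order at least |g| / d - N, and column m gives back its degree in the variables other
    than X_i0. Only entries with |g| = |m| can be nonzero, so the guaranteed exponent depends on the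
    column alone. *)
Definition vanishing_order n :=
  (\sum_i ((mdeg (nthm (N := N) n i) %/ d - N) - (mdeg (nthm n i) - nthm n i i0)))%N.

Lemma rdvd_prod (I : Type) (r : seq I) (e : I -> nat) (f : I -> A) :
  (forall i, rdvd (x ^+ e i) (f i)) ->
  rdvd (x ^+ (\sum_(i <- r) e i)) (\prod_(i <- r) f i).
Proof.
move=> H; elim: r => [|i r IH]; first by rewrite !big_nil; exists 1; rewrite mul1r.
rewrite !big_cons exprD; have [u ->] := H i; have [v ->] := IH.
by exists (u * v); ring.
Qed.

Lemma rdvd_adapted_det (H : 'I_N -> {mpoly A[N]}) (p : 'I_N -> A) n :
  (forall i, H i \is d.-homog) -> p i0 = 1 -> (forall i, rdvd x (H i).@[p]) ->
  rdvd (x ^+ vanishing_order n) (adapted_det d H n).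
Proof.
move=> Hd p1 Hx.
suff [z ez] : rdvd (x ^+ vanishing_order n) (adapted_det d H n * \det (shear_mx i0 p n)).
  exists (z * \det (shear_mx i0 (fun i => - p i) n)).
  by rewrite mulrAC -ez -mulrA det_shear_mx mulr1.
rewrite -det_mulmx; apply: rdvd_sum => s _; apply: rdvd_mull.
(* Reindexing by s charges each factor of the Leibniz product to its column. *)
rewrite /vanishing_order (reindex_inj (@perm_inj _ s)) /=; apply: rdvd_prod => i.
set j := s i; have Hdeg k := homog_deg_le (Hd k).
have -> : (adapted_mx d H n *m shear_mx i0 p n) i j =
    (shear i0 p (adapted d H (nthm n i)))@_(nthm n j).
  rewrite mxE (@shear_coef _ _ _ _ n); first by apply: eq_bigr => k _; rewrite !mxE.
  move=> m nm; apply: (deg_le_adapted Hdeg).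
  by rewrite (leq_ltn_trans _ nm) // mdeg_nthm.
have ad := shear_homog i0 p (adapted_homog (nthm n i) Hd).
have [e|ne] := eqVneq (mdeg (nthm n j)) (mdeg (nthm n i)); last first.
  by rewrite (dhomog_nemf_coeff ad ne); exists 0; rewrite mul0r.
apply: rdvd_exp (order_ge_adapted (nthm n i) Hd p1 Hx (nthm n j)).
by rewrite {1}e leq_sub2r // mdeg_div_ge.
Qed.

End VanishingOrder.

(** * Counting monomials, and the asymptotics of the exponent E_n *)

Section Counting.
Variable N : nat.
Implicit Types (m g : 'X_{1..N}).

Lemma hockey_stick k n : (\sum_(m < n.+1) 'C(m + k, k) = 'C(n + k.+1, k.+1))%N.
Proof.
elim: n => [|n IH]; first by rewrite big_ord_recr big_ord0 !add0n /= !binn.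
by rewrite big_ord_recr IH /= [in RHS]addSn binS addSnnS.
Qed.

Lemma card_layer b k : (0 < N)%N -> (k < b)%N ->
  #|[pred g : 'X_{1..N < b} | mdeg g == k]| = 'C(k + N.-1, N.-1).
Proof.
case: N => // N' _ kb.
set s := [seq @s2m N'.+1 t | t : k.-tuple 'I_N'.+1 <- enum (mpoly.basis N'.+1 k)].
rewrite /= -[RHS](@bin_sub (k + N')) ?leq_addl // addnK -size_basis -/s.
rewrite cardE -(size_map (fun g : 'X_{1..N'.+1 < b} => (g : 'X_{1..N'.+1}))).
apply/perm_size/uniq_perm; first by rewrite map_inj_uniq ?enum_uniq //; exact: val_inj.
  exact: uniq_basis.
move=> g; rewrite -basis_cover; apply/mapP/eqP => [[h]|gk].
  by rewrite mem_enum inE => /eqP <- ->.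
have gb : (mdeg g < b)%N by rewrite gk.
by exists (BMultinom gb); rewrite ?mem_enum ?inE //= gk.
Qed.

Lemma sum_by_degree n (f : nat -> nat) : (0 < N)%N ->
  (\sum_(g : 'X_{1..N < n.+1}) f (mdeg g) = \sum_(k < n.+1) 'C(k + N.-1, N.-1) * f k)%N.
Proof.
move=> N_gt0.
rewrite (partition_big (fun g : 'X_{1..N < n.+1} => Ordinal (bmdeg g)) xpredT) //=.
apply: eq_bigr => k _; rewrite -(card_layer N_gt0 (ltn_ord k)) -sum_nat_const.
by apply: eq_big => g; rewrite -val_eqE //= => /eqP ->.
Qed.

Lemma card_bmultinom n : (0 < N)%N -> #|{: 'X_{1..N < n.+1}}| = 'C(N + n, N).
Proof.
move=> N_gt0; rewrite -sum1_card (@sum_by_degree n (fun=> 1%N)) //.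
under eq_bigr => i _ do rewrite muln1.
by rewrite hockey_stick prednK // addnC.
Qed.

Lemma sum_mdeg n : (0 < N)%N ->
  (\sum_(i : 'I_#|{: 'X_{1..N < n.+1}}|) mdeg (nthm n i) = N * 'C(N + n, N.+1))%N.
Proof.
move=> N_gt0; rewrite -(big_nthm _ n (fun g => mdeg g)).
rewrite (sum_by_degree n (fun k => k)) //.
case: n => [|n]; first by rewrite big_ord1 muln0 addn0 bin_small ?muln0.
rewrite big_ord_recl /= muln0 add0n.
have -> : (N + n.+1 = n + N.+1)%N by lia.
rewrite -hockey_stick big_distrr /=; apply: eq_bigr => k _.
rewrite /bump leq0n add1n; case: N N_gt0 => // N' _ /=.
by rewrite mul_bin_left addnS subSn ?leq_addl // addnK mulnC addSn.
Qed.

Lemma sum_small_degree b n : (0 < N)%N -> (b <= n)%N ->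
  (\sum_(g : 'X_{1..N < n.+1}) (mdeg g < b) = 'C(b + N.-1, N))%N.
Proof.
move=> N_gt0 bn; rewrite (@sum_by_degree n (fun k => (k < b)%N)) //.
rewrite -(big_mkord xpredT (fun k => 'C(k + N.-1, N.-1) * (k < b))%N).
rewrite (big_cat_nat (n := b)) //=; last exact: leqW.
rewrite [X in (_ + X)%N]big_nat_cond [X in (_ + X)%N]big1 => [|k /andP [/andP [bk _] _]]; last first.
  by rewrite ltnNge bk muln0.
case: b bn => [|b] bn; first by rewrite big_geq // bin_small // prednK.
rewrite addn0 big_mkord; under eq_bigr => i _ do rewrite ltn_ord muln1.
by rewrite hockey_stick addSnnS prednK.
Qed.

End Counting.

Section VanishingOrderBound.
Variables (N d : nat) (i0 : 'I_N).
Hypothesis d_gt0 : (0 < d)%N.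

Lemma sum_lt_shift a c p :
  (\sum_(k < p) nat_of_bool (a + k < c) = minn p (c - a))%N.
Proof.
elim: p => [|p IH]; first by rewrite big_ord0 min0n.
by rewrite big_ord_recr IH /=; case: ltnP => h; lia.
Qed.

(** The exponent E_n. The binomial counts the monomials in N variables of degree below m / d - N.
    Unlike the vanishing order it does not refer to [i0], which varies with the common zero. *)
Definition resultant_order n : nat :=
  (\sum_(m < n.+1) 'C((m %/ d - N) + N.-1, N))%N.

(* The pairs (m, u) with |u| < m %/ d - N counted by [resultant_order] are sent
   to the pairs (g, k) counted by [vanishing_order]: k is the i0-th exponent of
   u and g replaces that exponent so as to reach the degree m. *)
Lemma resultant_order_le n : (resultant_order n <= vanishing_order d i0 n)%N.
Proof.
have N_gt0 : (0 < N)%N by case: N i0 => // -[].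
pose b m := (m %/ d - N)%N.
have bm m : (b m <= m)%N by rewrite (leq_trans (leq_subr _ _)) // leq_div.
pose T := 'X_{1..N < n.+1}.
pose off (g : 'X_{1..N}) := (mdeg g - g i0)%N.
pose AA := [set x : T * 'I_n.+1 | off x.1 + x.2 < b (mdeg x.1)]%N.
pose BB := [set x : 'I_n.+1 * T | mdeg x.2 < b x.1]%N.
have cB : #|BB| = resultant_order n.
  transitivity (\sum_(x : 'I_n.+1 * T) nat_of_bool (mdeg x.2 < b x.1))%N.
    by rewrite -sum1_card big_mkcond; apply: eq_bigr => x _; rewrite inE; case: ifP.
  rewrite -(pair_bigA _ (fun (m : 'I_n.+1) (u : T) => nat_of_bool (mdeg u < b m)%N)) /=.
  apply: eq_bigr => m _; rewrite -(@sum_small_degree N (b m) n) //.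
  by rewrite (leq_trans (bm m)) // -ltnS.
have cA : #|AA| = vanishing_order d i0 n.
  transitivity (\sum_(x : T * 'I_n.+1) nat_of_bool (off x.1 + x.2 < b (mdeg x.1)))%N.
    by rewrite -sum1_card big_mkcond; apply: eq_bigr => x _; rewrite inE; case: ifP.
  rewrite -(pair_bigA _ (fun (g : T) (k : 'I_n.+1) => nat_of_bool (off g + k < b (mdeg g))%N)) /=.
  rewrite /vanishing_order -(big_nthm _ n (fun g => (b (mdeg g) - off g)%N)).
  apply: eq_bigr => g _; rewrite sum_lt_shift; apply/minn_idPr.
  by rewrite (leq_trans (leq_subr _ _)) // (leq_trans (bm _)) // ltnW // bmdeg.
rewrite -cA -cB.
pose repl m (u : 'X_{1..N}) := [multinom if i == i0 then (m - off u)%N else u i | i < N].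
have offE (u : 'X_{1..N}) : off u = (\sum_(i | i != i0) u i)%N.
  by rewrite /off mdegE (bigD1 i0) //= addKn.
have off_repl m u : off (repl m u) = off u.
  by rewrite !offE; apply: eq_bigr => i /negbTE ii; rewrite mnmE ii.
have deg_repl m u : (off u <= m)%N -> mdeg (repl m u) = m.
  by move=> h; rewrite -(mdeg_off i0) -/(off _) off_repl mnmE eqxx subnK.
pose phi (x : 'I_n.+1 * T) : T * 'I_n.+1 :=
  (insubd (bm0 : T) (repl x.1 x.2), inord ((x.2 : 'X_{1..N}) i0)).
have Bprop x : x \in BB -> [/\ (off x.2 <= x.1)%N, (x.2 : 'X_{1..N}) i0 <= n &
    val (phi x).1 = repl x.1 x.2 :> 'X_{1..N}]%N.
  rewrite inE => h; have h' := leq_trans h (bm x.1).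
  have o1 : (off x.2 <= x.1)%N by rewrite (leq_trans (leq_subr _ _)) // ltnW.
  split=> //.
    rewrite -ltnS (leq_ltn_trans _ (ltn_ord x.1)) // (leq_trans _ (ltnW h')) //.
    by rewrite -(mdeg_off i0 x.2) leq_addr.
  by rewrite /= val_insubd deg_repl // ltn_ord.
have phi_inj : {in BB &, injective phi}.
  move=> [m1 u1] [m2 u2] x1B x2B.
  have [/= o1 n1 e1] := Bprop _ x1B; have [/= o2 n2 e2] := Bprop _ x2B.
  move=> /(congr1 (fun x => (val x.1 : 'X_{1..N}, val x.2))) /=.
  rewrite e1 e2 !inordK // => e12.
  have er : repl m1 u1 = repl m2 u2 by have /= := congr1 fst e12.
  have ei : (u1 : 'X_{1..N}) i0 = (u2 : 'X_{1..N}) i0 by have /= := congr1 snd e12.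
  have em : m1 = m2 by apply: val_inj; rewrite /= -(deg_repl m1 u1) // -(deg_repl m2 u2) // er.
  congr (_, _) => //; apply: val_inj; apply/mnmP => i.
  have [-> //|ii] := eqVneq i i0.
  by have := congr1 (fun g : 'X_{1..N} => g i) er; rewrite /= !mnmE (negbTE ii).
rewrite -(card_in_imset phi_inj); apply/subset_leq_card/fintype.subsetP => y /imsetP [x xB ->].
have [/= o1 n1 e1] := Bprop x xB.
rewrite inE e1 off_repl deg_repl // inordK //.
by move: xB; rewrite inE /off addnC mdeg_off.
Qed.

Lemma bin_add_le a k p : ('C(a + k, p.+1) <= 'C(a, p.+1) + k * 'C(a + k, p))%N.
Proof.
elim: k => [|k IH]; first by rewrite addn0 mul0n addn0.
rewrite addnS binS mulSn addnCA addnC leq_add //.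
  by rewrite leq_bin2l // leqnSn.
by rewrite (leq_trans IH) // leq_add2l leq_mul2l leq_bin2l ?orbT // leqnSn.
Qed.

(** The falling factorials are compared factor by factor, using m < (m / d + 1) d. *)
Lemma bin_scale_le m : ('C(m + N.-1, N) <= d ^ N * 'C(m %/ d + N, N))%N.
Proof.
rewrite -(leq_pmul2r (fact_gt0 N)) -mulnA !bin_ffact.
rewrite !ffact_prod -[N in (d ^ N)%N]card_ord -prod_nat_const -big_split /=.
apply: leq_prod => i _.
have := ltn_ord i; have := ltn_ceil m d_gt0; move: (m %/ d)%N => q h1 h2.
have : (m + N.-1 - i <= q.+1 * d + (N - i.+1))%N by lia.
move=> /leq_trans; apply.
have -> : (q + N - i = q.+1 + (N - i.+1))%N by lia.
by rewrite mulnDr (mulnC d) leq_add2l leq_pmull.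
Qed.

(** One half of E_n ~ D(n) / (N d^N). Passing from m / d + N to (m / d - N) + N - 1 shifts the upper
    index of the binomial by at most N + 1, each shift costing a binomial of lower order; summed
    over m these give at most (N + 1) C(N + n, N), whence the square. *)
Lemma sum_degree_le n :
  (N * 'C(N + n, N.+1) <=
   N * d ^ N * resultant_order n + N * d ^ N * N.+1 ^ 2 * 'C(N + n, N))%N.
Proof.
have N_gt0 : (0 < N)%N by case: N i0 => // -[].
have -> : (N * d ^ N * resultant_order n + N * d ^ N * N.+1 ^ 2 * 'C(N + n, N) =
    N * (d ^ N * (resultant_order n + N.+1 ^ 2 * 'C(N + n, N))))%N.
  by rewrite -!mulnA -!mulnDr.
rewrite leq_mul2l; apply/orP; right.
have -> : ('C(N + n, N.+1) = \sum_(m < n.+1) 'C(m + N.-1, N))%N.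
  case: n => [|n].
    by rewrite big_ord_recr big_ord0 /= !bin_small // ?addn0 // prednK.
  rewrite big_ord_recl /= [in RHS]bin_small ?prednK // add0n.
  have -> : (N + n.+1 = n + N.+1)%N by lia.
  rewrite -hockey_stick; apply: eq_bigr => k _.
  by rewrite /bump leq0n add1n addSn -addnS prednK.
have step m : (m < n.+1)%N -> ('C(m + N.-1, N) <=
    d ^ N * ('C((m %/ d - N) + N.-1, N) + N.+1 * 'C(m + N, N.-1)))%N.
  move=> mn; rewrite (leq_trans (bin_scale_le m)) // leq_mul2l; apply/orP; right.
  set q := (m %/ d)%N; set a := ((q - N) + N.-1)%N.
  have ak : (q + N = a + (q + N - a))%N by rewrite subnKC // /a; lia.
  have kN : (q + N - a <= N.+1)%N by rewrite /a; lia.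
  have := bin_add_le a (q + N - a) N.-1; rewrite prednK // -ak => /leq_trans; apply.
  rewrite leq_add2l leq_mul // leq_bin2l // leq_add2r; exact: leq_div.
apply: (@leq_trans (\sum_(m < n.+1)
    d ^ N * ('C((m %/ d - N) + N.-1, N) + N.+1 * 'C(m + N, N.-1)))%N).
  by apply: leq_sum => m _; exact: step.
rewrite -big_distrr leq_mul2l big_split /= -big_distrr /=; apply/orP; right.
rewrite leq_add2l expnS expn1 -mulnA leq_mul2l; apply/orP; right.
apply: (@leq_trans (\sum_(m < n.+2) 'C(m + N.-1, N.-1))%N).
  rewrite [leqRHS]big_ord_recl /= (leq_trans _ (leq_addl _ _)) //.
  by apply: leq_sum => m _; rewrite /bump leq0n add1n addSn -addnS prednK.
rewrite hockey_stick prednK // -(leq_pmul2l (ltn0Sn n)).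
have := mul_bin_down (n.+1 + N) N; rewrite addnK => <-.
rewrite addSn /= (addnC N n) mulnA leq_mul2r; apply/orP; right; nia.
Qed.

End VanishingOrderBound.

Lemma sum_mdeg_div N d n : (0 < N)%N ->
  (d * \sum_(i : 'I_#|{: 'X_{1..N < n.+1}}|) mdeg (mnm_div d (nthm n i)) <=
   N * 'C(N + n, N.+1))%N.
Proof.
move=> N_gt0; rewrite -sum_mdeg // big_distrr; apply: leq_sum => i _.
by rewrite [leqRHS](mdeg_divmod d) leq_addl.
Qed.

(** * Transition determinants as polynomials in the coefficients *)

Lemma dhomog_bigprod (A : comNzRingType) n (I : Type) (r : seq I) (k : I -> nat)
  (f : I -> {mpoly A[n]}) :
  (forall i, f i \is (k i).-homog) ->
  \prod_(i <- r) f i \is [in A[n], (\sum_(i <- r) k i).-homog].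
Proof.
move=> H; elim: r => [|i r IH]; first by rewrite !big_nil dhomog1.
by rewrite !big_cons; apply: dhomogM.
Qed.

Section TupleOf.
Variables (N d : nat).
Local Notation ci := (coef_index N d).
Implicit Types (A B : comNzRingType).

(** The ring is arbitrary, so that single tuples, pencils a + t b and the generic tuple are all of
    this form. *)
Definition tuple_of A (a : 'I_#|ci| -> A) (i : 'I_N) : {mpoly A[N]} :=
  \sum_(m : {m : 'X_{1..N < d.+1} | mdeg m == d}) a (enum_rank ((i, m) : ci)) *: 'X_[val m].

Lemma tuple_of_homog A (a : 'I_#|ci| -> A) i : tuple_of a i \is d.-homog.
Proof.
apply: rpred_sum => m _; apply: dhomogZ; rewrite dhomogX; exact: valP m.
Qed.

Lemma mcoeff_tuple_of A (a : 'I_#|ci| -> A) i m :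
  (tuple_of a i)@_(val (val m)) = a (enum_rank ((i, m) : ci)).
Proof.
rewrite raddf_sum (bigD1 m) //= mcoeffZ mcoeffX eqxx mulr1 big1 ?addr0 // => m' mm'.
rewrite mcoeffZ mcoeffX; case: eqP => [e|]; rewrite ?mulr0 //.
by case/eqP: mm'; apply/val_inj/val_inj.
Qed.

Lemma homog_eq A (f g : {mpoly A[N]}) : f \is d.-homog -> g \is d.-homog ->
  (forall m : {m : 'X_{1..N < d.+1} | mdeg m == d}, f@_(val (val m)) = g@_(val (val m))) ->
  f = g.
Proof.
move=> fd gd H; apply/mpolyP => m; have [md|md] := eqVneq (mdeg m) d; last first.
  by rewrite (dhomog_nemf_coeff fd md) (dhomog_nemf_coeff gd md).
have mb : (mdeg m < d.+1)%N by rewrite md.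
have md' : mdeg (BMultinom mb) == d by rewrite /= md.
exact: (H (Sub (BMultinom mb) md')).
Qed.

Definition coefs_of A (H : 'I_N -> {mpoly A[N]}) (k : 'I_#|ci|) : A :=
  (H (enum_val k).1)@_(val (val (enum_val k).2)).

Lemma tuple_of_coefs A (H : 'I_N -> {mpoly A[N]}) :
  (forall i, H i \is d.-homog) -> tuple_of (coefs_of H) = H.
Proof.
move=> Hd; apply: funext => i; apply: homog_eq => // [|m]; first exact: tuple_of_homog.
by rewrite mcoeff_tuple_of /coefs_of enum_rankK.
Qed.

Lemma map_tuple_of A B (f : {rmorphism A -> B}) (a : 'I_#|ci| -> A) i :
  map_mpoly f (tuple_of a i) = tuple_of (f \o a) i.
Proof.
rewrite rmorph_sum; apply: eq_bigr => m _.
by rewrite /= map_mpolyZ map_mpolyX.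
Qed.

Definition generic_det A n : {mpoly A[#|ci|]} :=
  adapted_det d (tuple_of (fun k => 'X_k)) n.

Lemma meval_generic_det A (a : 'I_#|ci| -> A) n :
  (generic_det A n).@[a] = adapted_det d (tuple_of a) n.
Proof.
rewrite -[LHS]/(meval a _) rmorph_adapted_det; congr adapted_det.
apply: funext => i; rewrite map_tuple_of; congr (tuple_of _ i).
by apply: funext => k /=; rewrite mevalXU.
Qed.

Lemma mline_generic_det A (a b : 'I_#|ci| -> A) n :
  mline a b (generic_det A n) = adapted_det d (tuple_of (fun k => (a k)%:P + b k *: 'X)) n.
Proof.
rewrite /generic_det rmorph_adapted_det; congr adapted_det.
apply: funext => i; rewrite map_tuple_of; congr (tuple_of _ i).
by apply: funext => k /=; rewrite mlineXU.
Qed.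

Definition coef_homog A k (f : {mpoly {mpoly A[#|ci|]}[N]}) :=
  forall m, f@_m \is [in A[#|ci|], k.-homog].

Lemma coef_homogM A k l (f g : {mpoly {mpoly A[#|ci|]}[N]}) :
  coef_homog k f -> coef_homog l g -> coef_homog (k + l) (f * g).
Proof.
by move=> fk gl m; rewrite mcoeffM; apply: rpred_sum => -[m1 m2] _; apply: dhomogM.
Qed.

Lemma coef_homogX A m : @coef_homog A 0 'X_[m].
Proof.
move=> m'; rewrite mcoeffX; case: eqP => _; last exact: dhomog0.
exact: dhomog1.
Qed.

Lemma coef_homog1 A : @coef_homog A 0 1.
Proof. by rewrite -mpolyX0; exact: coef_homogX. Qed.

Lemma coef_homog_exp A k e (f : {mpoly {mpoly A[#|ci|]}[N]}) :
  coef_homog k f -> coef_homog (k * e) (f ^+ e).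
Proof.
move=> fk; elim: e => [|e IH]; first by rewrite muln0 expr0; exact: coef_homog1.
by rewrite exprS mulnS; exact: coef_homogM.
Qed.

Lemma coef_homog_prod A (I : Type) (r : seq I) (k : I -> nat)
  (f : I -> {mpoly {mpoly A[#|ci|]}[N]}) :
  (forall i, coef_homog (k i) (f i)) ->
  coef_homog (\sum_(i <- r) k i) (\prod_(i <- r) f i).
Proof.
move=> H; elim: r => [|i r IH]; first by rewrite !big_nil; exact: coef_homog1.
by rewrite !big_cons; exact: coef_homogM.
Qed.

(** The degree of A_n in the coefficients of the tuple, as B_g contains |b| factors F_i. *)
Definition det_degree n : nat :=
  (\sum_(i : 'I_#|{: 'X_{1..N < n.+1}}|) mdeg (mnm_div d (nthm n i)))%N.

Lemma generic_det_homog A n : generic_det A n \is (det_degree n).-homog.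
Proof.
apply: rpred_sum => s _; rewrite -signr_odd mulr_sign.
have H : \prod_i adapted_mx d (tuple_of (fun k => 'X_k : {mpoly A[#|ci|]})) n i (s i)
    \is (det_degree n).-homog.
  apply: dhomog_bigprod => i; rewrite mxE; move: (nthm n (s i)).
  rewrite -[mdeg _]add0n; apply: coef_homogM; first exact: coef_homogX.
  rewrite mdegE; apply: coef_homog_prod => j; rewrite -[X in coef_homog X _]mul1n.
  apply: coef_homog_exp => m; rewrite raddf_sum.
  apply: rpred_sum => m' _ /=; rewrite mcoeffZ mcoeffX mulr_natr.
  by apply: rpredMn; rewrite dhomogX /= mdeg1.
by case: ifP => _ //; rewrite rpredN.
Qed.

End TupleOf.

Section HomogeneousLine.
Variables (K : idomainType) (n : nat) (a b : 'I_n -> K).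
Implicit Types (p : {mpoly K[n]}) (f g : {poly K}).

Definition top_coef k f c := (size f <= k.+1)%N /\ f`_k = c.

Lemma top_coefM k l f g c e :
  top_coef k f c -> top_coef l g e -> top_coef (k + l) (f * g) (c * e).
Proof.
move=> [sf fk] [sg gl]; split.
  rewrite (leq_trans (size_polyMleq _ _)) //.
  by move: sf sg; clear; move: (size f) (size g); lia.
rewrite coefM (bigD1 (inord k)) //= inordK ?ltnS ?leq_addr // addKn fk gl.
rewrite big1 ?addr0 // => i; rewrite -val_eqE /= inordK ?ltnS ?leq_addr // => ik.
have [lt|gt|e'] := ltngtP i k; last by rewrite e' eqxx in ik.
  rewrite [g`__]nth_default ?mulr0 // (leq_trans sg) //; have := ltn_ord i; lia.
by rewrite [f`__]nth_default ?mul0r // (leq_trans sf).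
Qed.

(** The parameter at infinity corresponds to the direction b. For b = (X_i^d), where A_n and the
    resultant take the value 1, both become monic in t. *)
Lemma top_coef_mline k p : p \is k.-homog -> top_coef k (mline a b p) p.@[b].
Proof.
move=> /dhomogP H; rewrite (mpolyE p) !rmorph_sum /= !big_seq.
elim/big_rec2: _ => [|m f c mp [sf fk]]; first by split; rewrite ?size_poly0 ?coef0.
have mk : mdeg m = k := H m mp.
suff [sg gk] : top_coef k (mline a b (p@_m *: 'X_[m])) (p@_m *: 'X_[m]).@[b].
  split; last by rewrite coefD fk gk.
  by rewrite (leq_trans (size_polyD _ _)) // geq_max sf sg.
rewrite -mul_mpolyC !rmorphM /= mevalC mlineC -[k]add0n; apply: top_coefM.
  by split; [exact: size_polyC_leq1|rewrite coefC].
rewrite -mk mpolyXE_id !rmorph_prod mdegE.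
elim/big_rec3: _ => [|i x f' l _ IH]; first by split; rewrite ?size_poly1 ?coefC.
apply: top_coefM IH; rewrite !rmorphXn /= mevalXU mlineXU.
elim: (m i) => [|e IH]; first by rewrite !expr0; split; rewrite ?size_poly1 ?coefC.
rewrite !exprS -add1n; apply: top_coefM IH; split.
  rewrite (leq_trans (size_polyD _ _)) // geq_max (leq_trans (size_polyC_leq1 _)) //=.
  by rewrite (leq_trans (size_scale_leq _ _)) ?size_polyX.
by rewrite coefD coefC coefZ coefX mulr1 add0r.
Qed.

End HomogeneousLine.

(** * Powers of the resultant as divisors, and its degree *)

Lemma meval_homog_scale (A : comNzRingType) n d (f : {mpoly A[n]}) (z : 'I_n -> A) c :
  f \is d.-homog -> f.@[fun i => c * z i] = c ^+ d * f.@[z].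
Proof.
move=> /dhomogP H; rewrite !mevalE big_distrr /= !big_seq; apply: eq_bigr => m mf.
have <- : mdeg m = d := H m mf.
rewrite mulrCA mdegE; congr (_ * _).
rewrite -prodrXr -big_split; apply: eq_bigr => i _; exact: exprMn.
Qed.

Definition mscale (A : comNzRingType) n (w : 'I_n -> A) : {mpoly A[n]} -> {mpoly A[n]} :=
  mmap (@mpolyC n A) (fun k => w k *: 'X_k).
HB.instance Definition _ (A : comNzRingType) n (w : 'I_n -> A) :=
  GRing.RMorphism.on (mscale w).

Lemma meval_mscale (A : comNzRingType) n (w a : 'I_n -> A) p :
  (mscale w p).@[a] = p.@[fun k => w k * a k].
Proof.
apply: (@rmorph_mpoly_eq _ _ _ (meval a \o mscale w) (meval _)) => [c|i] /=.
  by rewrite /mscale mmapC !mevalC.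
by rewrite /mscale mmapX mmap1U mevalZ !mevalXU.
Qed.

Lemma mcoeff_mscale (A : comNzRingType) n (w : 'I_n -> A) p m :
  (mscale w p)@_m = (\prod_k w k ^+ m k) * p@_m.
Proof.
have XE k : mscale w 'X_[k] = (\prod_i w i ^+ k i) *: 'X_[k].
  rewrite mpolyXE_id rmorph_prod -mul_mpolyC rmorph_prod -big_split.
  apply: eq_bigr => i _; rewrite rmorphXn /= /mscale mmapX mmap1U.
  by rewrite -mul_mpolyC exprMn rmorphXn.
elim/mpolyind: p => [|c k p _ _ IH]; first by rewrite rmorph0 mcoeff0 mulr0.
rewrite rmorphD !mcoeffD IH mulrDr; congr (_ + _).
rewrite -mul_mpolyC rmorphM /= XE /mscale mmapC !mcoeffCM mcoeffZ mcoeffX.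
by case: eqP => [->|]; rewrite ?mulr0 // !mulr1 mulrC.
Qed.

Lemma size_prod_le (K : idomainType) (I : Type) (r : seq I) (e : I -> nat)
  (f : I -> {poly K}) :
  (forall i, (size (f i) <= (e i).+1)%N) ->
  (size (\prod_(i <- r) f i)%R <= (\sum_(i <- r) e i).+1)%N.
Proof.
move=> H; elim: r => [|i r IH]; first by rewrite !big_nil size_poly1.
rewrite !big_cons (leq_trans (size_polyMleq _ _)) //; move: IH (H i).
by clear; move: (size _) (size _); lia.
Qed.

Lemma exists_unity_roots (K : numClosedFieldType) d : (0 < d)%N ->
  exists2 r : 'I_d -> K, injective r & forall k, r k ^+ d = 1.
Proof.
move=> d_gt0; have [s es] := closed_field_poly_normal ('X^d - 1 : {poly K}).
have mon : lead_coef ('X^d - 1 : {poly K}) = 1.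
  by apply/eqP; rewrite -monicE monicXnsubC.
rewrite mon scale1r in es.
have ss : size s = d.
  by have := congr1 (fun p : {poly K} => size p) es; rewrite /= size_prod_XsubC size_XnsubC // => -[].
have us : uniq s.
  rewrite -separable_prod_XsubC -es separable_Xn_sub_1 //.
  by rewrite pnatr_eq0 -lt0n.
exists (fun k => nth 0 s k) => [i j /eqP|k].
  by rewrite nth_uniq ?ss // => /eqP; exact: val_inj.
have : root ('X^d - 1) (nth 0 s k) by rewrite es root_prod_XsubC mem_nth // ss.
by rewrite /root !hornerE subr_eq0 => /eqP.
Qed.

Section Resultant.
Variables (K : numClosedFieldType) (N d : nat).
Hypotheses (N_gt0 : (0 < N)%N) (d_gt0 : (0 < d)%N).
Local Notation ci := (coef_index N d).
Variable P : {mpoly K[#|ci|]}.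
Implicit Types (a b w : 'I_#|ci| -> K).

Definition common_zero (H : 'I_N -> {mpoly K[N]}) : Prop :=
  exists z, (exists i, z i != 0) /\ forall i, (H i).@[z] = 0.

Definition coefs_Xn : 'I_#|ci| -> K := coefs_of (fun i => 'X_i ^+ d).

Hypothesis P_prime : prime_elt P.
Hypothesis P_zero : forall a, P.@[a] = 0 <-> common_zero (tuple_of a).
Hypothesis P_Xn : P.@[coefs_Xn] = 1.

Lemma homog_Xn (i : 'I_N) : ('X_i ^+ d : {mpoly K[N]}) \is d.-homog.
Proof.
have : ('X_i : {mpoly K[N]}) \is 1.-homog by rewrite dhomogX /= mdeg1.
by move/(dhomogMn d); rewrite mul1n.
Qed.

(** On a line through a point a of the hypersurface, the tuple has a common zero modulo t; dividing
    it by a nonzero coordinate gives the point p of the shear, and x is the parameter t. *)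
Lemma resultant_power_rdvd n : rdvd (P ^+ resultant_order N d n) (generic_det N d K n).
Proof.
apply: rdvd_power_vanishing_order => // a b /P_zero [z [[i0 zi0] Hz]].
apply: rdvd_exp (resultant_order_le i0 d_gt0 n) _; rewrite mline_generic_det.
pose p i := (z i0)^-1 * z i.
apply: (@rdvd_adapted_det _ _ _ i0 'X d_gt0 _ (fun i => (p i)%:P)).
- by move=> i; exact: tuple_of_homog.
- by rewrite /p mulVf.
move=> i; have : rdvd 'X^1 (tuple_of (fun k => (a k)%:P + b k *: 'X) i).@[fun i => (p i)%:P].
  apply/rdvdXn_coef => -[|//] _; rewrite -horner_coef0.
  pose ev := horner_eval (0 : K).
  rewrite -[LHS]/(ev _) /meval.
  have -> f : ev (mmap idfun (fun i => (p i)%:P) f) = (map_mpoly ev f).@[p].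
    apply: (@rmorph_mpoly_eq _ _ _ (ev \o mmap idfun (fun i => (p i)%:P))
      (meval p \o map_mpoly ev)) => [c|j] /=.
      by rewrite mmapC map_mpolyC mevalC.
    by rewrite mmapX mmap1U map_mpolyX mevalXU /ev /horner_eval hornerC.
  rewrite map_tuple_of (_ : ev \o _ = a).
    by rewrite /p (meval_homog_scale _ _ (tuple_of_homog a i)) Hz mulr0.
  apply: funext => k; rewrite /= /ev /horner_eval hornerD hornerC hornerZ hornerX.
  by rewrite mulr0 addr0.
by rewrite expr1.
Qed.

Definition block_deg (i : 'I_N) (m : 'X_{1..#|ci|}) : nat :=
  (\sum_(k | (enum_val k).1 == i) m k)%N.

Lemma common_zero_scale (c : 'I_N -> K) a : (forall i, c i != 0) ->
  common_zero (tuple_of a) -> common_zero (tuple_of (fun k => c (enum_val k).1 * a k)).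
Proof.
move=> c0 [z [z0 Hz]]; exists z; split=> // i.
rewrite (_ : tuple_of _ i = c i *: tuple_of a i) ?mevalZ ?Hz ?mulr0 //.
rewrite scaler_sumr; apply: eq_bigr => m _; by rewrite enum_rankK scalerA.
Qed.

(** Doubling the i-th member of the tuple preserves the hypersurface, so P divides its rescaled
    version. The degree does not grow, hence the quotient is a constant u, and u is 2 to the block
    degree of every monomial of P. *)
Lemma block_homog : exists delta, forall m i, m \in msupp P -> block_deg i m = delta i.
Proof.
suff H i m : m \in msupp P -> block_deg i m = block_deg i (mlead P).
  by exists (fun i => block_deg i (mlead P)) => m i; exact: H.
have [P0 _ _] := P_prime.
pose c (j : 'I_N) : K := if j == i then 2 else 1.
have c0 j : c j != 0 by rewrite /c; case: (j == i); rewrite ?oner_eq0 ?pnatr_eq0.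
pose w (k : 'I_#|ci|) := c (enum_val k).1.
have prodw (k : 'X_{1..#|ci|}) : \prod_j w j ^+ k j = 2 ^+ block_deg i k.
  rewrite /block_deg -prodrXr /= [RHS]big_mkcond; apply: eq_bigr => j _.
  by rewrite /w /c; case: eqP; rewrite ?expr1n.
have [z ez] : rdvd P (mscale w P).
  apply: rdvd_nullstellensatz => // a /P_zero az; rewrite meval_mscale.
  by apply/P_zero/common_zero_scale.
have wP0 : mscale w P != 0.
  apply/eqP => /mpolyP /(_ (mlead P)) /eqP.
  by rewrite mcoeff_mscale prodw mcoeff0 mulf_eq0 expf_eq0 pnatr_eq0 andbF /= mleadc_eq0 (negbTE P0).
have z0 : z != 0 by apply: contraNneq wP0 => z0; rewrite ez z0 mul0r.
have sz : (msize (mscale w P) <= msize P)%N.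
  have PD : deg_le (mdeg (mlead P)) P by apply/deg_leP; rewrite mlead_deg.
  rewrite -(mlead_deg P0); apply/deg_leP => k lt.
  by rewrite mcoeff_mscale PD ?mulr0.
have [u ezu] : exists u, z = u%:MP.
  exists z@_0%MM; apply: msize1_polyC; move: sz; rewrite ez msizeM //.
  move: P0; rewrite -msize_poly_eq0 -lt0n; move: (msize P) (msize z); lia.
have uE k : k \in msupp P -> 2 ^+ block_deg i k = u.
  rewrite mcoeff_msupp => k0; apply: (mulIf k0).
  by rewrite -prodw -mcoeff_mscale ez ezu mcoeffCM.
move=> mP; have := uE _ mP; rewrite -(uE _ (mlead_supp P0)) -!natrX => /eqP.
by rewrite eqr_nat eqn_exp2l // => /eqP.
Qed.

Lemma size_mline_block i D a b : (forall m, m \in msupp P -> block_deg i m = D) ->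
  (forall k, (enum_val k).1 != i -> b k = 0) -> (size (mline a b P) <= D.+1)%N.
Proof.
move=> H b0; rewrite (mpolyE P) rmorph_sum big_seq.
apply: (leq_trans (size_sum _ _ _)); apply/bigmax_leqP_seq => m _ mP.
rewrite -mul_mpolyC rmorphM /= mlineC mul_polyC (leq_trans (size_scale_leq _ _)) //.
rewrite -(H m mP) /block_deg big_mkcond mpolyXE_id rmorph_prod /=.
apply: size_prod_le => k; rewrite rmorphXn /= mlineXU.
case: eqP => [ki|/eqP/b0 ->]; last by rewrite scale0r addr0 -rmorphXn size_polyC_leq1.
rewrite (leq_trans (size_poly_exp_leq _ _)) // ltnS.
rewrite -[leqRHS]mul1n leq_mul2r; apply/orP; right.
have : (size ((a k)%:P + b k *: 'X)%R <= 2)%N; last by case: (size _) => [|[|]].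
rewrite (leq_trans (size_polyD _ _)) // geq_max (leq_trans (size_polyC_leq1 _)) //=.
by rewrite (leq_trans (size_scale_leq _ _)) ?size_polyX.
Qed.

End Resultant.

Section ResultantDegree.
Variables (K : numClosedFieldType) (N d : nat).
Hypotheses (N_gt0 : (0 < N)%N) (d_gt0 : (0 < d)%N).
Local Notation ci := (coef_index N d).
Variable P : {mpoly K[#|ci|]}.
Implicit Types (a b : 'I_#|ci| -> K).
Hypothesis P_prime : prime_elt P.
Hypothesis P_zero : forall a, P.@[a] = 0 <-> common_zero (tuple_of a).
Hypothesis P_Xn : P.@[@coefs_Xn K N d] = 1.

Lemma poly_nonroot (p : {poly K}) : p != 0 -> exists x, p.[x] != 0.
Proof.
move=> p0; have [r er] := closed_field_poly_normal p.
have [x _ xr] := closed_field_infinite r; exists x.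
rewrite er hornerZ mulf_neq0 ?lead_coef_eq0 //.
by rewrite -[_ == 0]/(root _ _) root_prod_XsubC.
Qed.

Lemma tuple_of_line a b t i :
  tuple_of (fun k => a k + t * b k) i = tuple_of a i + t *: tuple_of b i.
Proof.
rewrite scaler_sumr -big_split; apply: eq_bigr => m _.
by rewrite scalerDl scalerA.
Qed.

(* On the line X_i^d - t G, X_j^d - X_i^d (j <> i) the resultant vanishes at
   1 / G(p) for each of the d^(N-1) points p whose coordinates are d-th roots of
   unity with p_i = 1, and G can be chosen to separate these points. *)
Lemma block_deg_ge i D :
  (forall m, m \in msupp P -> block_deg i m = D) -> (d ^ N.-1 <= D)%N.
Proof.
move=> HD; have [r r_inj r1] := exists_unity_roots K d_gt0.
pose k0 := Ordinal d_gt0.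
pose p (f : {ffun 'I_N -> 'I_d}) (j : 'I_N) : K := if j == i then 1 else r (f j).
have pd f j : p f j ^+ d = 1 by rewrite /p; case: eqP => _; rewrite ?expr1n.
have pi f : p f i = 1 by rewrite /p eqxx.
(* Fixing f at i to the default [k0] leaves d^(N-1) functions, one for each point. *)
pose Fs := [pred f : {ffun 'I_N -> 'I_d} | f \in pffun_on k0 (predC1 i) predT].
have cF : #|Fs| = (d ^ N.-1)%N.
  by rewrite card_pffun_on card_ord cardC1 card_ord.
pose g f : {poly K} := \sum_(j < N) p f j *: 'X^j.
have gc f (j : 'I_N) : (g f)`_j = p f j.
  rewrite coef_sum (bigD1 j) //= coefZ coefXn eqxx mulr1 big1 ?addr0 // => l lj.
  by rewrite coefZ coefXn eq_sym val_eqE (negbTE lj) mulr0.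
have g0 f : g f != 0.
  by apply/eqP => e; have := gc f i; rewrite e coef0 pi => /eqP; rewrite eq_sym oner_eq0.
have g_inj : {in Fs &, injective g}.
  move=> f f' /pffun_onP [/fintype.subsetP sf _] /pffun_onP [/fintype.subsetP sf' _] e.
  apply/ffunP => j; have [->|ji] := eqVneq j i.
    have z h : {subset k0.-support h <= predC1 i} -> h i = k0.
      by move=> sh; apply/eqP; apply: contraT => hi; have := sh i hi; rewrite inE /= eqxx.
    by rewrite (z f sf) (z f' sf').
  by apply: r_inj; have := gc f j; rewrite e gc /p (negbTE ji).
(* Where Z does not vanish, the values of the g f are nonzero, and distinct g f have distinct
   values. *)
pose Z : {poly K} := (\prod_f g f) * \prod_f \prod_(f' | g f != g f') (g f - g f').
have [|y Zy] := @poly_nonroot Z.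
  rewrite mulf_neq0 //; first by apply/prodf_neq0.
  apply/prodf_neq0 => f _; apply/prodf_neq0 => f' ff'.
  by rewrite subr_eq0.
move: Zy; rewrite hornerM mulf_eq0 => /norP [y0 y1].
have gy0 f : (g f).[y] != 0.
  by apply: contraNneq y0 => e; rewrite horner_prod (bigD1 f) //= e mul0r.
have gy_inj : {in Fs &, injective (fun f => (g f).[y])}.
  move=> f f' fF fF' e; apply: g_inj => //; apply/eqP; apply: contraNT y1 => ff'.
  rewrite horner_prod (bigD1 f) //= horner_prod (bigD1 f') //=.
  by rewrite hornerD hornerN e subrr !mul0r.
pose G : {mpoly K[N]} := \sum_(j < N) y ^+ j *: ('X_i ^+ d.-1 * 'X_j).
have XnH (j : 'I_N) e : ('X_j ^+ e : {mpoly K[N]}) \is e.-homog.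
  have : ('X_j : {mpoly K[N]}) \is 1.-homog by rewrite dhomogX /= mdeg1.
  by move/(dhomogMn e); rewrite mul1n.
have GH : G \is d.-homog.
  apply: rpred_sum => j _; apply: dhomogZ; rewrite -[in X in X.-homog](prednK d_gt0) -addn1.
  by apply: dhomogM; rewrite ?dhomogX /= ?mdeg1.
have Gp f : G.@[p f] = (g f).[y].
  rewrite rmorph_sum horner_sum; apply: eq_bigr => j _ /=.
  by rewrite mevalZ mevalM !rmorphXn /= !mevalXU pi expr1n mul1r hornerZ hornerXn mulrC.
pose H (j : 'I_N) : {mpoly K[N]} := if j == i then 'X_i ^+ d else 'X_j ^+ d - 'X_i ^+ d.
pose B (j : 'I_N) : {mpoly K[N]} := if j == i then - G else 0.
have HH j : H j \is d.-homog by rewrite /H; case: eqP => _; rewrite ?rpredB ?XnH.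
have BH j : B j \is d.-homog by rewrite /B; case: eqP => _; rewrite ?rpredN ?rpred0.
pose a : 'I_#|ci| -> K := coefs_of H; pose b : 'I_#|ci| -> K := coefs_of B.
have ta : tuple_of a = H by exact: tuple_of_coefs.
have tb : tuple_of b = B by exact: tuple_of_coefs.
have sz : (size (mline a b P) <= D.+1)%N.
  apply: (size_mline_block a HD) => k ki.
  by rewrite /b /coefs_of /B (negbTE ki) mcoeff0.
have r0 : mline a b P != 0.
  apply/eqP => e; have := horner_mline0 a b P; rewrite e horner0 => /esym/P_zero.
  rewrite ta => -[z [[j zj] Hz]].
  have zi : z i = 0.
    have := Hz i; rewrite /H eqxx rmorphXn /= mevalXU => /eqP.
    by rewrite expf_eq0 d_gt0 => /eqP.
  move: zj; have := Hz j; rewrite /H; case: eqP => [->|_]; first by rewrite zi eqxx.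
  rewrite mevalB !rmorphXn /= !mevalXU zi expr0n gtn_eqF // subr0 => /eqP.
  by rewrite expf_eq0 d_gt0 => /eqP ->; rewrite eqxx.
pose rs := [seq ((g f).[y])^-1 | f <- enum Fs].
rewrite -cF cardE -(size_map (fun f => ((g f).[y])^-1)) -ltnS.
apply: leq_trans sz; apply: max_poly_roots => //.
  apply/allP => _ /mapP [f _ ->]; rewrite /root horner_mline; apply/eqP/P_zero.
  exists (p f); split; first by exists i; rewrite pi oner_eq0.
  move=> j; rewrite tuple_of_line ta tb mevalD mevalZ /H /B.
  case: eqP => _; last by rewrite meval0 mulr0 addr0 mevalB !rmorphXn /= !mevalXU !pd subrr.
  by rewrite mevalN Gp rmorphXn /= mevalXU pd mulrN mulVf ?subrr.
rewrite map_inj_in_uniq ?enum_uniq // => f f'; rewrite !mem_enum => fF fF' /invr_inj.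
exact: gy_inj.
Qed.

(** The lower bound is what leaves only o(D(n)) for the degree of the quotient of A_n by Res^E_n. *)
Lemma resultant_degree : exists2 delta, P \is delta.-homog & (N * d ^ N.-1 <= delta)%N.
Proof.
have [delta Hdelta] := block_homog N_gt0 d_gt0 P_prime P_zero.
exists (\sum_i delta i)%N; last first.
  rewrite -[N in (N * _)%N]card_ord -sum_nat_const; apply: leq_sum => i _.
  by apply: block_deg_ge => m mP; exact: Hdelta.
apply/dhomogP => m mP; rewrite /= mdegE.
rewrite (partition_big (fun k : 'I_#|ci| => (enum_val k).1) xpredT) //=.
by apply: eq_bigr => i _; rewrite -(Hdelta m i mP).
Qed.

(** Along a + t (X_i^d) the quotient is monic, so its value at t = 0 is the product of -z over its
    roots z. By [adapted_det_neq0] a root of any A_n is a root of some A_j with j <= N d; these form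
    one finite list, from which the hypothesis excludes 0. *)
Lemma adapted_det_factor a :
  (forall j, (j <= N * d)%N -> adapted_det d (tuple_of a) j != 0) ->
  exists2 s : seq K, 0 \notin s & forall n, exists rt : seq K,
    [/\ {subset rt <= s},
        (size rt + N * d ^ N.-1 * resultant_order N d n <= det_degree N d n)%N &
        adapted_det d (tuple_of a) n =
          P.@[a] ^+ resultant_order N d n * \prod_(z <- rt) (- z)].
Proof.
move=> a_ok; have [delta Pdelta delta_ge] := resultant_degree.
pose b : 'I_#|ci| -> K := @coefs_Xn K N d.
pose q n := mline a b (generic_det N d K n).
have tb : tuple_of b = fun i => 'X_i ^+ d by apply: tuple_of_coefs => i; exact: homog_Xn.
have qtop n : top_coef (det_degree N d n) (q n) 1.
  have := top_coef_mline a b (generic_det_homog N d K n).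
  by rewrite meval_generic_det tb adapted_det_Xn.
have rtop : top_coef delta (mline a b P) 1.
  by have := top_coef_mline a b Pdelta; rewrite P_Xn.
have top_monic k (f : {poly K}) : top_coef k f 1 -> (f \is monic) * (size f = k.+1).
  move=> [sf fk]; have sE : size f = k.+1.
    apply/eqP; rewrite eqn_leq sf ltnNge; apply/negP => /leq_sizeP /(_ k (leqnn k)) /eqP.
    by rewrite fk oner_eq0.
  by split=> //; rewrite monicE lead_coefE sE fk.
have q0 n t : (q n).[t] = adapted_det d (tuple_of (fun k => a k + t * b k)) n.
  by rewrite /q horner_mline meval_generic_det.
have a0 : (fun k => a k + 0 * b k) = a by apply: funext => k; rewrite mul0r addr0.
have [s es] := closed_field_poly_normal (\prod_(j < (N * d).+1) q j).
have smem t : (t \in s) = (root (\prod_(j < (N * d).+1) q j) t).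
  have pm : \prod_(j < (N * d).+1) q j \is monic.
    by apply: monic_prod => j _; have [] := top_monic _ _ (qtop j).
  by rewrite es (monicP pm) scale1r root_prod_XsubC.
have root_prod t : root (\prod_(j < (N * d).+1) q j) t = [exists j : 'I_(N * d).+1, root (q j) t].
  rewrite /root horner_prod; apply/idP/existsP => [|[j /eqP qj]].
    by rewrite prodf_seq_eq0 => /hasP [j _ /= qj]; exists j.
  by rewrite (bigD1 j) //= qj mul0r.
exists s.
  rewrite smem root_prod negb_exists; apply/forallP => j.
  by rewrite /root q0 a0 a_ok // -ltnS.
move=> n; have [x ex] := resultant_power_rdvd d_gt0 P_prime P_zero n.
have eq : q n = mline a b x * mline a b P ^+ resultant_order N d n.
  by rewrite /q ex rmorphM rmorphXn.
have [qm qs] := top_monic _ _ (qtop n); have [rm rs] := top_monic _ _ rtop.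
have rEm : mline a b P ^+ resultant_order N d n \is monic by rewrite monic_exp.
have xm : mline a b x \is monic.
  by move: qm; rewrite eq monicMr.
have [rt ert] := closed_field_poly_normal (mline a b x).
rewrite (monicP xm) scale1r in ert; exists rt; split.
- move=> t trt; rewrite smem root_prod.
  have : root (q n) t.
    by rewrite /root eq hornerM ert -/(root _ _); move: trt; rewrite -root_prod_XsubC => /eqP ->; rewrite mul0r.
  rewrite /root q0; apply: contraLR; rewrite negb_exists => /forallP h.
  apply: adapted_det_neq0 => // [i|j jNd]; first exact/homog_deg_le/tuple_of_homog.
  have jb : (j < (N * d).+1)%N by [].
  by have := h (Ordinal jb); rewrite /root q0.
- have : size (q n) = (size rt + delta * resultant_order N d n).+1.
    rewrite eq size_monicM // ?monic_neq0 // ert size_prod_XsubC.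
    have -> : size (mline a b P ^+ resultant_order N d n) = (delta * resultant_order N d n).+1.
      by have := size_exp (mline a b P) (resultant_order N d n); rewrite rs /= => <-;
        rewrite prednK // size_poly_gt0 monic_neq0.
    by rewrite addSn addnS.
  by rewrite qs => -[->]; rewrite leq_add2l leq_mul2r delta_ge orbT.
- have := q0 n 0; rewrite a0 => <-; rewrite eq hornerM horner_exp (horner_mline0 a b P) mulrC ert.
  congr (_ * _); rewrite horner_prod; apply: eq_bigr => z _.
  by rewrite hornerXsubC sub0r.
Qed.

End ResultantDegree.

(** * Traces over the fibres of a polynomial map *)

Section FreeModule.
Variables (K : numClosedFieldType) (N d : nat).
Hypotheses (N_gt0 : (0 < N)%N) (d_gt0 : (0 < d)%N).
Variable F : 'I_N -> {mpoly K[N]}.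
Hypothesis F_deg : forall i, deg_le d (F i).
Hypothesis F_det : forall n, adapted_det d F n != 0.
Implicit Types (p g : {mpoly K[N]}) (m : 'X_{1..N}).

Local Notation rem := {ffun 'I_N -> 'I_d}.
Local Notation D := #|{: rem}|.
Local Notation W := {mpoly K[N]}.

Definition rem_mnm (k : 'I_D) : 'X_{1..N} := [multinom (enum_val k i : nat) | i < N].

Definition rem_index m : 'I_D :=
  enum_rank ([ffun i => Ordinal (ltn_pmod (m i) d_gt0)] : rem).

Lemma rem_indexK m : rem_mnm (rem_index m) = mnm_mod d m.
Proof. by apply/mnmP => i; rewrite !mnmE enum_rankK ffunE. Qed.

Definition join (k : 'I_D) m : 'X_{1..N} := (m *+ d + rem_mnm k)%MM.

Lemma join_div k m : mnm_div d (join k m) = m.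
Proof.
apply/mnmP => i; rewrite !mnmE mulmnE divnMDl // divn_small ?addn0 //.
Qed.

Lemma join_mod k m : mnm_mod d (join k m) = rem_mnm k.
Proof.
by apply/mnmP => i; rewrite !mnmE mulmnE modnMDl modn_small.
Qed.

Lemma rem_mnm_inj : injective rem_mnm.
Proof.
move=> k l /mnmP e; apply: enum_val_inj; apply/ffunP => i; apply: val_inj.
by have := e i; rewrite !mnmE.
Qed.

Lemma join_index k m : rem_index (join k m) = k.
Proof. by apply: rem_mnm_inj; rewrite rem_indexK join_mod. Qed.

Lemma joinK m : join (rem_index m) (mnm_div d m) = m.
Proof. by rewrite /join rem_indexK -mnm_divmod. Qed.

Definition substF : W -> {mpoly K[N]} := mmap (@mpolyC N K) F.
HB.instance Definition _ := GRing.RMorphism.on substF.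

Lemma substFC c : substF c%:MP = c%:MP.
Proof. by rewrite /substF mmapC. Qed.

Lemma substFX m : substF 'X_[m] = \prod_i F i ^+ m i.
Proof. by rewrite /substF mmapX. Qed.

(** The polynomial ring is free over the ring [W] of the base, whose variables act as the F_i, with
    basis the X^r. [rep] is the isomorphism from coordinate vectors; it is bijective because the B_g
    with |g| <= n are a basis of the polynomials of degree at most n. *)
Definition rep (q : 'rV[W]_D) : {mpoly K[N]} := \sum_k substF (q 0 k) * 'X_[rem_mnm k].

Lemma repD q r : rep (q + r) = rep q + rep r.
Proof.
by rewrite -big_split; apply: eq_bigr => k _; rewrite mxE rmorphD mulrDl.
Qed.

Lemma repZ c q : rep (c *: q) = substF c * rep q.
Proof.
by rewrite mulr_sumr; apply: eq_bigr => k _; rewrite mxE rmorphM mulrA.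
Qed.

Lemma rep_delta k : rep (delta_mx 0 k) = 'X_[rem_mnm k].
Proof.
rewrite /rep (bigD1 k) //= mxE !eqxx rmorph1 mul1r big1 ?addr0 // => l /negbTE lk.
by rewrite mxE lk rmorph0 mul0r.
Qed.

Lemma rep_sum (I : Type) (r : seq I) (q : I -> 'rV[W]_D) :
  rep (\sum_(i <- r) q i) = \sum_(i <- r) rep (q i).
Proof.
elim: r => [|i r IH]; last by rewrite !big_cons repD IH.
by rewrite !big_nil /rep big1 // => k _; rewrite mxE rmorph0 mul0r.
Qed.

Lemma rep_join k m : rep ('X_[m] *: delta_mx 0 k) = adapted d F (join k m).
Proof. by rewrite repZ rep_delta substFX /adapted join_mod join_div mulrC. Qed.

Lemma rep_surj p : exists q, rep q = p.
Proof.
have /deg_leP pn : (msize p <= (msize p).+1)%N by [].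
have [c ->] : in_span d F (msize p) p.
  apply: in_span_monomials => // m mp.
  exact: (adapted_det_in_span F_deg (F_det _)).
exists (\sum_i (c i)%:MP *: ('X_[mnm_div d (nthm _ i)] *: delta_mx 0 (rem_index (nthm _ i)))).
rewrite rep_sum; apply: eq_bigr => i _.
by rewrite repZ rep_join joinK substFC mul_mpolyC.
Qed.

(** The coefficient of B_m: the remainder of m selects the basis vector, the quotient the monomial
    of the base. *)
Definition coord (q : 'rV[W]_D) m : K := (q 0 (rem_index m))@_(mnm_div d m).

Lemma coord_join k m k' m' :
  coord ('X_[m] *: delta_mx 0 k) (join k' m') = (join k m == join k' m')%:R.
Proof.
rewrite /coord join_index join_div !mxE eqxx /= mulr_natr mcoeffMn mcoeffX.
have -> : (join k m == join k' m') = (k == k') && (m == m').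
  apply/eqP/andP => [e|[/eqP -> /eqP ->] //].
  have -> : k = k' by rewrite -(join_index k m) e join_index.
  have -> : m = m' by rewrite -(join_div k m) e join_div.
  by rewrite !eqxx.
by rewrite (eq_sym k'); case: (k == k'); rewrite ?mulr1n // mulr0n.
Qed.

Lemma rep_coord q : exists n0, forall n, (n0 <= n)%N ->
  rep q = \sum_i coord q (nthm n i) *: adapted d F (nthm n i).
Proof.
pose good q := exists n0, forall n, (n0 <= n)%N ->
  rep q = \sum_i coord q (nthm n i) *: adapted d F (nthm n i).
have good0 : good 0.
  exists 0%N => n _; rewrite /rep !big1 // => k _; last by rewrite mxE rmorph0 mul0r.
  by rewrite /coord mxE mcoeff0 scale0r.
have goodD x y : good x -> good y -> good (x + y).
  move=> [a Ha] [b Hb]; exists (maxn a b) => n; rewrite geq_max => /andP [an bn].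
  rewrite repD (Ha n an) (Hb n bn) -big_split; apply: eq_bigr => i _.
  by rewrite /= /coord [(x + y) 0 _]mxE mcoeffD scalerDl.
rewrite -/(good q) (row_sum_delta q).
elim/big_rec: _ => // k x _ gx; apply: (goodD _ _ _ gx).
elim/mpolyind: (q 0 k) => [|c m f _ _ IH]; first by rewrite scale0r.
rewrite scalerDl; apply: (goodD) => //; exists (mdeg (join k m)) => n le.
have [i ei] := nthm_surj le.
rewrite -mul_mpolyC -scalerA repZ rep_join substFC mul_mpolyC.
rewrite (bigD1 i) //= big1 ?addr0 => [|j ji].
  congr (_ *: _); last by rewrite ei.
  by rewrite ei /coord mxE mcoeffCM -/(coord _ _) coord_join eqxx mulr1.
rewrite -(joinK (nthm n j)) /coord mxE mcoeffCM -/(coord _ _) coord_join.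
rewrite joinK -ei (inj_eq (@nthm_inj _ n)) eq_sym (negbTE ji) mulr0 scale0r //.
Qed.

Lemma rep_inj q r : rep q = rep r -> q = r.
Proof.
suff inj0 x : rep x = 0 -> x = 0.
  move=> e; apply/eqP; rewrite -subr_eq0; apply/eqP/inj0.
  by rewrite -scaleN1r repD repZ rmorphN rmorph1 mulN1r e subrr.
move=> x0; have [n0 Hn0] := rep_coord x.
suff cz m : coord x m = 0.
  apply/rowP => k; rewrite mxE; apply/mpolyP => m; rewrite mcoeff0.
  by have := cz (join k m); rewrite /coord join_index join_div.
have [|i ei] := @nthm_surj N (maxn n0 (mdeg m)) m; first exact: leq_maxr.
have := Hn0 _ (leq_maxl n0 (mdeg m)); rewrite x0.
set n := maxn _ _ in i ei * => e.
have : (\row_j coord x (nthm n j)) *m adapted_mx d F n = 0.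
  apply/rowP => j; have := congr1 (fun p => p@_(nthm n j)) e.
  rewrite /= mcoeff0 raddf_sum !mxE => e2; rewrite [RHS]e2.
  by apply: eq_bigr => k _; rewrite !mxE /= mcoeffZ.
move=> /(congr1 (fun B => B *m invmx (adapted_mx d F n))).
rewrite mul0mx mulmxK ?unitmxE ?unitfE //; last exact: F_det.
by move/rowP/(_ i); rewrite !mxE ei.
Qed.

Definition nf p : 'rV[W]_D := projT1 (cid (rep_surj p)).

Lemma nfK p : rep (nf p) = p.
Proof. exact: (projT2 (cid (rep_surj p))). Qed.

Definition mulM g : 'M[W]_D := \matrix_(k, l) nf ('X_[rem_mnm k] * g) 0 l.

Lemma row_mulM k g : row k (mulM g) = nf ('X_[rem_mnm k] * g).
Proof. by apply/rowP => l; rewrite !mxE. Qed.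

Lemma rep_mulM q g : rep (q *m mulM g) = rep q * g.
Proof.
rewrite mulmx_sum_row rep_sum /rep mulr_suml; apply: eq_bigr => k _.
by rewrite -/(rep _) repZ row_mulM nfK mulrA.
Qed.

Lemma mulM_eq g h : (forall q, rep (q *m mulM g) = rep (q *m h)) -> mulM g = h.
Proof.
move=> H; apply/row_matrixP => k; rewrite 2!rowE; apply: rep_inj; exact: H.
Qed.

Lemma mulM_mul g h : mulM (g * h) = mulM g *m mulM h.
Proof. by apply: mulM_eq => q; rewrite mulmxA !rep_mulM mulrA. Qed.

Lemma mulM_add g h : mulM (g + h) = mulM g + mulM h.
Proof. by apply: mulM_eq => q; rewrite mulmxDr repD !rep_mulM mulrDr. Qed.

Lemma mulM_subst c : mulM (substF c) = c%:M.
Proof. by apply: mulM_eq => q; rewrite rep_mulM mul_mx_scalar repZ mulrC. Qed.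

Lemma mulM_C c : mulM c%:MP = (c%:MP)%:M.
Proof. by rewrite -mulM_subst substFC. Qed.

Lemma mulM_Z c g : mulM (c *: g) = c%:MP *: mulM g.
Proof. by rewrite -mul_mpolyC mulM_mul mulM_C mul_scalar_mx. Qed.

Lemma mulM_substM c g : mulM (substF c * g) = c *: mulM g.
Proof. by rewrite mulM_mul mulM_subst mul_scalar_mx. Qed.

Lemma mulM_F i : mulM (F i) = ('X_i)%:M.
Proof. by rewrite -mulM_subst /substF mmapX mmap1U. Qed.

Lemma mulM_comm g h : mulM g *m mulM h = mulM h *m mulM g.
Proof. by rewrite -!mulM_mul mulrC. Qed.

Lemma mulM_sum (I : Type) (r : seq I) (f : I -> {mpoly K[N]}) :
  mulM (\sum_(i <- r) f i) = \sum_(i <- r) mulM (f i).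
Proof.
elim: r => [|i r IH]; last by rewrite !big_cons mulM_add IH.
by rewrite !big_nil -(mpolyC0 N K) mulM_C mpolyC0 raddf0.
Qed.

Definition evM (w : 'I_N -> K) g : 'M[K]_D := map_mx (meval w) (mulM g).
Definition ftrace (w : 'I_N -> K) g : K := \tr (evM w g).

Lemma ftrace_mulM w g : ftrace w g = (\tr (mulM g)).@[w].
Proof. by rewrite /ftrace /evM /mxtrace rmorph_sum; apply: eq_bigr => k _; rewrite mxE. Qed.

(* The trace is the sum of the values over the fibre, counted with
   multiplicity: the points of the fibre are read off the diagonals of the
   commuting multiplication matrices once these are made triangular. *)
Lemma ftrace_bound w g (B : K) :
  (forall z, (forall i, (F i).@[z] = w i) -> `|g.@[z]| <= B) ->
  `|ftrace w g| <= B *+ D.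
Proof.
move=> HB; pose As := [seq evM w 'X_i | i <- enum 'I_N].
have [|P PU /allP PT] := @cotrigonalization K _ As.
  move=> _ _ /mapP [i _ ->] /mapP [j _ ->].
  by rewrite /comm_mx /evM -!map_mxM mulM_comm.
have {}PU : P \in unitmx by exact: unitarymx_unit.
pose c h := P *m evM w h *m invmx P.
have cM h h' : c (h * h') = c h *m c h'.
  by rewrite /c /evM mulM_mul map_mxM !mulmxA mulmxKV.
have cD h h' : c (h + h') = c h + c h'.
  by rewrite /c /evM mulM_add map_mxD mulmxDr mulmxDl.
have cC a : c a%:MP = a%:M.
  by rewrite /c /evM mulM_C map_scalar_mx /= mevalC mul_mx_scalar -scalemxAl mulmxV // scalemx1.
have cX i : is_trig_mx (c 'X_i).
  have /PT /= : evM w 'X_i \in As by apply: map_f; rewrite mem_enum.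
  by rewrite /similar_to conjumx.
pose x k i := c 'X_i k k.
(* The conjugated matrix of h is lower triangular with diagonal entries h(x_k). This holds for the
   coordinates and passes to sums and products. *)
pose good h := forall k l : 'I_D, (k <= l)%N -> c h k l = (k == l)%:R * h.@[x k].
have goodM h h' : good h -> good h' -> good (h * h').
  move=> gh gh' k l kl; rewrite cM mxE (bigD1 k) //= gh // eqxx mul1r gh' // mevalM.
  rewrite big1 ?addr0 => [|j jk]; first by rewrite mulrCA.
  have [lt|gt|e] := ltngtP k j; last by rewrite -val_eqE /= e eqxx in jk.
    by rewrite gh 1?ltnW // eq_sym (negbTE jk) mul0r mul0r.
  have jl : (j < l)%N by exact: leq_trans kl.
  by rewrite gh' 1?ltnW // -val_eqE /= ltn_eqF // mul0r mulr0.
have goodD h h' : good h -> good h' -> good (h + h').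
  by move=> gh gh' k l kl; rewrite cD mxE gh // gh' // mevalD mulrDr.
have goodC a : good a%:MP.
  by move=> k l _; rewrite cC mxE mevalC mulr_natl.
have goodX i : good 'X_i.
  move=> k l; rewrite leq_eqVlt => /orP [/eqP/val_inj ->|kl].
    by rewrite eqxx mul1r mevalXU.
  by rewrite (is_trig_mxP (cX i)) // -val_eqE /= ltn_eqF // mul0r.
have good_all h : good h.
  elim/mpolyind: h => [|a m f _ _ IH]; first by rewrite -mpolyC0.
  apply: (goodD) => //; rewrite -mul_mpolyC; apply: (goodM) => //; rewrite mpolyXE_id.
  elim/big_rec: _ => [|i f' _ IH']; first by rewrite -mpolyC1.
  apply: (goodM) => //; elim: (m i) => [|e IHe]; first by rewrite expr0 -mpolyC1.
  by rewrite exprS; apply: (goodM).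
(* F_i acts as the scalar w_i, so every x_k lies in the fibre over w. *)
have xfib k i : (F i).@[x k] = w i.
  have := good_all (F i) k k (leqnn _); rewrite eqxx mul1r => <-.
  rewrite /c /evM mulM_F map_scalar_mx /= mevalXU mul_mx_scalar -scalemxAl mulmxV //.
  by rewrite !mxE eqxx mulr1.
have -> : ftrace w g = \sum_k g.@[x k].
  have -> : ftrace w g = \tr (c g) by rewrite /c mxtrace_mulC mulmxA mulVmx ?mul1mx.
  by apply: eq_bigr => k _; rewrite good_all // eqxx mul1r.
rewrite (le_trans (ler_norm_sum _ _ _)) //.
rewrite -[X in _ *+ X]card_ord -sumr_const; apply: ler_sum => k _; exact: HB.
Qed.

Definition trace_form : 'M[W]_D := \matrix_(k, l) \tr (mulM ('X_[rem_mnm k] * 'X_[rem_mnm l])).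

Lemma det_mulM_neq0 p : p != 0 -> \det (mulM p) != 0.
Proof.
move=> p0; apply/det0P => -[v v0 vp].
have : rep v * p = 0 by rewrite -rep_mulM vp /rep big1 // => k _; rewrite mxE rmorph0 mul0r.
move/eqP; rewrite mulf_eq0 (negbTE p0) orbF => /eqP e.
case/eqP: v0; apply: rep_inj; rewrite e.
by rewrite /rep big1 // => k _; rewrite mxE rmorph0 mul0r.
Qed.

(* Characteristic 0: if p is orthogonal to everything, then so is the multiple
   of p that represents the scalar det (mulM p), whose trace is D times itself. *)
Lemma det_trace_form_neq0 : \det trace_form != 0.
Proof.
apply/det0P => -[v v0 vT]; set p := rep v.
have p0 : p != 0.
  apply: contraNneq v0 => e; apply/eqP/rep_inj; rewrite -/p e.
  by rewrite /rep big1 // => k _; rewrite mxE rmorph0 mul0r.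
have trX l : \tr (mulM (p * 'X_[rem_mnm l])) = 0.
  have := congr1 (fun B => fun_of_matrix B 0 l) vT; rewrite /= !mxE => <-.
  rewrite /p /rep mulr_suml mulM_sum raddf_sum; apply: eq_bigr => k _ /=.
  by rewrite -mulrA mulM_substM mxtraceZ mxE.
have trp g : \tr (mulM (p * g)) = 0.
  rewrite -(nfK g) /rep mulr_sumr mulM_sum raddf_sum big1 // => l _ /=.
  by rewrite mulrCA mulM_substM mxtraceZ trX mulr0.
pose k0 := rem_index 0%MM.
have X0 : 'X_[rem_mnm k0] = 1 :> {mpoly K[N]}.
  by rewrite rem_indexK (_ : mnm_mod d 0 = 0%MM) ?mpolyX0 //; apply/mnmP => i; rewrite !mnmE mod0n.
have adj : p * rep (row k0 (\adj (mulM p))) = substF (\det (mulM p)).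
  rewrite mulrC -rep_mulM -row_mul mul_adj_mx -[RHS]mulr1 -X0 -rep_delta -repZ.
  by congr rep; apply/rowP => l; rewrite !mxE eqxx /= mulr_natr eq_sym.
have := trp (rep (row k0 (\adj (mulM p)))); rewrite adj mulM_subst mxtrace_scalar.
move/eqP; rewrite -mulr_natr mulf_eq0 (negbTE (det_mulM_neq0 p0)) /=.
rewrite -mpolyC_nat mpolyC_eq0 pnatr_eq0 => /eqP D0.
by have := ltn_ord k0; rewrite {2}D0.
Qed.

End FreeModule.

(** * Lower bound for the determinants *)

(* Points are chosen one by one: expanding along the last column, the new
   determinant is the previous one times a monic combination of the f_j. *)
Lemma leja_points (K : numFieldType) (T : Type) (t0 : T) (E : T -> Prop)
  (f : nat -> T -> K) (tau : nat -> K) n :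
  (forall s, (s < n)%N -> 0 < tau s) ->
  (forall s (c : nat -> K), (s < n)%N ->
    exists2 z, E z & tau s <= `|f s z + \sum_(j < s) c j * f j z|) ->
  exists2 z : nat -> T, (forall j, (j < n)%N -> E (z j)) &
    \prod_(s < n) tau s <= `|\det (\matrix_(i < n, j < n) f i (z j))|.
Proof.
elim: n => [_ _|n IH tau_gt0 H].
  by exists (fun=> t0) => //; rewrite big_ord0 det_mx00 normr1.
have [s sn|s c sn|z zE le] := IH; [exact/tau_gt0/ltnW|exact/H/ltnW|].
pose A (x : T) := \matrix_(i < n.+1, j < n.+1) f i (if (j < n)%N then z j else x).
pose D i := cofactor (A t0) i ord_max.
have cofE x i : cofactor (A x) i ord_max = D i.
  congr (_ * \det _); apply/matrixP => k l; rewrite !mxE.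
  by rewrite !lift_max ltn_ord.
have Dmax : D ord_max = \det (\matrix_(i < n, j < n) f i (z j)).
  rewrite /D /cofactor addnn -signr_odd odd_double mul1r; congr (\det _).
  by apply/matrixP => k l; rewrite !mxE !lift_max ltn_ord.
have D_gt0 : 0 < `|D ord_max|.
  rewrite Dmax (lt_le_trans _ le) // prodr_gt0 // => s _; by apply: tau_gt0; rewrite ltnS ltnW.
have D0 : D ord_max != 0 by rewrite -normr_gt0.
(* The coefficients are the cofactors of the last column divided by the one in the corner; none of
   them depends on the new point. *)
have [x xE lex] := H n (fun j => D (inord j) / D ord_max) (ltnSn n).
exists (fun j => if (j < n)%N then z j else x).
  by move=> j jn; case: ifP => // /zE.
have -> : \matrix_(i, j) f i (if (j < n)%N then z j else x) = A x by [].
rewrite [leLHS]big_ord_recr /= (expand_det_col _ ord_max) [X in `|X|]big_ord_recr /=.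
have -> : \sum_(i < n) A x (widen_ord (leqnSn n) i) ord_max *
      cofactor (A x) (widen_ord (leqnSn n) i) ord_max + A x ord_max ord_max *
      cofactor (A x) ord_max ord_max =
    D ord_max * (f n x + \sum_(j < n) (D (inord j) / D ord_max) * f j x).
  rewrite mulrDr addrC cofE mxE ltnn mulrC; congr (_ + _).
  rewrite mulr_sumr; apply: eq_bigr => i _; rewrite cofE mxE ltnn /=.
  have -> : widen_ord (leqnSn n) i = inord i.
    by apply: val_inj; rewrite /= inordK // ltnW // ltnS.
  by rewrite mulrA [D ord_max * _]mulrC divfK // mulrC.
rewrite normrM ler_pM //; last by rewrite Dmax.
  by apply: prodr_ge0 => s _; apply/ltW/tau_gt0; rewrite ltnS ltnW.
exact/ltW/tau_gt0.
Qed.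

(** * Cauchy's estimate for coefficients *)

Section CoefficientEstimate.
Variable K : numClosedFieldType.

Lemma exists_prim_root L : (0 < L)%N -> exists r : K, L.-primitive_root r.
Proof.
move=> L_gt0; have [r r_inj r1] := exists_unity_roots K L_gt0.
have := @has_prim_root K L [seq r k | k <- enum 'I_L] L_gt0.
rewrite size_map size_enum_ord leqnn map_inj_uniq ?enum_uniq // => h.
have /hasP [x _ xP] : has L.-primitive_root [seq r k | k <- enum 'I_L].
  by apply: h => //; apply/allP => _ /mapP [k _ ->]; apply/unity_rootP.
by exists x.
Qed.

Lemma norm_unity_root (L : nat) (r : K) : (0 < L)%N -> r ^+ L = 1 -> `|r| = 1.
Proof.
by move=> L_gt0 rL; apply/eqP; rewrite -(@pexpr_eq1 _ _ L) // -normrX rL normr1.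
Qed.

(** The Cauchy integral is replaced by a sum over rho times the L-th roots of unity, which is exact
    once L exceeds both the degree of f and b. *)
Lemma cauchy_poly (f : {poly K}) (rho : K) b : 0 < rho ->
  exists2 x, `|x| = rho & `|f`_b| * rho ^+ b <= `|f.[x]|.
Proof.
move=> rho_gt0; pose L := maxn (size f) b.+1.
have bL : (b < L)%N by rewrite leq_maxr.
have L_gt0 : (0 < L)%N by rewrite (leq_trans _ bL).
have [r rP] := exists_prim_root L_gt0.
have nr k : `|r ^+ k| = 1.
  by apply: (norm_unity_root L_gt0); rewrite exprAC (prim_expr_order rP) expr1n.
(* The exponent k (L - b) stands for -k b. *)
have sumE : \sum_(k < L) f.[rho * r ^+ k] * r ^+ (k * (L - b)) = (f`_b * rho ^+ b) *+ L.
  under eq_bigr => k _ do rewrite (horner_coef_wide _ (leq_maxl _ _ : size f <= L)%N) mulr_suml.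
  rewrite exchange_big (bigD1 (Ordinal bL)) //= [X in _ + X]big1 ?addr0 => [|j jb].
    transitivity (\sum_(k < L) f`_b * rho ^+ b); last by rewrite sumr_const card_ord.
    apply: eq_bigr => k _.
    rewrite exprMn -exprM mulrA -[LHS]mulrA -exprD -mulnDr subnKC; last exact: ltnW.
    by rewrite mulnC exprM (prim_expr_order rP) expr1n mulr1.
  have e (k : 'I_L) : f`_j * (rho * r ^+ k) ^+ j * r ^+ (k * (L - b)) =
      f`_j * rho ^+ j * (r ^+ (j + (L - b))) ^+ k.
    by rewrite exprMn -[(r ^+ k) ^+ j]exprM mulrA -[LHS]mulrA -exprD -mulnDr mulnC exprM.
  rewrite (eq_bigr _ (fun k _ => e k)).
  rewrite -mulr_sumr; set q := r ^+ (j + (L - b)).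
  have q1 : q != 1.
    rewrite -(prim_order_dvd rP); have jL := ltn_ord j.
    have [jlt|jgt|je] := ltngtP (j : nat) b.
    - by rewrite gtnNdvd //; move: jL; clear -jlt bL; lia.
    - have -> : (j + (L - b) = L + (j - b))%N by clear -jgt bL; lia.
      by rewrite dvdn_addr // gtnNdvd //; clear -jgt jL; lia.
    - by move: jb; rewrite -val_eqE /= je eqxx.
  have : (q - 1) * \sum_(k < L) q ^+ k = 0.
    by rewrite -subrX1 /q exprAC (prim_expr_order rP) expr1n subrr.
  by move/eqP; rewrite mulf_eq0 subr_eq0 (negbTE q1) /= => /eqP ->; rewrite mulr0.
have [k le] : exists k : 'I_L, `|f`_b| * rho ^+ b <= `|f.[rho * r ^+ k]|.
  apply/existsP; apply: contraT; rewrite negb_exists => /forallP lt.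
  have : `|(f`_b * rho ^+ b) *+ L| < (`|f`_b| * rho ^+ b) *+ L.
    rewrite -sumE (le_lt_trans (ler_norm_sum _ _ _)) //.
    apply: (@lt_le_trans _ _ (\sum_(k < L) `|f`_b| * rho ^+ b)); last first.
      by rewrite sumr_const card_ord.
    apply: ltr_sum => [|k _].
      by apply/hasP; exists (Ordinal bL); rewrite ?mem_index_enum.
    rewrite normrM nr mulr1 real_ltNge ?lt //.
    by rewrite realM ?normr_real ?realX ?gtr0_real.
  by rewrite normrMn normrM normrX (gtr0_norm rho_gt0) ltxx.
exists (rho * r ^+ k) => //; by rewrite normrM nr mulr1 gtr0_norm.
Qed.

Lemma mcoeff_muni n (p : {mpoly K[n.+1]}) (m : 'X_{1..n.+1}) :
  ((muni p)`_(m ord_max))@_[multinom m (widen_ord (leqnSn n) i) | i < n] = p@_m.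
Proof.
elim/mpolyind: p => [|c k p _ _ IH]; first by rewrite muni0 coef0 !mcoeff0.
rewrite muniD coefD mcoeffD [RHS]mcoeffD; congr (_ + _); last exact: IH.
rewrite muniZ coefZ mcoeffCM mcoeffZ muniE msuppX big_seq1 mcoeffX eqxx scale1r.
rewrite coefZ coefXn mulr_natr mcoeffMn !mcoeffX -mulrnA mulnb; congr (_ * (nat_of_bool _)%:R).
apply/andP/eqP => [[/eqP/mnmP e1 /eqP e2]|->] //.
apply/mnmP; apply: ord_max_ind => [|i]; first by rewrite e2.
by have := e1 i; rewrite !mnmE.
Qed.

End CoefficientEstimate.

Lemma cauchy_mpoly (K : numClosedFieldType) n (p : {mpoly K[n]}) (rho : K) m :
  0 < rho ->
  exists2 v, (forall i, `|v i| = rho) & `|p@_m| * rho ^+ mdeg m <= `|p.@[v]|.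
Proof.
move=> rho_gt0; elim: n p m => [|n IH] p m.
  exists (fun=> 0); first by case.
  rewrite nvar0_mnmE mdeg0 expr0 mulr1.
  by rewrite [p in p.@[_]]nvar0_mpolyC mevalC.
pose m' : 'X_{1..n} := [multinom m (widen_ord (leqnSn n) i) | i < n].
have [w wr lew] := IH ((muni p)`_(m ord_max)) m'.
have [x xr lex] := cauchy_poly (map_poly (meval w) (muni p)) (m ord_max) rho_gt0.
have [v [vw vx]] := extend_last w x; exists v.
  by apply: ord_max_ind => [|i]; rewrite ?vx // -[v _]/((v \o _) i) vw.
rewrite meval_muni vw vx; apply: le_trans lex; rewrite coef_map /=.
have -> : mdeg m = (mdeg m' + m ord_max)%N.
  rewrite !mdegE big_ord_recr; congr (_ + _)%N.
  by apply: eq_bigr => i _; rewrite mnmE.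
rewrite exprD mulrA ler_wpM2r ?exprn_ge0 ?(ltW rho_gt0) //.
by move: lew; rewrite mcoeff_muni.
Qed.

Lemma meval_bounded (K : numClosedFieldType) n (p : {mpoly K[n]}) (B : K) :
  exists2 C, 0 < C & forall z, (forall i, `|z i| <= B) -> `|p.@[z]| <= C.
Proof.
elim/mpolyind: p => [|c m p _ _ [C C_gt0 HC]].
  by exists 1 => // z _; rewrite meval0 normr0 ler01.
exists (`|c| * (1 + `|B|) ^+ mdeg m + C); first by rewrite ltr_wpDl ?mulr_ge0 ?exprn_ge0 ?addr_ge0.
move=> z zB; rewrite mevalD (le_trans (ler_normD _ _)) // lerD ?HC //.
rewrite mevalZ normrM ler_wpM2l // mevalX normr_prod mdegE -prodrXr.
apply: ler_prod => i _; rewrite normr_ge0 normrX /= lerXn2r ?nnegrE ?addr_ge0 //.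
rewrite (le_trans (zB i)) // (le_trans (real_ler_norm _)) ?lerDr //.
by rewrite ger0_real // (le_trans _ (zB i)).
Qed.

Lemma mcoeff0_meval (A : comNzRingType) n (p : {mpoly A[n]}) :
  p@_0%MM = p.@[fun=> 0].
Proof.
elim/mpolyind: p => [|c m p _ _ IH]; first by rewrite meval0 mcoeff0.
rewrite mcoeffD mevalD IH mcoeffZ mevalZ mcoeffX; congr (_ * _ + _).
rewrite mevalX; case: (eqVneq m 0%MM) => [->|m0].
  by rewrite big1 // => i _; rewrite mnm0E expr0.
have [i mi] : exists i, m i != 0%N.
  apply/existsP; rewrite -negb_forall; apply: contra m0 => /forallP h.
  by apply/eqP/mnmP => i; rewrite mnm0E; apply/eqP.
by rewrite (bigD1 i) //= expr0n (negbTE mi) mul0r.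
Qed.

Definition translate (A : comNzRingType) n (w : 'I_n -> A) : {mpoly A[n]} -> {mpoly A[n]} :=
  mmap (@mpolyC n A) (fun i => 'X_i + (w i)%:MP).
HB.instance Definition _ (A : comNzRingType) n (w : 'I_n -> A) :=
  GRing.RMorphism.on (translate w).

Lemma meval_translate (A : comNzRingType) n (w v : 'I_n -> A) p :
  (translate w p).@[v] = p.@[fun i => v i + w i].
Proof.
apply: (@rmorph_mpoly_eq _ _ _ (meval v \o translate w) (meval _)) => [c|i] /=.
  by rewrite /translate mmapC !mevalC.
by rewrite /translate mmapX mmap1U mevalD mevalC !mevalXU.
Qed.

(** X^m p has no term of degree below |m|, and its only possible one of degree |m| is p_0 X^m. This
    isolates one summand of the trace polynomial. *)
Lemma mcoeff_lowest (A : comNzRingType) n (p : {mpoly A[n]}) (m k : 'X_{1..n}) :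
  (mdeg k <= mdeg m)%N -> ('X_[m] * p)@_k = (m == k)%:R * p@_0%MM.
Proof.
move=> km; case: (eqVneq m k) => [<-|mk].
  by rewrite mul1r mulrC -(mcoeffMX p m) ?addm0 ?add0m.
rewrite mul0r -(mcoeff0 A k) -(mul0r (0 : {mpoly A[n]})).
apply: mcoeffM_eq => m1 m2 dk ek.
rewrite !mcoeff0 mul0r mcoeffX.
case: eqP => [em1|]; last by rewrite mul0r.
have m20 : m2 = 0%MM.
  apply/eqP; rewrite -mdeg_eq0; move: dk km; rewrite em1; clear.
  by move: (mdeg k) (mdeg m1) (mdeg m2); lia.
by move: mk; rewrite ek m20 em1 addm0 eqxx.
Qed.

(** * Lower bounds from the trace form *)

Section LowerBound.
Variables (K : numClosedFieldType) (N d : nat).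
Hypothesis d_gt0 : (0 < d)%N.
Variable F : 'I_N -> {mpoly K[N]}.
Hypothesis F_deg : forall i, deg_le d (F i).
Hypothesis F_det : forall n, adapted_det d F n != 0.
Local Notation D := #|{: {ffun 'I_N -> 'I_d}}|.
Local Notation tr w g := (ftrace d_gt0 F_deg F_det w g).

Lemma ftrace_substM w c g : tr w (substF F c * g) = c.@[w] * tr w g.
Proof. by rewrite !ftrace_mulM mulM_substM mxtraceZ mevalM. Qed.

Lemma ftraceZ w c g : tr w (c *: g) = c * tr w g.
Proof. by rewrite !ftrace_mulM mulM_Z mxtraceZ mevalM mevalC. Qed.

Lemma ftrace_sum w (I : Type) (r : seq I) (g : I -> {mpoly K[N]}) :
  tr w (\sum_(i <- r) g i) = \sum_(i <- r) tr w (g i).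
Proof.
rewrite ftrace_mulM mulM_sum.
rewrite (raddf_sum mxtrace) (rmorph_sum (meval w)).
by apply: eq_bigr => i _; rewrite ftrace_mulM.
Qed.

Variables (w0 : 'I_N -> K) (rho B : K).
Hypothesis w0_nondeg : (\det (trace_form d_gt0 F_deg F_det)).@[w0] != 0.
Hypothesis rho_gt0 : 0 < rho.
Hypothesis F_bounded : forall z,
  (forall i, `|(F i).@[z] - w0 i| = rho) -> forall i, `|z i| <= B.

Local Notation Fw := (fun i => F i - (w0 i)%:MP).

Lemma adapted_shifted g : adapted d Fw g =
  substF F (\prod_i ('X_i - (w0 i)%:MP) ^+ mnm_div d g i) * 'X_[mnm_mod d g].
Proof.
rewrite /adapted mulrC; congr (_ * _); rewrite rmorph_prod; apply: eq_bigr => i _.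
by rewrite rmorphXn rmorphB /= substFC /substF mmapX mmap1U.
Qed.

Lemma dual_basis : exists G : 'I_D -> {mpoly K[N]},
  forall k l, tr w0 ('X_[rem_mnm k] * G l) = (k == l)%:R.
Proof.
pose T0 := map_mx (meval w0) (trace_form d_gt0 F_deg F_det).
have T0U : T0 \in unitmx by rewrite unitmxE unitfE det_map_mx.
exists (fun l => \sum_k invmx T0 k l *: 'X_[rem_mnm k]) => k l.
rewrite mulr_sumr ftrace_sum; have := congr1 (fun A => fun_of_matrix A k l) (mulmxV T0U).
rewrite /= !mxE => <-; apply: eq_bigr => j _.
by rewrite -scalerAr ftraceZ mulrC !mxE ftrace_mulM.
Qed.

Lemma combination_lower_bound : exists2 tau, 0 < tau &
  forall n i0 (c : 'I_#|{: 'X_{1..N < n.+1}}| -> K), c i0 = 1 ->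
  (forall i, c i != 0 ->
    (mdeg (mnm_div d (nthm n i0)) <= mdeg (mnm_div d (nthm n i)))%N) ->
  exists2 z, (forall i, `|(F i).@[z] - w0 i| = rho) &
    tau * rho ^+ mdeg (mnm_div d (nthm n i0)) <=
      `|\sum_i c i * (adapted d Fw (nthm n i)).@[z]|.
Proof.
have [G GP] := dual_basis.
have /choice [C CP] : forall l : 'I_D, exists C, 0 < C /\
    forall z, (forall i, `|z i| <= B) -> `|(G l).@[z]| <= C.
  by move=> l; have [C C0 HC] := meval_bounded (G l) B; exists C.
(* The index l of the dual element varies with [i0] while tau must not, so all G_l are bounded at
   once; the summand 1 keeps the bound positive. *)
pose CC := 1 + \sum_l C l.
have CC_gt0 : 0 < CC.
  by rewrite ltr_pwDl ?ltr01 // sumr_ge0 // => l _; apply/ltW; case: (CP l).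
have CC_ge l : C l <= CC.
  rewrite /CC (bigD1 l) //= addrCA lerDl addr_ge0 ?ler01 // sumr_ge0 // => k _.
  by apply/ltW; case: (CP k).
have D_gt0 : (0 < D)%N by case: (rem_index d_gt0 0%MM (N := N)) => k; exact: leq_ltn_trans.
(* If |p| were below tau rho^|b| on the fibre, the trace, a sum of D values of p G_l, would be at
   most rho^|b| / 2, against Cauchy's estimate. *)
pose tau : K := (CC *+ (2 * D))^-1.
have tau_gt0 : 0 < tau by rewrite invr_gt0 pmulrn_lgt0 // muln_gt0 D_gt0.
exists tau => // n i0 c c1 cdeg.
set b0 := mnm_div d (nthm n i0); set p := \sum_i c i *: adapted d Fw (nthm n i).
have pE z : \sum_i c i * (adapted d Fw (nthm n i)).@[z] = p.@[z].
  by rewrite rmorph_sum; apply: eq_bigr => i _; rewrite /= mevalZ.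
pose l := rem_index d_gt0 (nthm n i0).
pose S i := translate w0 (\tr (mulM d_gt0 F_deg F_det ('X_[mnm_mod d (nthm n i)] * G l))).
(* The trace of p G_l as a polynomial in w - w0. At b0 only terms with the same quotient can
   contribute, since no quotient has smaller degree; among these, duality at w0 retains the one with
   the remainder of g. *)
pose Y : {mpoly K[N]} := \sum_i c i *: ('X_[mnm_div d (nthm n i)] * S i).
have Y0 : Y@_b0 = 1.
  rewrite raddf_sum (bigD1 i0) //= big1 => [|i ii0].
    rewrite addr0 mcoeffZ c1 mul1r mcoeff_lowest // eqxx mul1r mcoeff0_meval.
    rewrite meval_translate -ftrace_mulM.
    by under eq_fun do rewrite add0r; rewrite -rem_indexK GP eqxx.
  rewrite mcoeffZ; have [->|ci] := eqVneq (c i) 0; first by rewrite mul0r.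
  rewrite mcoeff_lowest ?cdeg //; case: eqP => [eb|_]; last by rewrite mul0r mulr0.
  rewrite mcoeff0_meval meval_translate -ftrace_mulM.
  under eq_fun do rewrite add0r.
  rewrite -rem_indexK GP; case: eqP => [er|_]; last by rewrite !mulr0.
  case/eqP: ii0; apply: (@nthm_inj N n).
  by rewrite -(joinK d_gt0 (nthm n i)) er eb joinK.
have [v vr leY] := cauchy_mpoly Y b0 rho_gt0.
rewrite Y0 normr1 mul1r in leY.
pose wv i := v i + w0 i.
have YE : Y.@[v] = tr wv (p * G l).
  rewrite rmorph_sum mulr_suml ftrace_sum; apply: eq_bigr => i _ /=.
  rewrite mevalZ mevalM meval_translate -ftrace_mulM -scalerAl ftraceZ.
  rewrite adapted_shifted -mulrA ftrace_substM; congr (_ * (_ * _)).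
  rewrite mevalX rmorph_prod; apply: eq_bigr => j _.
  by rewrite rmorphXn /= mevalB mevalXU mevalC /wv addrK.
apply: contrapT => nz; move: leY; rewrite YE; apply/negP.
have wv_on z : (forall i, (F i).@[z] = wv i) -> forall i, `|(F i).@[z] - w0 i| = rho.
  by move=> zw i; rewrite zw /wv addrK.
have rhob_gt0 : 0 < rho ^+ mdeg b0 by rewrite exprn_gt0.
have bd : `|tr wv (p * G l)| <= (tau * rho ^+ mdeg b0 * CC) *+ D.
  apply: ftrace_bound => z zw; rewrite mevalM normrM ler_pM //; last first.
    by rewrite (le_trans _ (CC_ge l)) //; case: (CP l) => _; apply; exact/F_bounded/wv_on.
  have taur : tau * rho ^+ mdeg b0 \is Num.real by rewrite gtr0_real // mulr_gt0.
  have [//|lt] := real_leP (normr_real p.@[z]) taur.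
  by case: nz; exists z; [exact: wv_on|rewrite pE ltW].
have e : (tau * rho ^+ mdeg b0 * CC) *+ D = rho ^+ mdeg b0 / 2.
  have CC0 : CC != 0 by rewrite gt_eqF.
  have D0 : D%:R != 0 :> K by rewrite pnatr_eq0 -lt0n.
  rewrite /tau -[in X in X^-1]mulr_natr -mulr_natr natrM.
  by field; rewrite CC0 D0.
rewrite e in bd; apply/negP => leY; have := le_trans leY bd.
apply/negP; rewrite -real_ltNge ?gtr0_real ?divr_gt0 //.
by rewrite ltr_pdivrMr // ltr_pMr // ltr1n.
Qed.

Lemma det_lower_bound : exists2 tau, 0 < tau &
  forall n, exists2 z : 'I_#|{: 'X_{1..N < n.+1}}| -> 'I_N -> K,
    (forall j i, `|(F i).@[z j] - w0 i| = rho) &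
    tau ^+ #|{: 'X_{1..N < n.+1}}| * rho ^+ det_degree N d n <=
      `|\det (\matrix_(i, j) (adapted d Fw (nthm n i)).@[z j])|.
Proof.
have [tau tau_gt0 H] := combination_lower_bound; exists tau => // n.
set M := #|{: 'X_{1..N < n.+1}}|; pose e (i : 'I_M) := mdeg (mnm_div d (nthm n i)).
have [i00 _] : exists i, nthm n i = 0%MM :> 'X_{1..N} by apply: nthm_surj; rewrite mdeg0.
(* Rows in order of decreasing |b|: each row is then combined only with earlier ones of at least the
   same |b|, as [combination_lower_bound] requires. *)
pose sq := sort (fun i j => e j <= e i)%N (enum 'I_M).
have sq_size : size sq = M by rewrite size_sort size_enum_ord.
have sq_uniq : uniq sq by rewrite sort_uniq enum_uniq.
have sq_mem i : i \in sq by rewrite mem_sort mem_enum.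
have sq_sorted : sorted (fun i j => e j <= e i)%N sq.
  by apply: sort_sorted => i j; exact: leq_total.
pose g k := nth i00 sq k.
have gK k : (k < M)%N -> index (g k) sq = k by move=> kM; rewrite index_uniq ?sq_size.
have g_inj : injective (fun k : 'I_M => g k).
  by move=> k l /(congr1 (index^~ sq)); rewrite !gK // => /val_inj.
pose f k z := (adapted d Fw (nthm n (g k))).@[z].
have [s _|s c sM|z zE lez] := @leja_points K _ (fun=> 0)
    (fun z => forall i, `|(F i).@[z] - w0 i| = rho) f (fun k => tau * rho ^+ e (g k)) M.
- by rewrite mulr_gt0 ?exprn_gt0.
- pose c' i := let k := index i sq in if (k < s)%N then c k else (k == s)%:R.
  have c'g k : (k < M)%N -> c' (g k) = if (k < s)%N then c k else (k == s)%:R.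
    by move=> kM; rewrite /c' gK.
  have [||z zE lez] := H n (g s) c'; first by rewrite c'g // ltnn eqxx.
    move=> i; rewrite /c' => ci.
    have iM : (index i sq < M)%N by rewrite -sq_size index_mem.
    have les : (index i sq <= s)%N.
      rewrite leqNgt; apply: contraNN ci => si; rewrite ltnNge (ltnW si) (gtn_eqF si).
      by rewrite mulr0n.
    suff: (e (g s) <= e (nth i00 sq (index i sq)))%N by rewrite nth_index.
    have e_trans : transitive (fun i j => e j <= e i)%N.
      by move=> j1 j2 j3 h1 h2; exact: leq_trans h2 h1.
    have e_refl : reflexive (fun i j => e j <= e i)%N by move=> j1; exact: leqnn.
    by apply: (sorted_leq_nth e_trans e_refl i00 sq_sorted) les; rewrite inE sq_size.
  exists z => //; apply: le_trans lez _; rewrite le_eqVlt; apply/orP; left; apply/eqP.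
  congr `|_|; pose h k := (if (k < s)%N then c k else (k == s)%:R) * f k z.
  rewrite (reindex_inj g_inj) /= (eq_bigr (fun k : 'I_M => h k)) => [|k _].
    rewrite -(big_mkord xpredT h) (big_cat_nat (n := s)) ?(ltnW sM) //=.
    rewrite (big_ltn sM) [in X in _ + (X + _)]/h ltnn eqxx mul1r addrCA.
    rewrite [X in _ + (_ + X)]big_nat_cond [X in _ + (_ + X)]big1 ?addr0.
by congr (_ + _); rewrite big_mkord; apply: eq_bigr => k _; rewrite /h ltn_ord.
    by move=> k /andP [/andP [sk _] _]; rewrite /h ltnNge ltnW // gtn_eqF // mul0r.
  by rewrite /h c'g.
exists (fun j : 'I_M => z j); first by move=> j; exact: zE.
pose A := \matrix_(i < M, j < M) (adapted d Fw (nthm n i)).@[z j].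
have detE : \matrix_(i < M, j < M) f i (z j) = row_perm (perm g_inj) A.
  by apply/matrixP => i j; rewrite !mxE permE.
move: lez; rewrite detE row_permE det_mulmx normrM det_perm normrX normrN1 expr1n mul1r.
rewrite big_split /= prodr_const card_ord prodrXr.
by rewrite /det_degree [in X in _ -> X](reindex_inj g_inj).
Qed.

End LowerBound.

(** * Perturbations and growth of regular maps *)

Section Perturbation.
Variable K : numClosedFieldType.

Lemma meval_lipschitz n (p : {mpoly K[n]}) a : exists2 C, 0 < C &
  forall delta e, 0 <= e -> e <= 1 -> (forall k, `|delta k| <= e) ->
    `|p.@[fun k => a k + delta k] - p.@[a]| <= C * e.
Proof.
pose L (p : {mpoly K[n]}) := exists2 C, 0 < C &
  forall delta e, 0 <= e -> e <= 1 -> (forall k, `|delta k| <= e) ->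
    `|p.@[fun k => a k + delta k] - p.@[a]| <= C * e.
have LC c : L c%:MP.
  by exists 1 => // delta e e0 _ _; rewrite !mevalC subrr normr0 mul1r.
have LD q r : L q -> L r -> L (q + r).
  move=> [C C0 HC] [C' C'0 HC']; exists (C + C'); first exact: addr_gt0.
  move=> delta e e0 e1 de; rewrite !mevalD opprD addrACA mulrDl.
  by rewrite (le_trans (ler_normD _ _)) // lerD ?HC ?HC'.
have LM q r : L q -> L r -> L (q * r).
  move=> [C C0 HC] [C' C'0 HC']; exists (C * (`|r.@[a]| + C') + (1 + `|q.@[a]|) * C').
    apply: addr_gt0; first by apply: mulr_gt0 => //; exact: ltr_wpDl.
    by apply: mulr_gt0 => //; exact: ltr_pwDl.
  move=> delta e e0 e1 de; rewrite !mevalM.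
  set q' := q.@[_]; set r' := r.@[_].
  have -> : q' * r' - q.@[a] * r.@[a] = (q' - q.@[a]) * r' + q.@[a] * (r' - r.@[a]).
    by ring.
  have r'_le : `|r'| <= `|r.@[a]| + C'.
    rewrite -[r'](subrK r.@[a]) addrC (le_trans (ler_normD _ _)) // lerD //.
    by rewrite (le_trans (HC' _ _ e0 e1 de)) // ler_piMr // ltW.
  rewrite [leRHS]mulrDl (le_trans (ler_normD _ _)) // !normrM lerD //.
    by rewrite mulrAC ler_pM // HC.
  rewrite -mulrA ler_pM //; first by rewrite lerDr.
  exact: HC'.
have LX i : L 'X_i by exists 1 => // delta e _ _ de; rewrite !mevalXU addrAC subrr add0r mul1r.
rewrite -/(L p) (mpolyE p); apply: big_ind => [||m _]; [by rewrite -mpolyC0|exact: LD|].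
rewrite -mul_mpolyC; apply: (LM); first exact: LC.
rewrite mpolyXE_id; apply: big_ind => [||i _]; [by rewrite -mpolyC1|exact: LM|].
elim: (m i) => [|k IH]; first by rewrite expr0 -mpolyC1.
by rewrite exprS; exact: LM.
Qed.

Lemma meval_growth N k (p : {mpoly K[N]}) : deg_le k p -> exists2 C, 0 <= C &
  forall z m, 1 <= m -> (forall i, `|z i| <= m) -> `|p.@[z]| <= C * m ^+ k.
Proof.
move=> pk; exists (\sum_i `|p@_(nthm k i)|); first exact: sumr_ge0.
move=> z m m1 zm; rewrite (meval_deg_le z pk) (le_trans (ler_norm_sum _ _ _)) //.
rewrite mulr_suml ler_sum // => i _; rewrite normrM ler_wpM2l //.
apply: (@le_trans _ _ (m ^+ mdeg (nthm k i))); last first.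
  by apply: ler_weXn2l; rewrite ?mdeg_nthm.
rewrite mevalX normr_prod mdegE -prodrXr; apply: ler_prod => j _.
by rewrite normr_ge0 normrX lerXn2r ?nnegrE // (le_trans ler01).
Qed.

Section Growth.
Variables (N d : nat).
Hypotheses (N_gt0 : (0 < N)%N) (d_gt0 : (0 < d)%N).
Variable P : {mpoly K[#|coef_index N d|]}.
Hypothesis P_zero : forall a, P.@[a] = 0 <-> common_zero (tuple_of a).
Variable a : 'I_#|coef_index N d| -> K.
Hypothesis Pa : P.@[a] != 0.

(* If every |H_i(z)| were at most e |z_i0|^d, then z would be a common zero of
   the nearby tuple H_i - (H_i(z) / z_i0^d) X_i0^d. *)
Lemma regular_growth : exists2 e, 0 < e & forall t, `|t| <= e ->
  forall (z : 'I_N -> K) i0, z i0 != 0 ->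
  exists i, e * `|z i0| ^+ d < `|(tuple_of a i + t *: 'X_i ^+ d).@[z]|.
Proof.
have [C C0 HC] := meval_lipschitz P a.
have Pa0 : 0 < `|P.@[a]| by rewrite normr_gt0.
(* This gives 2 e <= 1 and 2 C e < |P(a)|. The coefficients move by at most 2 e: one e from t, one
   from c_i. *)
pose e := `|P.@[a]| / (C + `|P.@[a]|) / 2.
have CP0 : 0 < C + `|P.@[a]| by exact: addr_gt0.
have e0 : 0 < e by rewrite !divr_gt0.
have ee : e + e = `|P.@[a]| / (C + `|P.@[a]|) by rewrite /e; field; rewrite gt_eqF.
exists e => // t te z i0 zi0; apply: contrapT => /forallNP h.
have {}h i : `|(tuple_of a i + t *: 'X_i ^+ d).@[z]| <= e * `|z i0| ^+ d.
  rewrite real_leNgt; first exact/negP/h.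
    exact: normr_real.
  by rewrite ger0_real // mulr_ge0 ?ltW // exprn_gt0 // normr_gt0.
pose c i := (tuple_of a i + t *: 'X_i ^+ d).@[z] / z i0 ^+ d.
have c_le i : `|c i| <= e.
  by rewrite normrM normfV normrX ler_pdivrMr ?exprn_gt0 ?normr_gt0.
pose G (i : 'I_N) : {mpoly K[N]} := t *: 'X_i ^+ d - c i *: 'X_i0 ^+ d.
have Gd i : G i \is d.-homog by rewrite rpredB // dhomogZ // homog_Xn.
have bX (i : 'I_N) m : `|('X_i ^+ d : {mpoly K[N]})@_m| <= 1.
  by rewrite mpolyXn mcoeffX; case: eqP; rewrite ?normr1 ?normr0.
have bG (k : 'I_#|coef_index N d|) : `|coefs_of G k| <= e + e.
  rewrite /coefs_of mcoeffB !mcoeffZ (le_trans (ler_normB _ _)) //.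
  rewrite [`|t * _|]normrM [`|c _ * _|]normrM.
  by apply: lerD; rewrite -[leRHS]mulr1; apply: ler_pM (bX _ _).
have /P_zero : common_zero (tuple_of (fun k => a k + 1 * coefs_of G k)).
  exists z; split=> [|i]; first by exists i0.
  rewrite tuple_of_line scale1r tuple_of_coefs // /G !mevalD mevalN !mevalZ.
  rewrite !(rmorphXn (meval z)) /= !mevalXU /c divfK ?expf_neq0 //.
  by rewrite mevalD mevalZ (rmorphXn (meval z)) /= mevalXU addrA subrr.
have -> : (fun k => a k + 1 * coefs_of G k) = (fun k => a k + coefs_of G k).
  by apply: funext => k; rewrite mul1r.
move=> P0; have := HC (coefs_of G) (e + e); rewrite P0 sub0r normrN ee.
have q1 : `|P.@[a]| / (C + `|P.@[a]|) <= 1 by rewrite ler_pdivrMr // mul1r lerDr ltW.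
move=> /(_ _ q1) h2; have := h2 (ltW (divr_gt0 Pa0 CP0)); rewrite -ee => /(_ bG).
by rewrite ee mulrA ler_pdivlMr // mulrC ler_pM2r // gerDl normr_le0 (negbTE Pa).
Qed.

Variable F : 'I_N -> {mpoly K[N]}.
Hypothesis F_deg : forall i, deg_le d (F i).
Hypothesis F_lead : forall i, pihomog mdeg d (F i) = tuple_of a i.

(** At a coordinate of largest modulus, some member of the perturbed leading part exceeds e |z|^d,
    while the remaining terms are O(|z|^(d-1)). The bound B is found before t, because the size
    allowed for t depends on B. *)
Lemma perturbed_bounded : exists e B, [/\ 0 < e, 0 < B & forall t, `|t| <= e ->
  forall z, (forall i, `|(F i + t *: 'X_i ^+ d).@[z]| <= 1) -> forall i, `|z i| <= B].
Proof.
have [e e0 He] := regular_growth.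
have /choice [C CP] : forall i, exists C, 0 <= C /\ forall z m, 1 <= m ->
    (forall i, `|z i| <= m) -> `|(F i - tuple_of a i).@[z]| <= C * m ^+ d.-1.
  move=> i; have [|C C0 HC] := @meval_growth N d.-1 (F i - tuple_of a i); last by exists C.
  move=> m dm; have [_ h] := same_top_lead (F_deg i).
  by rewrite mcoeffB h ?F_lead ?subrr // -(prednK d_gt0).
pose CC := 1 + \sum_i C i.
have sC0 : 0 <= \sum_i C i by apply: sumr_ge0 => i _; case: (CP i).
have CC0 : 0 < CC by rewrite ltr_pwDl.
exists e, (1 + CC / e); split=> //; first by rewrite addr_gt0 // divr_gt0.
move=> t te z zF; have i1 : 'I_N := Ordinal N_gt0.
have [i0 _ /(_ _ isT) zmax] := @real_arg_maxP K _ i1 xpredT (fun i => `|z i|) isT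
  (fun i _ => normr_real _).
have {}zmax i : `|z i| <= `|z i0| := zmax i.
move=> i; apply: le_trans (zmax i) _.
have [z1|z1] := real_leP (normr_real (z i0)) (real1 K).
  by rewrite (le_trans z1) // lerDl ltW // divr_gt0.
have zi0 : z i0 != 0 by rewrite -normr_gt0 (lt_trans ltr01).
have [j hj] := He t te z i0 zi0.
have hle : e * `|z i0| ^+ d <= CC * `|z i0| ^+ d.-1.
  apply: (le_trans (ltW hj)).
  have -> : tuple_of a j + t *: 'X_j ^+ d = (F j + t *: 'X_j ^+ d) - (F j - tuple_of a j).
    by ring.
  rewrite mevalB (le_trans (ler_normB _ _)) // mulrDl lerD //.
    by rewrite (le_trans (zF j)) // mul1r exprn_ege1 // ltW.
  have [Cj0 HCj] := CP j; apply: le_trans (HCj z _ (ltW z1) zmax) _.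
  rewrite ler_wpM2r ?exprn_ge0 // (bigD1 j) //= lerDl sumr_ge0 // => l _.
  by case: (CP l).
move: hle; rewrite -[X in _ * _ ^+ X <= _](prednK d_gt0) exprS mulrA ler_pM2r; last first.
  by rewrite exprn_gt0 // normr_gt0.
move=> hle; rewrite ler_wpDl // ler_pdivlMr //; by rewrite mulrC.
Qed.

End Growth.
End Perturbation.

(** * Bounds for the determinants of monomials *)

Section DeterminantBounds.
Variable K : numClosedFieldType.

(** The number n! of terms is replaced by n^n, whose logarithm is n ln n. *)
Lemma leibniz_bound n (A : 'M[K]_n) (c : 'I_n -> K) : (forall i j, `|A i j| <= c i) ->
  `|\det A| <= (n ^ n)%:R * \prod_i c i.
Proof.
move=> Ac; apply: (@le_trans _ _ (n`!%:R * \prod_i c i)).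
  rewrite /determinant (le_trans (ler_norm_sum _ _ _)) //.
  rewrite (@le_trans _ _ (\sum_(s : 'S_n) \prod_i c i)) //.
    apply: ler_sum => s _; rewrite normrM normrX normrN1 expr1n mul1r normr_prod.
    by apply: ler_prod => i _; rewrite normr_ge0 Ac.
  by rewrite sumr_const card_Sn mulr_natl.
have c0 i : 0 <= c i by exact: le_trans (Ac i i).
rewrite ler_wpM2r ?prodr_ge0 // ler_nat.
elim: n {A c Ac c0} => // n IH; rewrite factS expnS leq_mul //.
by apply: leq_trans IH _; case: (n) => // k; rewrite leq_exp2r.
Qed.

Variables (N d : nat).
Hypotheses (N_gt0 : (0 < N)%N) (d_gt0 : (0 < d)%N).
Local Notation M n := #|{: 'X_{1..N < n.+1}}|.
Variable F : 'I_N -> {mpoly K[N]}.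
Hypothesis F_deg : forall i, deg_le d (F i).

Lemma monomial_det_upper B lambda : 1 <= lambda -> exists2 C, 1 <= C &
  forall n (z : 'I_(M n) -> 'I_N -> K), (forall j i, `|z j i| <= B) ->
  (forall j i, `|(F i).@[z j]| <= lambda) ->
  `|adapted_det d F n| * `|\det (\matrix_(i, j) ('X_[nthm n i]).@[z j])| <=
    (M n ^ M n)%:R * (C ^+ M n * lambda ^+ det_degree N d n).
Proof.
move=> l1; have l0 := le_trans ler01 l1.
have b1 : 1 <= 1 + `|B| by rewrite lerDl.
exists ((1 + `|B|) ^+ (N * d)); first exact: exprn_ege1.
move=> n z zB zF; rewrite -normrM -det_adapted_meval //.
apply: le_trans (leibniz_bound (c := fun i =>
  (1 + `|B|) ^+ (N * d) * lambda ^+ mdeg (mnm_div d (nthm n i))) _) _.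
  move=> i j; rewrite mxE /adapted mevalM normrM ler_pM //.
    rewrite mevalX normr_prod; apply: (@le_trans _ _ (\prod_(k < N) (1 + `|B|) ^+ d)).
      apply: ler_prod => k _; rewrite normr_ge0 /= normrX.
      apply: (@le_trans _ _ ((1 + `|B|) ^+ mnm_mod d (nthm n i) k)); last first.
        by apply: ler_weXn2l; rewrite // mnmE ltnW // ltn_pmod.
      rewrite lerXn2r ?nnegrE ?addr_ge0 // (le_trans (zB j k)) //.
      by rewrite (le_trans (real_ler_norm _)) ?lerDr // ger0_real // (le_trans _ (zB j k)).
    by rewrite prodr_const card_ord -exprM mulnC.
  rewrite rmorph_prod normr_prod mdegE -prodrXr; apply: ler_prod => k _.
  by rewrite normr_ge0 rmorphXn normrX /= lerXn2r ?nnegrE.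
by rewrite big_split /= prodr_const card_ord prodrXr.
Qed.

Hypothesis F_det : forall n, adapted_det d F n != 0.

(** The centre w0 is taken off the zeros of the determinant of the trace form and within eta of 0,
    so that |F_i - w0_i| = rho implies |F_i| <= rho + eta. Subtracting the constants w0_i does not
    affect A_n. *)
Lemma monomial_det_lower B rho eta : 0 < rho -> 0 < eta ->
  (forall z, (forall i, `|(F i).@[z]| <= rho + eta) -> forall i, `|z i| <= B) ->
  exists2 tau, 0 < tau & forall n, exists2 z : 'I_(M n) -> 'I_N -> K,
    (forall j i, `|(F i).@[z j]| <= rho + eta) &
    tau ^+ M n * rho ^+ det_degree N d n <=
      `|adapted_det d F n| * `|\det (\matrix_(i, j) ('X_[nthm n i]).@[z j])|.
Proof.
move=> rho0 eta0 FB.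
have [|w0 w0_le w0_det] := @mpoly_nonroot K (fun x => `|x| <= eta) N _ _
    (det_trace_form_neq0 d_gt0 F_deg F_det).
  move=> s; have [k ks] : exists k : nat, eta / k.+1%:R \notin s.
    apply: contrapT => /forallNP h.
    have := @uniq_leq_size _ [seq eta / k.+1%:R | k <- iota 0 (size s).+1] s.
    rewrite size_map size_iota ltnn map_inj_uniq ?iota_uniq.
      move=> /(_ isT) H; suff: false by []; apply: (H) => x /mapP [k _ ->].
      by apply: contraT => /h.
    move=> i j /(mulfI (lt0r_neq0 eta0)) /invr_inj /eqP.
    by rewrite eqr_nat => /eqP [].
  exists (eta / k.+1%:R) => //; rewrite normrM gtr0_norm // normfV normr_nat.
  by rewrite ler_pdivrMr ?ltr0Sn // ler_peMr ?ler1n ?(ltW eta0).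
have w0F z : (forall i, `|(F i).@[z] - w0 i| = rho) -> forall i, `|(F i).@[z]| <= rho + eta.
  move=> zr i; rewrite -[(F i).@[z]](subrK (w0 i)) (le_trans (ler_normD _ _)) //.
  by rewrite zr lerD.
have [|tau tau0 H] := @det_lower_bound K N d d_gt0 F F_deg F_det w0 rho B w0_det rho0.
  by move=> z zr; exact: FB (w0F z zr).
exists tau => // n; have [z zr le] := H n; exists z; first by move=> j; exact: w0F.
rewrite -normrM (adapted_det_same_top (F' := fun i => F i - (w0 i)%:MP)).
  rewrite -det_adapted_meval // => i m dm.
  by rewrite mcoeffB F_deg // mcoeffC; case: eqP dm => [->|]; rewrite ?mdeg0 ?mulr0 ?subr0.
move=> i; split=> // m dm; rewrite mcoeffB mcoeffC; case: eqP dm => [->|]; last first.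
  by rewrite mulr0 subr0.
by rewrite mdeg0 leqNgt d_gt0.
Qed.

Section Factor.
Variable P : {mpoly K[#|coef_index N d|]}.
Hypothesis P_prime : prime_elt P.
Hypothesis P_zero : forall a, P.@[a] = 0 <-> common_zero (tuple_of a).
Hypothesis P_Xn : P.@[@coefs_Xn K N d] = 1.

(** The roots lie in a finite list without 0, so a single q bounds both |z| and 1 / |z|; L is the
    number of roots. *)
Lemma adapted_det_bounds a : (forall j, (j <= N * d)%N -> adapted_det d (tuple_of a) j != 0) ->
  exists2 q : K, 1 <= q & forall n, exists L,
  [/\ (L + N * d ^ N.-1 * resultant_order N d n <= det_degree N d n)%N,
      `|adapted_det d (tuple_of a) n| <= q ^+ L * `|P.@[a]| ^+ resultant_order N d n &
      `|P.@[a]| ^+ resultant_order N d n <= q ^+ L * `|adapted_det d (tuple_of a) n|].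
Proof.
move=> a_det; have [s s0 H] := adapted_det_factor N_gt0 d_gt0 P_prime P_zero P_Xn a_det.
pose q : K := 1 + \sum_(z <- s) (`|z| + `|z|^-1).
have pos z : 0 <= `|z| + `|z|^-1 :> K by rewrite addr_ge0 ?invr_ge0.
have q1 : 1 <= q by rewrite lerDl sumr_ge0.
have qz z : z \in s -> `|z| <= q /\ `|z|^-1 <= q.
  move=> zs; have : `|z| + `|z|^-1 <= q.
    by rewrite /q (perm_big _ (perm_to_rem zs)) big_cons addrCA lerDl addr_ge0 ?sumr_ge0.
  by move=> h; split; apply: le_trans h; rewrite ?lerDl ?lerDr ?invr_ge0.
exists q => // n; have [rt [rts szL ->]] := H n; exists (size rt); split=> //.
  rewrite normrM normrX mulrC ler_wpM2r ?exprn_ge0 //; elim: rt rts {szL} => [|z rt IH] rts.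
    by rewrite big_nil normr1 expr0.
  rewrite big_cons normrM exprS normrN ler_pM //.
    by case: (qz z) => //; apply: rts; rewrite mem_head.
  by apply: IH => x xr; apply: rts; rewrite inE xr orbT.
rewrite normrM normrX mulrCA -[leLHS]mulr1 ler_wpM2l ?exprn_ge0 //.
elim: rt rts {szL} => [|z rt IH] rts; first by rewrite big_nil normr1 expr0 mulr1.
have zs : z \in s by apply: rts; rewrite mem_head.
rewrite big_cons normrM exprS normrN mulrACA -[leLHS]mulr1 ler_pM ?ler01 //; last first.
  by apply: IH => x xr; apply: rts; rewrite inE xr orbT.
rewrite -ler_pdivrMr ?div1r; first by case: (qz z).
by rewrite normr_gt0; apply: contraNneq s0 => <-.
Qed.

End Factor.
End DeterminantBounds.

(** * Asymptotics of the transfinite diameter *)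

Section Asymptotics.
Variable R : realType.

Lemma mul_bin_degree N n : (N.+1 * (N * 'C(N + n, N.+1)) = N * n * 'C(N + n, N))%N.
Proof. by rewrite mulnCA mul_bin_left addKn mulnA. Qed.

Lemma bin_le_exp m k : ('C(m, k) <= m ^ k)%N.
Proof.
apply: (@leq_trans (m ^_ k)); first by rewrite -bin_ffact leq_pmulr ?fact_gt0.
elim: k => [|k IH]; first by rewrite ffactn0.
by rewrite ffactnSr expnSr leq_mul // leq_subr.
Qed.

(** With M = C(N + n, N) one has (N + 1) D(n) = N n M, so it suffices that ln M = o(n). The
    inequality ln x < x at x = 2 sqrt(n), together with M <= (4 n)^N for n >= N, gives ln M <= 4 N
    sqrt(n). *)
Lemma bin_log_negligible N (kappa eta : R) : (0 < N)%N -> 0 <= kappa -> 0 < eta ->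
  exists n0, forall n, (n0 <= n)%N -> (0 < 'C(N + n, N.+1))%N /\
    'C(N + n, N)%:R * (ln 'C(N + n, N)%:R + kappa) <= eta * (N * 'C(N + n, N.+1))%N%:R.
Proof.
(* From n >= y^2 follows 2 (4 N + kappa) <= eta sqrt(n); the factor 2 absorbs (N + 1) / N. *)
move=> N0 k0 eta0; pose y : R := 2 * (4 * N%:R + kappa) / eta.
have y0 : 0 <= y by rewrite !mulr_ge0 ?invr_ge0 ?addr_ge0 ?(ltW eta0) // mulr_ge0.
exists (maxn N (Num.bound (y ^+ 2))) => n; rewrite geq_max => /andP [Nn yn].
have n0 : (0 < n)%N by exact: leq_trans Nn.
split; first by rewrite bin_gt0 -addn1 leq_add2l.
set M := 'C(N + n, N); set D := (N * _)%N.
have M0 : (0 < M)%N by rewrite bin_gt0 leq_addr.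
pose r : R := Num.sqrt n%:R.
have r2 : r ^+ 2 = n%:R by rewrite sqr_sqrtr.
have r1 : 1 <= r by rewrite -sqrtr1 ler_sqrt ?ler1n.
have r0 : 0 < r by exact: lt_le_trans r1.
have yr : y <= r.
  rewrite -(ler_pXn2r (n := 2)) ?nnegrE ?(ltW r0) // r2.
  by rewrite (le_trans (ltW (archi_boundP _))) ?exprn_ge0 // ler_nat.
have lnM_le : ln M%:R <= N%:R * (4 * r) :> R.
  have h : M%:R <= (2 * r) ^+ 2 ^+ N :> R.
    rewrite [(2 * r) ^+ 2]exprMn r2 (_ : 2 ^+ 2 * n%:R = (4 * n)%:R :> R); last by rewrite natrM -natrX.
    rewrite -natrX ler_nat (leq_trans (bin_le_exp _ _)) // leq_exp2r //.
    by apply: (@leq_trans (n + n)); [rewrite leq_add2r|lia].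
  have r20 : 0 < 2 * r by rewrite mulr_gt0.
  have := h; rewrite -ler_ln ?posrE ?ltr0n ?exprn_gt0 // !lnXn ?exprn_gt0 //.
  move=> /le_trans; apply; rewrite -[leLHS]mulr_natl ler_wpM2l // mulr2n.
  have := ltW (ln_sublinear r20); lra.
have DE : N.+1%:R * D%:R = N%:R * r ^+ 2 * M%:R :> R.
  by rewrite r2 -!natrM mul_bin_degree.
have N1 : 1 <= N%:R :> R by rewrite ler1n.
have N2 : N.+1%:R <= 2 * N%:R :> R by rewrite -natrM ler_nat; lia.
rewrite -(ler_pM2l (ltr0Sn R N)) mulrCA [leRHS]mulrCA DE mulrCA.
rewrite [leRHS](_ : _ = M%:R * (N%:R * (eta * r * r))); last by ring.
rewrite mulrCA ler_wpM2l //.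
have yr' : 2 * (4 * N%:R + kappa) <= eta * r by move: yr; rewrite /y ler_pdivrMr // [r * eta]mulrC.
have A1 : ln M%:R + kappa <= (4 * N%:R + kappa) * r.
  rewrite mulrDl lerD //; first by rewrite mulrAC mulrC (le_trans lnM_le) // mulrC.
  by rewrite ler_peMr.
have A0 : 0 <= (4 * N%:R + kappa) * r by rewrite mulr_ge0 ?addr_ge0 ?(ltW r0) ?mulr_ge0.
apply: (@le_trans _ _ (2 * N%:R * ((4 * N%:R + kappa) * r))).
  apply: le_trans (_ : N.+1%:R * ((4 * N%:R + kappa) * r) <= _).
    by rewrite ler_wpM2l.
  by rewrite ler_wpM2r.
rewrite [leLHS](_ : _ = N%:R * (2 * (4 * N%:R + kappa) * r)); last by ring.
by rewrite ler_wpM2l // ler_wpM2r // ltW.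
Qed.

Section Exponents.
Variables N d D E L S M c : nat.
Hypotheses (N_gt0 : (0 < N)%N) (d_gt0 : (0 < d)%N) (M_gt0 : (0 < M)%N).
Hypotheses (dS : (d * S <= D)%N) (LS : (L + N * d ^ N.-1 * E <= S)%N).
Hypothesis DE : (D <= N * d ^ N * E + c * M)%N.

Let eN : R := (N * d ^ N)%N%:R.

Let dN : (d ^ N = d * d ^ N.-1)%N.
Proof. by rewrite -expnS prednK. Qed.

(** Here D is D(n), S the degree of A_n, E the exponent E_n, L the degree of the quotient, and M the
    number of points. The three inequalities confine L and D - N d^N E to the range from 0 to c
    M. *)
Let L_le : L%:R <= c%:R * M%:R :> R.
Proof.
rewrite -natrM ler_nat; move: DE; rewrite dN.
have : (d * (L + N * d ^ N.-1 * E) <= D)%N by apply: leq_trans dS; rewrite leq_mul2l LS orbT.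
move: (d ^ N.-1)%N => k h1 h2.
have e : (N * (d * k) * E = d * (N * k * E))%N by lia.
rewrite e in h2; apply: (@leq_trans (d * L)); first by rewrite leq_pmull.
by rewrite mulnDr in h1; move: (d * L)%N (d * (N * k * E))%N (c * M)%N h1 h2 => *; lia.
Qed.

Let E_le : `|D%:R / eN - E%:R| <= c%:R * M%:R.
Proof.
have e1 : (1 <= N * d ^ N)%N by rewrite muln_gt0 N_gt0 expn_gt0 d_gt0.
have e0 : 0 < eN by rewrite ltr0n.
have h1 : (N * d ^ N * E <= D)%N.
  apply: leq_trans dS; rewrite dN mulnCA -!mulnA leq_mul2l.
  by rewrite (leq_trans (leq_addl L _)) ?orbT // mulnA.
have -> : D%:R / eN - E%:R = (D - N * d ^ N * E)%N%:R / eN :> R.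
  by rewrite natrB // mulrBl natrM mulrAC divff ?mul1r // gt_eqF.
rewrite ger0_norm ?divr_ge0 ?(ltW e0) // ler_pdivrMr // -!natrM ler_nat.
apply: (@leq_trans (c * M)); first by rewrite leq_subLR.
by rewrite leq_pmulr.
Qed.

(** In the logarithms E becomes D / (N d^N) and S is bounded by D / d. The errors are collected into
    a multiple of M; ln c0 has either sign and enters them in absolute value. *)
Lemma log_upper (x c0 C q lambda : R) : 0 < x -> 0 < c0 -> 1 <= C -> 1 <= q -> 1 <= lambda ->
  c0 ^+ E * x <= q ^+ L * ((M ^ M)%N%:R * (C ^+ M * lambda ^+ S)) ->
  ln x <= D%:R * (ln lambda / d%:R - ln c0 / eN) +
          M%:R * (ln M%:R + (c%:R * ln q + ln C + c%:R * `|ln c0|)).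
Proof.
move=> x0 c00 C1 q1 l1.
have C0 := lt_le_trans ltr01 C1; have q0 := lt_le_trans ltr01 q1.
have l0 := lt_le_trans ltr01 l1; have M0 : 0 < M%:R :> R by rewrite ltr0n.
have MM0 : 0 < (M ^ M)%N%:R :> R by rewrite natrX exprn_gt0.
have pc := exprn_gt0 E c00; have pq := exprn_gt0 L q0.
have pC := exprn_gt0 M C0; have pl := exprn_gt0 S l0.
have X0 := mulr_gt0 pC pl; have Y0 := mulr_gt0 MM0 X0.
have := mulr_gt0 pq Y0; have := mulr_gt0 pc x0 => Z1 Z2.
rewrite -ler_ln // (lnM pc x0) (lnM pq Y0) (lnM MM0 X0) (lnM pC pl).
rewrite natrX !lnXn // -!(mulr_natl (ln _)).
have lq := ln_ge0 q1; have ll := ln_ge0 l1; have lC := ln_ge0 C1.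
have h1 : L%:R * ln q <= c%:R * M%:R * ln q by rewrite ler_wpM2r.
have h2 : S%:R * ln lambda <= D%:R * (ln lambda / d%:R).
  rewrite mulrCA mulrC ler_wpM2l // ler_pdivlMr ?ltr0n // -natrM ler_nat.
  by rewrite mulnC.
have h3 : (D%:R / eN - E%:R) * ln c0 <= c%:R * M%:R * `|ln c0|.
  by rewrite (le_trans (ler_norm _)) // normrM ler_wpM2r.
rewrite mulrBl in h3; lra.
Qed.

Lemma log_lower (x c0 tau q rho : R) : 0 < x -> 0 < c0 -> 0 < tau -> 1 <= q ->
  0 < rho -> rho <= 1 -> tau ^+ M * rho ^+ S <= q ^+ L * (c0 ^+ E * x) ->
  D%:R * (ln rho / d%:R - ln c0 / eN) -
    M%:R * (`|ln tau| + c%:R * ln q + c%:R * `|ln c0|) <= ln x.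
Proof.
move=> x0 c00 t0 q1 r0 r1; have q0 := lt_le_trans ltr01 q1.
have M0 : 0 < M%:R :> R by rewrite ltr0n.
have pc := exprn_gt0 E c00; have pq := exprn_gt0 L q0.
have pt := exprn_gt0 M t0; have pr := exprn_gt0 S r0.
have X0 := mulr_gt0 pc x0; have := mulr_gt0 pt pr; have := mulr_gt0 pq X0 => Z1 Z2.
rewrite -ler_ln // (lnM pt pr) (lnM pq X0) (lnM pc x0) !lnXn // -!(mulr_natl (ln _)).
have lq := ln_ge0 q1; have lr := ln_le0 r1.
have h1 : L%:R * ln q <= c%:R * M%:R * ln q by rewrite ler_wpM2r.
have h2 : D%:R * (ln rho / d%:R) <= S%:R * ln rho.
  rewrite mulrCA mulrC -subr_le0 -mulrBl mulr_ge0_le0 // subr_ge0.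
  by rewrite ler_pdivlMr ?ltr0n // -natrM ler_nat mulnC.
have h3 : - (c%:R * M%:R * `|ln c0|) <= (D%:R / eN - E%:R) * ln c0.
  by rewrite lerNl (le_trans (ler_norm _)) // normrN normrM ler_wpM2r.
have h4 : - (M%:R * `|ln tau|) <= M%:R * ln tau.
  by rewrite lerNl -mulrN ler_wpM2l // (le_trans (ler_norm _)) // normrN.
rewrite mulrBl in h3; lra.
Qed.

End Exponents.
End Asymptotics.

Local Open Scope classical_set_scope.
Import Normc.

(** * Logarithmic estimates over the complex numbers *)

Section ComplexModulus.
Variable R : realType.

Lemma complex_ge0P (z : R[i]) : 0 <= z -> exists2 r : R, 0 <= r & z = r%:C%C.
Proof.
move=> z0; have /complex_realP [r zr] := ger0_real z0.
by exists r => //; rewrite -ler0c -zr.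
Qed.

Lemma ln_near (x eta : R) : 0 < x -> 0 < eta ->
  exists2 delta, 0 < delta & forall y, `|y - x| <= delta -> 0 < y /\ `|ln y - ln x| <= eta.
Proof.
move=> x0 eta0.
have /cvgrPdist_le /(_ eta eta0) /nbhs_ballP [e /= e0 He] := continuous_ln x0.
exists (Num.min (e / 2) (x / 2)); first by rewrite lt_min !divr_gt0.
move=> y; rewrite le_min => /andP [ye yx]; split.
  by move: yx; rewrite ler_norml => /andP [h _]; lra.
rewrite distrC; apply: He; rewrite /ball /= distrC (le_lt_trans ye) //.
by rewrite ltr_pdivrMr // ltr_pMr // ltr1n.
Qed.

Lemma exists_small_nonroot (p : {poly R[i]}) (e : R) : 0 < e -> p != 0 ->
  exists s : R, [/\ 0 < s, s <= e & p.[s%:C%C] != 0].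
Proof.
move=> e0 p0; apply: contrapT => /forallNP h.
pose u k : R := e / k.+1%:R.
have u0 k : 0 < u k by rewrite divr_gt0.
have ue k : u k <= e by rewrite ler_pdivrMr // ler_peMr ?ler1n ?ltW.
have := max_poly_roots p0 (rs := [seq (u k)%:C%C | k <- iota 0 (size p)]).
rewrite size_map size_iota ltnn => H; suff: false by [].
apply: (H).
  apply/allP => _ /mapP [k _ ->]; apply: contrapT => /negP pk.
  by apply: (h (u k)); split.
rewrite map_inj_uniq ?iota_uniq // => k l /complexI /(mulfI (lt0r_neq0 e0)) /invr_inj /eqP.
by rewrite eqr_nat => /eqP [].
Qed.

End ComplexModulus.

Section DiameterEstimates.
Variables (R : realType) (N d : nat).
Hypotheses (N_gt0 : (0 < N)%N) (d_gt0 : (0 < d)%N).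
Local Notation M n := #|{: 'X_{1..N < n.+1}}|.
Local Notation D n := (N * 'C(N + n, N.+1))%N.
Variable P : {mpoly R[i][#|coef_index N d|]}.
Hypothesis P_prime : prime_elt P.
Hypothesis P_zero : forall a, P.@[a] = 0 <-> common_zero (tuple_of a).
Hypothesis P_Xn : P.@[@coefs_Xn R[i] N d] = 1.
Variable F : 'I_N -> {mpoly R[i][N]}.
Hypothesis F_deg : forall i, deg_le d (F i).
Variable a : 'I_#|coef_index N d| -> R[i].
Hypothesis F_lead : forall i, pihomog mdeg d (F i) = tuple_of a i.
Hypothesis a_det : forall k, (k <= N * d)%N -> adapted_det d (tuple_of a) k != 0.
Hypothesis Pa : P.@[a] != 0.

Let c0 := normc P.@[a].
Let c0_gt0 : 0 < c0.
Proof. by rewrite -ltcR; change (0 < `|P.@[a]|); rewrite normr_gt0. Qed.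

Let F_adapted n : adapted_det d F n = adapted_det d (tuple_of a) n.
Proof. by apply: adapted_det_same_top => i; rewrite -F_lead; exact: same_top_lead. Qed.

Let F_det n : adapted_det d F n != 0.
Proof.
by apply: (adapted_det_neq0 N_gt0 d_gt0 F_deg) => k kN; rewrite F_adapted; exact: a_det.
Qed.

Let sum_le n : (d * det_degree N d n <= D n)%N := sum_mdeg_div d n N_gt0.
Let order_ge n : (D n <= N * d ^ N * resultant_order N d n +
  N * d ^ N * N.+1 ^ 2 * 'C(N + n, N))%N := sum_degree_le (Ordinal N_gt0) d_gt0 n.
Let M_gt0 n : (0 < 'C(N + n, N))%N.
Proof. by rewrite bin_gt0 leq_addr. Qed.

(** In the application [lambda] exceeds 1: the points are those of K, while F is a perturbation of
    the given map. *)
Lemma log_det_upper (B : R[i]) (lambda : R) : 1 <= lambda -> exists2 kappa, 0 <= kappa &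
  forall n (z : 'I_(M n) -> 'I_N -> R[i]), (forall j i, `|z j i| <= B) ->
  (forall j i, `|(F i).@[z j]| <= lambda%:C%C) -> 0 < normc (monomial_det z) ->
  ln (normc (monomial_det z)) <=
    (D n)%:R * (ln lambda / d%:R - ln c0 / (N * d ^ N)%N%:R) +
    'C(N + n, N)%:R * (ln 'C(N + n, N)%:R + kappa).
Proof.
move=> l1; have l1' : 1 <= lambda%:C%C by rewrite -(rmorph1 (real_complex R)) lecR.
have [C C1 HC] := monomial_det_upper d_gt0 F_deg B l1'.
have [q q1 Hq] := adapted_det_bounds N_gt0 d_gt0 P_prime P_zero P_Xn a_det.
have [C' C'0 eC] := complex_ge0P (le_trans ler01 C1).
have [q' q'0 eq] := complex_ge0P (le_trans ler01 q1).
have C'1 : 1 <= C' by rewrite -lecR rmorph1 -eC.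
have q'1 : 1 <= q' by rewrite -lecR rmorph1 -eq.
exists ((N * d ^ N * N.+1 ^ 2)%N%:R * ln q' + ln C' + (N * d ^ N * N.+1 ^ 2)%N%:R * `|ln c0|).
  by rewrite !addr_ge0 ?mulr_ge0 ?ln_ge0.
move=> n z zB zF; have := HC n z zB zF; have [L [LS _ HL]] := Hq n.
rewrite -[\det _]/(monomial_det z) F_adapted card_bmultinom //.
move: (monomial_det z) => {zB zF} x; move=> hx x0.
apply: (log_upper N_gt0 d_gt0 (M_gt0 n) (sum_le n) LS (order_ge n) x0 c0_gt0 C'1 q'1 l1).
rewrite -lecR !rmorphM !rmorphXn /= rmorph_nat -eC -eq.
rewrite -[(normc x)%:C%C]/(`|x|) -[c0%:C%C]/(`|P.@[a]|).
apply: (@le_trans _ _ (q ^+ L * `|adapted_det d (tuple_of a) n| * `|x|)).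
  by rewrite ler_wpM2r.
rewrite -[leLHS]mulrA; rewrite natrX in hx; apply: ler_wpM2l hx.
by rewrite exprn_ge0 // (le_trans ler01).
Qed.

Lemma log_det_lower (B : R[i]) (rho eta : R) : 0 < rho -> rho <= 1 -> 0 < eta ->
  (forall z, (forall i, `|(F i).@[z]| <= (rho + eta)%:C%C) -> forall i, `|z i| <= B) ->
  exists2 kappa, 0 <= kappa & forall n, exists z : 'I_(M n) -> 'I_N -> R[i],
  [/\ forall j i, `|(F i).@[z j]| <= (rho + eta)%:C%C, 0 < normc (monomial_det z) &
  (D n)%:R * (ln rho / d%:R - ln c0 / (N * d ^ N)%N%:R) - 'C(N + n, N)%:R * kappa <=
    ln (normc (monomial_det z))].
Proof.
move=> r0 r1 eta0 FB.
have r0' : 0 < rho%:C%C by rewrite -(rmorph0 (real_complex R)) ltcR.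
have eta0' : 0 < eta%:C%C by rewrite -(rmorph0 (real_complex R)) ltcR.
have [|tau tau0 Ht] := monomial_det_lower (B := B) d_gt0 F_deg F_det r0' eta0'.
  by rewrite -rmorphD.
have [q q1 Hq] := adapted_det_bounds N_gt0 d_gt0 P_prime P_zero P_Xn a_det.
have [t' t'0 et] := complex_ge0P (ltW tau0).
have [q' q'0 eq] := complex_ge0P (le_trans ler01 q1).
have t'1 : 0 < t' by rewrite -ltcR rmorph0 -et.
have q'1 : 1 <= q' by rewrite -lecR rmorph1 -eq.
exists (`|ln t'| + (N * d ^ N * N.+1 ^ 2)%N%:R * ln q' + (N * d ^ N * N.+1 ^ 2)%N%:R * `|ln c0|).
  by rewrite !addr_ge0 ?mulr_ge0 ?ln_ge0.
move=> n; have [z zF hz] := Ht n; have [L [LS HL _]] := Hq n; exists z.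
move: hz; rewrite -[\det _]/(monomial_det z) => hz.
have x0 : 0 < normc (monomial_det z).
  rewrite -ltcR -[(normc _)%:C%C]/(`|monomial_det z|) rmorph0 lt_neqAle normr_ge0 andbT eq_sym.
  apply: contraTneq hz => ->.
  rewrite [leRHS]mulr0.
  by rewrite (lt_geF (mulr_gt0 (exprn_gt0 _ tau0) (exprn_gt0 _ r0'))).
split; [by rewrite rmorphD|by []|]; move: hz x0; rewrite F_adapted card_bmultinom //.
move: (monomial_det z) => {z zF} x hx x0.
apply: (log_lower N_gt0 d_gt0 (M_gt0 n) (sum_le n) LS (order_ge n) x0 c0_gt0 t'1 q'1 r0 r1).
rewrite -lecR !rmorphM !rmorphXn /= -et -eq.
rewrite -[(normc x)%:C%C]/(`|x|) -[c0%:C%C]/(`|P.@[a]|).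
by rewrite (le_trans hx) // mulrA ler_wpM2r.
Qed.

End DiameterEstimates.

(** * Perturbing the map, and the limit *)

Section Perturbations.
Variables (K : numClosedFieldType) (N d : nat).
Hypothesis d_gt0 : (0 < d)%N.
Variable F : 'I_N -> {mpoly K[N]}.
Hypothesis F_deg : forall i, deg_le d (F i).
Variable a : 'I_#|coef_index N d| -> K.
Hypothesis F_lead : forall i, pihomog mdeg d (F i) = tuple_of a i.
Let as_ t (k : 'I_#|coef_index N d|) := a k + t * @coefs_Xn K N d k.

Lemma tuple_of_perturbed t i : tuple_of (as_ t) i = tuple_of a i + t *: 'X_i ^+ d.
Proof. by rewrite tuple_of_line tuple_of_coefs // => j; exact: homog_Xn. Qed.

Lemma deg_le_perturbed t i : deg_le d (F i + t *: 'X_i ^+ d).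
Proof.
move=> m dm; rewrite mcoeffD F_deg // mcoeffZ.
by rewrite (homog_deg_le (homog_Xn K d i)) // mulr0 addr0.
Qed.

Lemma lead_perturbed t i : pihomog mdeg d (F i + t *: 'X_i ^+ d) = tuple_of (as_ t) i.
Proof.
by rewrite linearD /= linearZ /= F_lead (pihomog_dE (homog_Xn K d i)) tuple_of_perturbed.
Qed.

(** Each A_k is monic in t along the line towards (X_i^d), so the product over k <= N d is a nonzero
    polynomial, and only its roots are to be avoided. *)
Lemma adapted_det_perturbed : exists2 p : {poly K}, p != 0 & forall t, p.[t] != 0 ->
  forall k, (k <= N * d)%N -> adapted_det d (tuple_of (as_ t)) k != 0.
Proof.
pose p k := mline a (@coefs_Xn K N d) (generic_det N d K k).
exists (\prod_(k < (N * d).+1) p k).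
  apply/prodf_neq0 => k _; apply/eqP => p0.
  have [_] := top_coef_mline a (@coefs_Xn K N d) (generic_det_homog N d K k).
  rewrite -/(p k) p0 coef0 meval_generic_det tuple_of_coefs; last exact: homog_Xn.
  by rewrite adapted_det_Xn => /eqP; rewrite eq_sym oner_eq0.
move=> t; rewrite horner_prod => /prodf_neq0 pt k; rewrite -ltnS => kN.
by have := pt (Ordinal kN) isT; rewrite horner_mline meval_generic_det.
Qed.

End Perturbations.

(** In the application [T] is the logarithm of the supremum, [l1] and [l2] are those of the radii
    divided by d, and [lp] and [l0] those of the perturbed and the given resultant divided by N
    d^N. *)
Lemma squeeze_estimate (R : realFieldType) (T l1 l2 lp l0 m1 m2 Q eta : R) : 0 < Q ->
  `|l1| <= eta -> `|l2| <= eta -> `|lp - l0| <= eta -> m1 <= eta * Q -> m2 <= eta * Q ->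
  T <= Q * (l1 - lp) + m1 -> Q * (l2 - lp) - m2 <= T -> `|Q^-1 * T - - l0| <= 3 * eta.
Proof.
move=> Q0; rewrite !ler_norml => /andP [_ h1] /andP [h2 _] /andP [h3 h4] h5 h6 h7 h8.
have k1 : Q * (l1 - lp) <= Q * (2 * eta - l0) by rewrite ler_wpM2l ?(ltW Q0) //; lra.
have k2 : Q * (- (2 * eta) - l0) <= Q * (l2 - lp) by rewrite ler_wpM2l ?(ltW Q0) //; lra.
rewrite opprK; apply/andP; split.
  by rewrite -lerBlDr ler_pdivlMl //; lra.
by rewrite -lerBrDr ler_pdivrMl //; lra.
Qed.

Section Diameter.
Variables (R : realType) (N d : nat).
Hypotheses (N_gt0 : (0 < N)%N) (d_gt0 : (0 < d)%N).
Local Notation M n := #|{: 'X_{1..N < n.+1}}|.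
Local Notation D n := (N * 'C(N + n, N.+1))%N.
Variable P : {mpoly R[i][#|coef_index N d|]}.
Hypothesis P_prime : prime_elt P.
Hypothesis P_zero : forall a, P.@[a] = 0 <-> common_zero (tuple_of a).
Hypothesis P_Xn : P.@[@coefs_Xn R[i] N d] = 1.
Variable F : 'I_N -> {mpoly R[i][N]}.
Hypothesis F_deg : forall i, deg_le d (F i).
Variable a : 'I_#|coef_index N d| -> R[i].
Hypothesis F_lead : forall i, pihomog mdeg d (F i) = tuple_of a i.
Hypothesis Pa : P.@[a] != 0.

Let dets n := [set normc (monomial_det zeta) | zeta in
  [set zeta : 'I_(M n) -> 'I_N -> R[i] | forall j, unit_polyhedron F (zeta j)]].
Let ell : R := - (ln (normc P.@[a]) / (N * d ^ N)%N%:R).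

Let normC (z : R[i]) : (normc z)%:C%C = `|z|. Proof. by []. Qed.

Let normc_gt0 (z : R[i]) : z != 0 -> 0 < normc z.
Proof. by move=> z0; rewrite -ltcR normC normr_gt0. Qed.

Lemma log_sup_dets eta : 0 < eta -> exists n0, forall n, (n0 <= n)%N ->
  0 < sup (dets n) /\ `|(D n)%:R^-1 * ln (sup (dets n)) - ell| <= eta.
Proof.
have small (x : R) : 0 < x -> 4 * x <= 1 -> [/\ 0 < 1 - 2 * x, 1 - 2 * x <= 1,
    1 - 2 * x + x <= 1 & 1 - 2 * x + x + x <= 1] by move=> ? ?; split; lra.
move=> eta0; pose eta' := eta / 3; have eta'0 : 0 < eta' by rewrite divr_gt0.
have [e [B [e0 B0 HB]]] := perturbed_bounded N_gt0 d_gt0 P_zero Pa F_deg F_lead.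
have [C C0 HC] := meval_lipschitz P a.
have [e' _ ee] := complex_ge0P (ltW e0); have [B' _ eB] := complex_ge0P (ltW B0).
have [C' _ eC] := complex_ge0P (ltW C0).
have e'0 : 0 < e' by rewrite -ltcR rmorph0 -ee.
have B'0 : 0 < B' by rewrite -ltcR rmorph0 -eB.
have C'0 : 0 < C' by rewrite -ltcR rmorph0 -eC.
(* On points bounded by B the perturbation changes each F_i by at most s beta. *)
pose beta := B' ^+ d; have beta0 : 0 < beta by exact: exprn_gt0.
set c0 := normc P.@[a]; have c00 : 0 < c0 by exact: normc_gt0.
have [d1 d10 Hd1] := ln_near (ltr01 : 0 < 1 :> R) eta'0.
have [d2 d20 Hd2] := ln_near c00 eta'0.
have [p p0 Hp] := adapted_det_perturbed a.
(* In this order: the uniform bound B applies; the Lipschitz estimate applies; the two resultants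
   are close; 1 + s beta and 1 - 2 s beta are close to 1; the latter is positive. *)
pose s0 := Num.min e' (Num.min 1 (Num.min (d2 / C') (Num.min (d1 / (2 * beta)) (1 / (4 * beta))))).
have s00 : 0 < s0 by rewrite !lt_min e'0 ltr01 !divr_gt0 ?mulr_gt0.
have [s [s_gt0 ss0 ps]] := exists_small_nonroot s00 p0.
move: ss0; rewrite !le_min => /and5P [se s1 sC sd1 sb].
rewrite ler_pdivlMr // in sC; rewrite ler_pdivlMr ?mulr_gt0 // in sd1.
rewrite ler_pdivlMr ?mulr_gt0 // in sb.
have sd2 : 2 * (s * beta) <= d1 by rewrite mulrCA.
have sb0 : 0 < s * beta by exact: mulr_gt0.
have [r0 r1 r2 r3] : [/\ 0 < 1 - 2 * (s * beta), 1 - 2 * (s * beta) <= 1,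
    1 - 2 * (s * beta) + s * beta <= 1 & 1 - 2 * (s * beta) + s * beta + s * beta <= 1].
  by apply: small => //; rewrite mulrCA.
have s_norm : `|s%:C%C| = s%:C%C :> R[i] by rewrite ger0_norm // ler0c ltW.
have se' : `|s%:C%C| <= e by rewrite s_norm ee lecR.
pose t : R[i] := s%:C%C.
pose a' k := a k + t * @coefs_Xn R[i] N d k; pose F' i := F i + t *: 'X_i ^+ d.
have a'_det := Hp _ ps.
have coefs1 k : `|@coefs_Xn R[i] N d k| <= 1.
  by rewrite /coefs_Xn /coefs_of mpolyXn mcoeffX; case: eqP; rewrite ?normr1 ?normr0.
have c'_near : `|normc P.@[a'] - c0| <= d2.
  have h : normc (P.@[a'] - P.@[a]) <= d2.
    apply: le_trans sC; rewrite -lecR normC mulrC rmorphM /= -eC; apply: HC.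
    - by rewrite ler0c ltW.
    - by rewrite -(rmorph1 (real_complex R)) lecR.
    - by move=> k; rewrite normrM s_norm ler_piMr // ler0c ltW.
  apply: le_trans h; rewrite ler_norml -lecR -[X in _ && X]lecR.
  rewrite rmorphN !rmorphB /= !normC lerBlDr lerNl opprB; apply/andP; split.
    by rewrite lerBlDr -{1}[P.@[a]](subrK P.@[a']) distrC ler_normD.
  by rewrite -{1}[P.@[a']](subrK P.@[a]) ler_normD.
have [c'0 lnc'] := Hd2 _ c'_near.
have Pa' : P.@[a'] != 0.
  by apply: contraTneq c'0 => ->; rewrite normc0 ltxx.
have F'_deg i : deg_le d (F' i) by exact: deg_le_perturbed.
have F'_lead i : pihomog mdeg d (F' i) = tuple_of a' i by exact: lead_perturbed.
have E_bounded z : unit_polyhedron F z -> forall i, `|z i| <= B.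
  move=> zE; apply: (HB 0); first by rewrite normr0 ltW.
  by move=> i; rewrite scale0r addr0 -normC -(rmorph1 (real_complex R)) lecR.
have shift_le z (i : 'I_N) : (forall i, `|z i| <= B) -> `|(t *: 'X_i ^+ d).@[z]| <= (s * beta)%:C%C.
  move=> zB; rewrite mevalZ (rmorphXn (meval z)) /= mevalXU normrM normrX s_norm.
  rewrite rmorphM rmorphXn /= -eB ler_wpM2l ?ler0c ?(ltW s_gt0) //.
  by rewrite lerXn2r ?nnegrE // ltW.
have [|ka ka0 Hup] := log_det_upper N_gt0 d_gt0 P_prime P_zero P_Xn F'_deg F'_lead a'_det
  Pa' B (lambda := 1 + s * beta); first by rewrite lerDl ltW.
(* Since rho + eta = 1 - s beta, the points found for the perturbed map satisfy |F_i| <= 1 and lie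
   in K. *)
have [||||kb kb0 Hlow] := log_det_lower N_gt0 d_gt0 P_prime P_zero P_Xn F'_deg F'_lead a'_det
  Pa' (B := B) (rho := 1 - 2 * (s * beta)) (eta := s * beta).
- exact: r0.
- exact: r1.
- exact: sb0.
- move=> z zF; apply: (HB t se') => i; apply: le_trans (zF i) _.
  by rewrite -(rmorph1 (real_complex R)) lecR.
have [n0 Hn0] := bin_log_negligible N_gt0 (addr_ge0 ka0 kb0) eta'0.
exists n0 => n /Hn0 [bin0 Mle].
have D_gt0 : 0 < (D n)%:R :> R by rewrite ltr0n muln_gt0 N_gt0.
set X := (D n)%:R * (ln (1 + s * beta) / d%:R - ln (normc P.@[a']) / (N * d ^ N)%N%:R) +
  'C(N + n, N)%:R * (ln 'C(N + n, N)%:R + ka).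
have ub x : dets n x -> x <= expR X.
  case=> z zE <-; have [->|z0] := eqVneq (monomial_det z) 0.
    by rewrite normc0 expR_ge0.
  have x0 := normc_gt0 z0; rewrite -(lnK x0) ler_expR; apply: Hup x0 => j.
    exact: E_bounded.
  move=> i; rewrite mevalD (le_trans (ler_normD _ _)) // rmorphD lerD //.
    by rewrite -normC lecR; exact: zE.
  by apply: shift_le; exact: E_bounded.
have [z [zF x0 lex]] := Hlow n.
have zE : dets n (normc (monomial_det z)).
  exists z => // j i /=; rewrite -lecR rmorph1 normC.
  have zB : forall i, `|z j i| <= B.
    apply: (HB t se') => k; apply: le_trans (zF j k) _.
    by rewrite -(rmorph1 (real_complex R)) lecR.
  rewrite -[F i](addrK (t *: 'X_i ^+ d)) mevalB (le_trans (ler_normB _ _)) //.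
  rewrite (le_trans (lerD (zF j i) (shift_le _ i zB))) // -rmorphD.
  by rewrite -(rmorph1 (real_complex R)) lecR.
have has_ub : has_ubound (dets n) by exists (expR X).
have sup_ge : normc (monomial_det z) <= sup (dets n) by exact: ub_le_sup.
have sup_gt0 : 0 < sup (dets n) by exact: lt_le_trans sup_ge.
have sup_le : ln (sup (dets n)) <= X.
  rewrite -[X]expRK ler_ln ?posrE ?expR_gt0 //; apply: ge_sup ub.
  by exists (normc (monomial_det z)).
have lns : ln (normc (monomial_det z)) <= ln (sup (dets n)) by rewrite ler_ln ?posrE.
have {lns}lex := le_trans lex lns.
split=> //; rewrite /ell -/c0.
have dR : 1 <= d%:R :> R by rewrite ler1n.
have eN1 : 1 <= (N * d ^ N)%N%:R :> R by rewrite ler1n muln_gt0 N_gt0 expn_gt0 d_gt0.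
have div_small (x y : R) : 1 <= y -> `|x| <= eta' -> `|x / y| <= eta'.
  move=> y1 h; have y0 : 0 < y by exact: lt_le_trans y1.
  rewrite normrM [`|y^-1|]ger0_norm ?invr_ge0 ?(ltW y0) // -[leRHS]mulr1 ler_pM //.
    by rewrite invr_ge0 ltW.
  by rewrite invf_le1.
have near1 (x y : R) : 0 < x -> x <= d1 -> y = x \/ y = - x -> `|ln (1 + y) / d%:R| <= eta'.
  move=> x0' xd1 yx; apply: div_small => //; have [|_] := Hd1 (1 + y); last by rewrite ln1 subr0.
  rewrite addrAC subrr add0r; apply: le_trans xd1.
  by case: yx => ->; rewrite ?normrN gtr0_norm.
have M1 : 1 <= 'C(N + n, N)%:R :> R by rewrite ler1n mathcomp.boot.binomial.bin_gt0 leq_addr.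
have M0 := lt_le_trans ltr01 M1.
have -> : eta = 3 * eta' by rewrite /eta'; field.
apply: squeeze_estimate D_gt0 _ _ _ _ _ sup_le lex.
- by apply: (near1 (s * beta)); [| |left]; rewrite ?(le_trans _ sd2) // ler_peMl ?ler1n // ltW.
- by apply: (near1 (2 * (s * beta))); [exact: mulr_gt0| |right].
- by rewrite -mulrBl; exact: div_small.
- by apply: le_trans Mle; rewrite ler_pM2l // lerD2l lerDl.
- apply: le_trans Mle; rewrite ler_pM2l // addrA lerDr.
  by rewrite addr_ge0 // ln_ge0.
Qed.
End Diameter.

(** * The resultant and the final statement *)

Section ResultantOfTuples.
Variables (R : realType) (N d : nat).
Hypothesis d_gt0 : (0 < d)%N.
Implicit Types (H : 'I_N -> {mpoly R[i][N]}).

Lemma tuple_coefsE H : tuple_coefs H = coefs_of H :> ('I_#|coef_index N d| -> R[i]).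
Proof. by apply: funext => k; rewrite /tuple_coefs /coefs_of; case: enum_val. Qed.

Lemma coefs_of_tuple (a : 'I_#|coef_index N d| -> R[i]) : coefs_of (tuple_of a) = a.
Proof.
apply: funext => k; rewrite /coefs_of mcoeff_tuple_of -surjective_pairing.
by rewrite enum_valK.
Qed.

(** For d >= 1 the origin is always a zero, so the locus differs from it exactly when there is
    another point. *)
Lemma common_zeroP H : (forall i, H i \is d.-homog) ->
  common_zero H <-> zero_locus H <> [set fun=> 0].
Proof.
move=> Hd; split=> [[z [[i zi] Hz]] eH|neH].
  have : zero_locus H z by exact: Hz.
  by rewrite eH => /= z0; rewrite z0 eqxx in zi.
apply: contrapT => nz; apply: neH; apply/seteqP; split=> [z Hz|z -> i].
  apply: funext => i; apply: contrapT => /eqP zi; apply: nz.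
  by exists z; split=> //; exists i.
have := meval_homog_scale (fun=> 0) 0 (Hd i); rewrite expr0n gtn_eqF // mulr0n [RHS]mul0r => h.
by rewrite -[RHS]h; apply: meval_eq => k; rewrite mulr0.
Qed.

Variable Res : resultant_poly N d.
Hypothesis hRes : is_resultant R Res.

Lemma resultant_prime : prime_elt (complexify R Res).
Proof. by apply: factorial_irreducible_prime; [exact: factorial_mpoly|case: hRes]. Qed.

Lemma resultant_zero a : (complexify R Res).@[a] = 0 <-> common_zero (tuple_of a).
Proof.
have [_ /(_ _ (tuple_of_homog a)) h _] := hRes.
rewrite (common_zeroP (tuple_of_homog a)) -h /eval_coefs tuple_coefsE coefs_of_tuple.
by split=> [->|/negP/negPn/eqP //]; apply/negP; rewrite negbK.
Qed.

Lemma resultant_Xn : (complexify R Res).@[@coefs_Xn R[i] N d] = 1.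
Proof. by case: hRes => _ _ <-; rewrite /eval_coefs tuple_coefsE. Qed.

End ResultantOfTuples.

Lemma cvgn_powR (R : realType) (x e : nat -> R) (l : R) :
  (forall eta, 0 < eta -> exists n0, forall n, (n0 <= n)%N ->
    0 < x n /\ `|e n * ln (x n) - l| <= eta) ->
  (fun n => x n `^ e n) @ \oo --> expR l.
Proof.
move=> H; have lim : (fun n => e n * ln (x n)) @ \oo --> l.
  apply/cvgrPdist_le => eta /H [n0 Hn0]; near=> n; rewrite distrC.
  have nn0 : (n0 <= n)%N by near: n; exact: nbhs_infty_ge.
  by have [_] := Hn0 n nn0.
have h := cvg_comp _ _ lim (@continuous_expR R l); apply: cvg_trans h.
apply: near_eq_cvg; have [n0 Hn0] := H 1 ltr01; near=> n.
have nn0 : (n0 <= n)%N by near: n; exact: nbhs_infty_ge.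
(* Positivity excludes the base 0, for which [powR] is defined separately. *)
by have [x0 _] := Hn0 n nn0; rewrite /powR gt_eqF.
Unshelve. all: by end_near. Qed.

Theorem corollary1p3 (R : realType) (N d : nat) (hN : (1 <= N)%N)
    (hd : (1 <= d)%N) (F : 'I_N -> {mpoly R[i][N]}) (hF : regular_map d F)
    (Res : resultant_poly N d) (hRes : is_resultant R Res) :
  cvgn (nth_diameter (unit_polyhedron F)) /\
  transfinite_diameter (unit_polyhedron F) =
    Normc.normc (eval_coefs Res (lead_part d F)) `^ (- ((N * d ^ N)%N%:R)^-1).
Proof.
have [F_size F_reg] := hF.
have F_deg i : deg_le d (F i) by apply/deg_leP; rewrite F_size.
have lead_homog i : lead_part d F i \is d.-homog by exact: pihomogP.
have F_lead i : pihomog mdeg d (F i) =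
    tuple_of (tuple_coefs (lead_part d F) : 'I_#|coef_index N d| -> R[i]) i.
  by rewrite tuple_coefsE (tuple_of_coefs lead_homog).
have res0 : eval_coefs Res (lead_part d F) != 0.
  by have [_ /(_ _ lead_homog) [_ h] _] := hRes; exact: h.
have lim : nth_diameter (unit_polyhedron F) @ \oo -->
    normc (eval_coefs Res (lead_part d F)) `^ (- ((N * d ^ N)%N%:R)^-1).
  (* The special case of base 0 is ruled out by the regularity of F_h. *)
  rewrite /powR; case: eqP => [/eq0_normc /eqP|_]; first by rewrite (negbTE res0).
  rewrite mulNr mulrC; apply: cvgn_powR => eta.
  exact: (log_sup_dets hN hd (resultant_prime hRes) (resultant_zero hd hRes)
    (resultant_Xn hRes) F_deg F_lead res0).
by split; [exact: cvgP lim|exact: cvg_lim lim].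
Qed.
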